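(* The relation $\sim$ on $\widehat L(\mathscr A)$ is an equivalence relation, and the quotient space $\mathfrak S=\widehat L(\mathscr A)/{\sim}$ 1. is compact, metrizable and connected; 2. fibres over the circle $\mathbb R/\mathbb Z$ with fibre $L(\mathscr A)$; the monodromy around the circle induces the homeomorphism $\mu$ (the shift action of the Thue-Morse system) on the fibre; 3. admits a quotient map to the $2$-adic solenoid $\mathbb S_2=(\mathbb Z_2\times\mathbb R)/\big((z,t+1)\sim(z+1,t)\big)$, induced by forgetting alphabet decorations, i.e. by sending a bi-infinite path with labels $\big((i_n)_{j_n}\big)_{n\in\mathbb Z}$ to the class of $\big(\sum_{n\ge0}i_n2^n,\ \sum_{n<0}i_n2^n\big)$; its fibres have cardinality $2$ or $4$. Moreover, there is a homeomorphism from $\mathfrak S$ to $$\mathfrak T=\frac{(\mathbb Z/2\times\widetilde{\mathbb Z}_2)\times[0,1]}{\big((s,z),1\big)\sim\big((s+\phi(z+1),z+1),0\big)},$$ a two-point extension $\mathbb Z/2\cdot\Big(\frac{\widetilde{\mathbb Z}_2\times[0,1]}{(z,1)\sim(z+1,0)}\Big)$ of the suspension of $\widetilde{\mathbb Z}_2$, which transports the action on $\mathfrak S$ of $\mathbb Z$ generated by the homeomorphism induced by $\widehat\mu$ to ''addition with cocycle'' $\big((s,z),x\big)\mapsto\big((s+\phi(z+1),z+1),x\big)$, and under which the map $\mathfrak S\to\mathbb S_2$ becomes the map induced by the natural map $\widetilde{\mathbb Z}_2\to\mathbb Z_2$ and the trivial map $\mathbb Z/2\to1$.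
   Context: **The automaton $\mathscr A$.** $\mathscr A$ is the directed graph with vertices $a,b,c,d,e,f$ and labelled edges $1_b\colon a\to b$; $1_c\colon a\to c$; $1_a\colon b\to a$; $0_c\colon b\to c$; $0_b\colon c\to b$; $0_f\colon c\to f$; $0_a\colon d\to a$; $0_e\colon d\to e$; $0_d\colon e\to d$; $1_f\colon e\to f$; $1_d\colon f\to d$; $1_e\colon f\to e$. The subscript is the end vertex; every vertex $j$ has exactly two incoming edges, $0_j$ (''minimal'') and $1_j$ (''maximal''). $L(\mathscr A)$ is the space of right-infinite paths (indexed by $\mathbb N$, starting at any vertex) and $\widehat L(\mathscr A)$ the space of bi-infinite paths (indexed by $\mathbb Z$), identified with their label sequences and with the topology induced by the product topology. **The homeomorphism $\mu$ of $L(\mathscr A)$.** If $z=z_0z_1\cdots\in L(\mathscr A)$ has some minimal edge, let $n$ be least with $z_n$ minimal, $z_n=0_j$; then $\mu(z)=z'_0\cdots z'_{n-1}\,1_j\,z_{n+1}z_{n+2}\cdots$ where $z'_0\cdots z'_{n-1}$ is the unique path consisting of minimal edges and ending at the start vertex of the edge $1_j$. On the four all-maximal paths $\mu$ is extended by continuity: $(1_b1_a)^\omega\mapsto(0_e0_d)^\omega$, $(1_a1_b)^\omega\mapsto(0_d0_e)^\omega$, $(1_f1_e)^\omega\mapsto(0_c0_b)^\omega$, $(1_e1_f)^\omega\mapsto(0_b0_c)^\omega$. ($L(\mathscr A)$ with $\mu$ is a model of the Thue-Morse shift.) **The automaton $\mathscr A_\mu$.** It contains $\mathscr A$, with every label $i_j$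 read as $i_j|i_j$, together with ten more states $\mu_{jk}$ and edges: $\mu_{ca}\to b$ labelled $0_b|1_b$; $\mu_{ba}\to c$ labelled $0_c|1_c$; $\mu_{ce}\to f$ labelled $0_f|1_f$; $\mu_{df}\to e$ labelled $0_e|1_e$; $\mu_{ef}\to d$ labelled $0_d|1_d$; $\mu_{db}\to a$ labelled $0_a|1_a$; $\mu_{ad}\to\mu_{ca}$ labelled $1_c|0_a$; $\mu_{ad}\to\mu_{ba}$ labelled $1_b|0_a$; $\mu_{ad}\to\mu_{ce}$ labelled $1_c|0_e$; $\mu_{ad}\to\mu_{be}$ labelled $1_b|0_e$; $\mu_{be}\to\mu_{ad}$ labelled $1_a|0_d$; $\mu_{fc}\to\mu_{db}$ labelled $1_d|0_b$; $\mu_{fc}\to\mu_{ef}$ labelled $1_e|0_f$; $\mu_{fc}\to\mu_{df}$ labelled $1_d|0_f$; $\mu_{fc}\to\mu_{eb}$ labelled $1_e|0_b$; $\mu_{eb}\to\mu_{fc}$ labelled $1_f|0_c$. A bi-infinite path is labelled $w|w'$ if $w$, $w'$ are the sequences of left, resp. right parts of its labels. $\mathscr A_{\mu^{-1}}$ is obtained from $\mathscr A_\mu$ by changing every label $x|y$ to $y|x$ (keeping $\mathscr A$ as the common identity part), and $\mathscr N=\mathscr A\cup\mathscr A_\mu\cup\mathscr A_{\mu^{-1}}$. **The relation $\sim$.** For $w,w'\in\widehat L(\mathscr A)$, $w\sim w'$ if there is a bi-infinite path in $\mathscr N$ labelled $w|w'$ (equivalently, a bi-infinite path in $\mathscr A_\mu$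 labelled $w|w'$ or $w'|w$). **The map $\widehat\mu$.** For a left-infinite binary sequence $w=\cdots w_{-2}w_{-1}$ and a vertex $h$, let $p_{w,h}$ be the unique left-infinite path in $\mathscr A$ ending at $h$ whose labels become $w$ when subscripts are forgotten. Every element of $\widehat L(\mathscr A)$ is of the form $p_{w,h}.q$ with $q\in L(\mathscr A)$ starting at $h$ (the dot separates positions $<0$ and $\ge0$), and $\widehat\mu(p_{w,h}.q)=p_{w,h'}.\mu(q)$ where $h'$ is the initial vertex of $\mu(q)$. It induces a homeomorphism of $\mathfrak S$. **The space $\widetilde{\mathbb Z}_2$ and cocycle $\phi$.** As a set $\widetilde{\mathbb Z}_2=(\mathbb Z_2\setminus\mathbb Z)\sqcup(\mathbb Z\times\mathbb Z/2)$, with natural map to $\mathbb Z_2$ the identity on $\mathbb Z_2\setminus\mathbb Z$ and $(n,t)\mapsto n$. The map $z\mapsto z+1$ on $\widetilde{\mathbb Z}_2$ is the usual one on $\mathbb Z_2\setminus\mathbb Z$ and is $(n,t)\mapsto(n+1,t)$ on $\mathbb Z\times\mathbb Z/2$. The topology is generated by: preimages of open subsets of $\mathbb Z_2$; for $t\in\{0,1\}$, $N\in\mathbb N$, the set consisting of $(0,t)$ and all points lying over $\bigsqcup_{n\ge N}2^{2n+t}(2\mathbb Z_2+1)$; and all $\mathbb Z$-translates of these. $\phi\colon\widetilde{\mathbb Z}_2\to\mathbb Z/2$ is given by $\phi(z)=n+1\bmod2$ if $z$ lies over an element of $2^n(2\mathbb Z_2+1)$, $n\ge0$, and $\phi(0,t)=t+1\bmod2$.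 *)

(* Defs.v *)
From HB Require Import structures.
From Stdlib Require Import Relations.
From mathcomp Require Import all_boot all_order all_algebra.
From mathcomp Require Import generic_quotient.
From mathcomp Require Import all_classical all_reals topology normedtype sequences.

Set Implicit Arguments.
Unset Strict Implicit.
Unset Printing Implicit Defensive.

Import Order.TTheory GRing.Theory Num.Theory.
Import numFieldNormedType.Exports.

Local Open Scope classical_set_scope.
Local Open Scope ring_scope.
Local Open Scope quotient_scope.

Definition sub_elt {T : Type} {A : set T} (x : T) (Ax : A x) : A :=
  exist (fun x => x \in A) x (mem_set Ax).

Definition homeomorphism {T U : topologicalType} (f : T -> U) : Prop :=
  continuous f /\ exists g : U -> T, [/\ continuous g, cancel f g & cancel g f].

Definition quotient_map {T U : topologicalType} (f : T -> U) : Prop :=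
  (forall y, exists x, f x = y) /\ (forall A : set U, open A <-> open (f @^-1` A)).

Definition metrizable (R : realType) (T : topologicalType) : Prop :=
  exists (M : metricType R) (f : T -> M), homeomorphism f.

(* The topological quotient of T by the equivalence relation generated by E; if
   E is already an equivalence relation, this is T / E. *)
Section Quotient.
Context {T : topologicalType} (E : T -> T -> Prop).

Definition gen_equiv : rel T := fun x y => `[< clos_refl_sym_trans T E x y >].

Fact gen_equiv_class : equiv_class_of gen_equiv.
Proof.
split.
- by move=> x; apply/asboolP; exact: rst_refl.
- by move=> x y; apply/asboolP/asboolP; exact: rst_sym.
- by move=> y x z /asboolP xy /asboolP yz; apply/asboolP; exact: rst_trans xy yz.
Qed.

Definition gen_equiv_rel : equiv_rel T := EquivRelPack gen_equiv_class.

Definition quotient : topologicalType :=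
  quotient_topology {eq_quot gen_equiv_rel}.

Definition class (x : T) : quotient := \pi_({eq_quot gen_equiv_rel}) x.

End Quotient.

Definition fibre_bundle {E B : topologicalType} (F : topologicalType)
    (p : E -> B) : Prop :=
  continuous p /\
  forall b : B, exists U : set B, [/\ open U, U b &
    exists phi : p @^-1` U -> U * F,
      homeomorphism phi /\ forall e, \val (phi e).1 = p (\val e)].

Definition unit_interval (R : realType) : topologicalType :=
  set_type (`[0, 1]%classic : set R).

Definition circle (R : realType) : topologicalType :=
  quotient (fun x y : R => y = x + 1).

Definition circle_class (R : realType) : R -> circle R := @class R _.

(* For p : E -> R/Z, some lift of the loop t |-> t mod 1, 0 <= t <= 1, goes from
   x to y. *)
Definition monodromy (R : realType) (E : topologicalType) (p : E -> circle R)
    (x y : E) : Prop :=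
  exists g : R -> E, [/\ {within `[0, 1], continuous g},
    forall t, 0 <= t <= 1 -> p (g t) = circle_class t, g 0 = x & g 1 = y].

Definition mapping_torus (R : realType) (X : topologicalType) (f : X -> X) :
    topologicalType :=
  @quotient (X * unit_interval R)%type
    (fun p q => [/\ \val p.2 = 1, \val q.2 = 0 & q.1 = f p.1]).

Definition torus_class (R : realType) (X : topologicalType) (f : X -> X) :
  X * unit_interval R -> mapping_torus R f := @class _ _.

Inductive vertex := va | vb | vc | vd | ve | vf.

Definition vertex_code (v : vertex) : nat :=
  match v with va => 0 | vb => 1 | vc => 2 | vd => 3 | ve => 4 | vf => 5 end.
Definition vertex_decode (n : nat) : vertex :=
  match n with 0 => va | 1 => vb | 2 => vc | 3 => vd | 4 => ve | _ => vf end%N.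
Fact vertex_codeK : cancel vertex_code vertex_decode. Proof. by case. Qed.

HB.instance Definition _ := Countable.copy vertex (can_type vertex_codeK).
HB.instance Definition _ := hasNbhs.Build vertex principal_filter.
HB.instance Definition _ := Discrete_ofNbhs.Build vertex erefl.

(* The edge i_j is (i, j): it ends at j, and is minimal if i = false, maximal if
   i = true.  Distinct edges have distinct labels, so edges are identified with
   labels and a path with its label sequence. *)
Notation edge := (bool * vertex)%type.

Definition src (e : edge) : vertex :=
  match e with
  | (true,  vb) => va | (true,  vc) => va | (true,  va) => vb
  | (false, vc) => vb | (false, vb) => vc | (false, vf) => vc
  | (false, va) => vd | (false, ve) => vd | (false, vd) => ve
  | (true,  vf) => ve | (true,  vd) => vf | (true,  ve) => vf
  end.

Definition tgt (e : edge) : vertex := e.2.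

Definition is_path : set {ptws nat -> edge} :=
  [set z | forall n, tgt (z n) = src (z n.+1)].

Definition is_bipath : set {ptws int -> edge} :=
  [set w | forall n, tgt (w n) = src (w (n + 1))].

Definition L : topologicalType := set_type is_path.
Definition Lhat : topologicalType := set_type is_bipath.

(* Left-infinite sequences are indexed backwards: index k stands for position
   - (k + 1). [back w h k] is the end vertex of the edge at index k of p_{w,h}. *)
Fixpoint back (w : nat -> bool) (h : vertex) (k : nat) : vertex :=
  if k is k'.+1 then src (w k', back w h k') else h.

(* p_{w,h} *)
Definition left_path (w : nat -> bool) (h : vertex) (k : nat) : edge :=
  (w k, back w h k).

Definition alternate (x y : edge) (n : nat) : edge := if odd n then y else x.

(* An all-maximal path is determined by its first edge; no such path starts with
   1_c or 1_d. *)
Definition mu_maximal (z : nat -> edge) : nat -> edge :=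
  match (z 0%N).2 with
  | vb => alternate (false, ve) (false, vd)
  | va => alternate (false, vd) (false, ve)
  | vf => alternate (false, vc) (false, vb)
  | ve => alternate (false, vb) (false, vc)
  | _  => z
  end.

Definition mu_seq (z : nat -> edge) : nat -> edge :=
  match pselect (exists n, ~~ (z n).1) with
  | left hz =>
      let n := ex_minn hz in
      let e := (true, (z n).2) in
      fun k =>
        if (k < n)%N then left_path (fun=> false) (src e) (n - k.+1)
        else if k == n then e else z k
  | right _ => mu_maximal z
  end.

Fact mu_seqP (z : {ptws nat -> edge}) :
  is_path z -> is_path (mu_seq z : {ptws nat -> edge}).
Proof.
move=> zP; rewrite /mu_seq; case: pselect => [hz|_].
- case: ex_minnP => n _ _ k /=.
  case: (ltnP k n) => [kn|nk]; last first.
    rewrite [(k.+1 < n)%N]ltnNge leqW//= [k.+1 == n]gtn_eqF ?ltnS//.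
    by case: eqP => [->|_]; exact: zP.
  case: (ltnP k.+1 n) => [kn1|nk1]; first by rewrite -[(n - k.+1)%N]prednK ?subn_gt0// -subnS.
  have -> : n = k.+1 by apply/eqP; rewrite eqn_leq nk1.
  by rewrite eqxx subnn.
- rewrite /mu_maximal; case: ((z 0%N).2) => //= k;
  by rewrite /alternate /=; case: (odd k).
Qed.

Definition mu (q : L) : L :=
  sub_elt (mu_seqP (set_mem (valP q))).

(* States of A_mu: inl v is the vertex v of A, and inr (j, k) is mu_{jk}.  Pairs
   (j, k) other than the ten occurring below are isolated states, which no
   bi-infinite path visits. *)
Definition Amu_state := (vertex + vertex * vertex)%type.

Definition mu_edges : seq (vertex * vertex * edge * edge * Amu_state) :=
  [:: ((vc, va), (false, vb), (true,  vb), inl vb);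
      ((vb, va), (false, vc), (true,  vc), inl vc);
      ((vc, ve), (false, vf), (true,  vf), inl vf);
      ((vd, vf), (false, ve), (true,  ve), inl ve);
      ((ve, vf), (false, vd), (true,  vd), inl vd);
      ((vd, vb), (false, va), (true,  va), inl va);
      ((va, vd), (true,  vc), (false, va), inr (vc, va));
      ((va, vd), (true,  vb), (false, va), inr (vb, va));
      ((va, vd), (true,  vc), (false, ve), inr (vc, ve));
      ((va, vd), (true,  vb), (false, ve), inr (vb, ve));
      ((vb, ve), (true,  va), (false, vd), inr (va, vd));
      ((vf, vc), (true,  vd), (false, vb), inr (vd, vb));
      ((vf, vc), (true,  ve), (false, vf), inr (ve, vf));
      ((vf, vc), (true,  vd), (false, vf), inr (vd, vf));
      ((vf, vc), (true,  ve), (false, vb), inr (ve, vb));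
      ((ve, vb), (true,  vf), (false, vc), inr (vf, vc))].

Definition Amu_edge (s : Amu_state) (x y : edge) (s' : Amu_state) : bool :=
  match s with
  | inl v => [&& src x == v, y == x & s' == inl (tgt x)]
  | inr m => (m, x, y, s') \in mu_edges
  end.

(* States of N: those of A, and two copies of the ten others, for A_mu (false)
   and for A_{mu^-1} (true). *)
Definition N_state := (vertex + bool * (vertex * vertex))%type.

Definition N_embed (inv : bool) (s : Amu_state) : N_state :=
  match s with inl v => inl v | inr m => inr (inv, m) end.

Definition N_edge (s : N_state) (x y : edge) (s' : N_state) : Prop :=
  exists t t' : Amu_state,
    [/\ Amu_edge t x y t', s = N_embed false t & s' = N_embed false t'] \/
    [/\ Amu_edge t y x t', s = N_embed true t & s' = N_embed true t'].

Definition sim (w w' : Lhat) : Prop :=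
  exists s : int -> N_state,
    forall n, N_edge (s n) (\val w n) (\val w' n) (s (n + 1)).

Definition Sfrak : topologicalType := quotient sim.
Definition Sfrak_class : Lhat -> Sfrak := @class _ sim.

Definition right_part_seq (w : int -> edge) (n : nat) : edge := w n%:Z.

Fact right_part_subproof (w : Lhat) :
  is_path (right_part_seq (\val w) : {ptws nat -> edge}).
Proof.
by move=> n; rewrite /right_part_seq (set_mem (valP w)) intS addrC.
Qed.

Definition right_part (w : Lhat) : L := sub_elt (right_part_subproof w).

Definition left_digits (w : int -> edge) (k : nat) : bool := (w (Negz k)).1.

(* The bi-infinite path p_{w,h}.q, where h is the initial vertex of q. *)
Definition glue_seq (w : nat -> bool) (q : nat -> edge) (n : int) : edge :=
  match n with
  | Posz n => q n
  | Negz k => left_path w (src (q 0%N)) k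
  end.

Fact glue_subproof (w : nat -> bool) (q : L) :
  is_bipath (glue_seq w (\val q) : {ptws int -> edge}).
Proof.
case=> [n|[|k]]; last first.
- have -> : Negz k.+1 + 1 = Negz k.
    by rewrite !NegzE [k.+2%:Z]intS opprD addrAC addNr add0r.
  by [].
- by [].
- have -> : n%:Z + 1 = n.+1%:Z by rewrite intS addrC.
  exact: (set_mem (valP q)).
Qed.

Definition glue (w : nat -> bool) (q : L) : Lhat :=
  sub_elt (glue_subproof w q).

Definition muhat (w : Lhat) : Lhat :=
  glue (left_digits (\val w)) (mu (right_part w)).

(* Z_2 is the inverse limit of the Z/2^n, with residues taken in [0, 2^n). *)
Definition is_Z2 : set {ptws nat -> nat} :=
  [set x | forall n, x n = (x n.+1 %% 2 ^ n)%N].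

Definition Z2 : topologicalType := set_type is_Z2.

Definition Z2_of_int_seq (m : int) (n : nat) : nat := `|(m %% (2 ^ n)%N%:Z)%Z|%N.
Definition Z2_add_seq (x y : nat -> nat) (n : nat) : nat := ((x n + y n) %% 2 ^ n)%N.
Definition Z2_mul_seq (x y : nat -> nat) (n : nat) : nat := ((x n * y n) %% 2 ^ n)%N.
Definition Z2_digits_seq (i : nat -> bool) (n : nat) : nat :=
  (\sum_(k < n) i k * 2 ^ k)%N.

Fact Z2_of_int_subproof (m : int) : is_Z2 (Z2_of_int_seq m : {ptws nat -> nat}).
Proof.
move=> n /=; rewrite /Z2_of_int_seq; apply/eqP; rewrite -eqz_nat -modz_nat.
rewrite !gez0_abs ?modz_ge0 ?eqz_nat ?expn_eq0//.
by rewrite {1}(divz_eq m (2 ^ n.+1)%N%:Z) {2}expnS PoszM mulrA modzMDl.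
Qed.

Fact Z2_add_subproof (x y : Z2) :
  is_Z2 (Z2_add_seq (\val x) (\val y) : {ptws nat -> nat}).
Proof.
move=> n /=; rewrite /Z2_add_seq modn_dvdm ?dvdn_exp2l//.
by rewrite [\val x n](set_mem (valP x)) [\val y n](set_mem (valP y)) modnDm.
Qed.

Fact Z2_mul_subproof (x y : Z2) :
  is_Z2 (Z2_mul_seq (\val x) (\val y) : {ptws nat -> nat}).
Proof.
move=> n /=; rewrite /Z2_mul_seq modn_dvdm ?dvdn_exp2l//.
by rewrite [\val x n](set_mem (valP x)) [\val y n](set_mem (valP y)) modnMm.
Qed.

Fact Z2_digits_subproof (i : nat -> bool) :
  is_Z2 (Z2_digits_seq i : {ptws nat -> nat}).
Proof.
move=> n /=; rewrite /Z2_digits_seq big_ord_recr /= addnC modnMDl modn_small//.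
elim: n => [|n IH]; first by rewrite big_ord0 expn0.
rewrite big_ord_recr /= expnS mul2n -addnn -addSn leq_add//.
by case: (i n); rewrite ?mul1n ?mul0n.
Qed.

Definition Z2_of_int (m : int) : Z2 := sub_elt (Z2_of_int_subproof m).
Definition Z2_add (x y : Z2) : Z2 := sub_elt (Z2_add_subproof x y).
Definition Z2_mul (x y : Z2) : Z2 := sub_elt (Z2_mul_subproof x y).

Definition Z2_digits (i : nat -> bool) : Z2 :=
  sub_elt (Z2_digits_subproof i).

Definition Z2_layer (n : nat) : set Z2 :=
  [set x | exists y,
    x = Z2_mul (Z2_of_int (2 ^ n)%N) (Z2_add (Z2_mul (Z2_of_int 2) y) (Z2_of_int 1))].

Definition solenoid (R : realType) : topologicalType :=
  @quotient (Z2 * R)%type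
    (fun p q => exists z t, p = (z, t + 1) /\ q = (Z2_add z (Z2_of_int 1), t)).

Definition solenoid_class (R : realType) : Z2 * R -> solenoid R := @class _ _.

(* \sum_(n < 0) i_n 2^n, with i indexed backwards *)
Definition real_digits (R : realType) (i : nat -> bool) : R :=
  limn (series (fun k => (i k)%:R / 2 ^+ k.+1 : R)).

Definition forget (R : realType) (w : Lhat) : Z2 * R :=
  (Z2_digits (fun n => (\val w n%:Z).1), real_digits R (left_digits (\val w))).

Definition Z2_irr : set Z2 := ~` range Z2_of_int.

(* The disjoint union (Z_2 \ Z) + Z * Z/2; Z/2 is bool, with addition (+). *)
Definition Z2t := (Z2_irr + int * bool)%type.
HB.instance Definition _ := Choice.on Z2t.

Definition Z2t_proj (z : Z2t) : Z2 :=
  match z with inl z => \val z | inr (n, _) => Z2_of_int n end.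

Fact Z2t_shift_subproof (k : int) (z : Z2_irr) :
  Z2_irr (Z2_add (\val z) (Z2_of_int k)).
Proof.
case=> m _ /(congr1 \val) /= zkm; apply: (set_mem (valP z)).
exists (m - k) => //; apply: val_inj; apply/funext => n /=.
have xE : sval (sval z) n = (sval (sval z) n %% 2 ^ n)%N.
  by rewrite {1}(set_mem (valP (\val z))) [in RHS](set_mem (valP (\val z))) modn_mod.
have := congr1 (fun f : nat -> nat => f n) zkm => /= {zkm}.
rewrite /Z2_of_int_seq /Z2_add_seq /Z2_of_int_seq.
move: (sval (sval z) n) xE => x xE /(congr1 Posz).
have D0 : (2 ^ n)%N%:Z != 0 by rewrite eqz_nat expn_eq0.
rewrite -modz_nat PoszD !gez0_abs ?modz_ge0// modzDmr => /eqP mE.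
apply/eqP; rewrite -eqz_nat gez0_abs ?modz_ge0// xE -modz_nat.
by rewrite -(eqz_modDr k) subrK.
Qed.

Definition Z2t_shift (k : int) (z : Z2t) : Z2t :=
  match z with
  | inl z => inl (sub_elt (@Z2t_shift_subproof k z))
  | inr (n, t) => inr (n + k, t)
  end.

Definition Z2t_subbase : set (set Z2t) :=
  [set A | (exists2 U : set Z2, open U & A = Z2t_proj @^-1` U) \/
    exists (t : bool) (N : nat) (k : int), A = Z2t_shift k @`
      [set z | z = inr (0, t) \/
         exists2 n, (N <= n)%N & Z2_layer (2 * n + t)%N (Z2t_proj z)]].

HB.instance Definition _ := isSubBaseTopological.Build Z2t Z2t_subbase id.

(* The point (0, t) is sent to t + 1 mod 2; every other z lies over an element of
   Z2_layer n for exactly one n, which get selects. *)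
Definition phi (z : Z2t) : bool :=
  match z with
  | inr (Posz 0, t) => ~~ t
  | _ => odd (get (fun n => Z2_layer n (Z2t_proj z))).+1
  end.

Definition add_cocycle (p : bool * Z2t) : bool * Z2t :=
  let z1 := Z2t_shift 1 p.2 in (p.1 (+) phi z1, z1).

Definition Tfrak (R : realType) : topologicalType := mapping_torus R add_cocycle.
Definition Tfrak_class (R : realType) : bool * Z2t * unit_interval R -> Tfrak R :=
  @torus_class R _ add_cocycle.

Definition suspension (R : realType) : topologicalType :=
  mapping_torus R (Z2t_shift 1).
Definition suspension_class (R : realType) :
    Z2t * unit_interval R -> suspension R :=
  @torus_class R _ (Z2t_shift 1).

(* Main.v *)
(* A bi-infinite path p_{w,h}.q is encoded by q in L and by the real number with
   binary expansion 0.w.  Two paths get the same point of the mapping torus of mu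
   on L exactly when they are related by ~: a bi-infinite run of A_mu propagates
   one carry, either to the left of the dot, where it identifies the two binary
   expansions of a dyadic number, or across the dot, where it identifies (q, 1)
   with (mu q, 0).  Hence the quotient is the mapping torus of mu.

   The automaton has a digit-preserving symmetry exchanging a and f, b and e, c
   and d.  A right-infinite path amounts to its digits, a sign in Z/2 for its first
   vertex (constant along 0-edges, changing along 1-edges) and, for each position,
   the parity of the distance to the next change of digit.  This parity is free
   exactly when the digits are eventually constant, i.e. when they represent an
   integer; this gives a homeomorphism from L to Z/2 x Z2~ that conjugates mu to the
   addition with cocycle.

   Connectedness comes from mu^2 (0 z) = 0 mu(z), by which an invariant continuous
   function on L that depends on n + 1 edges reduces to one that depends on n. *)
Require Import Defs.
From HB Require Import structures.
From Stdlib Require Import Relations.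
From mathcomp Require Import all_boot all_order all_algebra.
From mathcomp Require Import generic_quotient finmap.
From mathcomp Require Import all_classical all_reals topology normedtype sequences.
From mathcomp Require Import zify ring lra.

Set Implicit Arguments.
Unset Strict Implicit.
Unset Printing Implicit Defensive.

Import Order.TTheory GRing.Theory Num.Theory.
Import numFieldNormedType.Exports.

Local Open Scope classical_set_scope.
Local Open Scope card_scope.
Local Open Scope ring_scope.
Local Open Scope quotient_scope.

(** * Topological preliminaries *)

Section CompactHausdorff.
Context {T U : topologicalType}.

(** The main spaces are compact, so most homeomorphisms come from continuous bijections onto
    Hausdorff spaces, and the inverse is not examined. What has to be proved is separation of
    quotients by generated relations; continuous injections into real spaces settle it and give
    metrizability as well. The definition of [mu] asks whether a minimal edge exists. A rule that
    reads two consecutive edges replaces it, because the four limit values are those that the same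
    rule produces. The conjugacy plays two roles. As a mere bijection it shows that [mu] is
    bijective, hence a homeomorphism; then the powers of [mu], now continuous in both directions,
    carry the neighbourhoods of (0, t) to those of the other integers, and this makes the conjugacy
    continuous. Mapping tori are studied through their infinite cyclic covering, whose local
    inverses give bundle charts and unique lifting of paths; since L is totally disconnected, the
    end of a lift depends only on its start. *)

Lemma hausdorff_inj (f : T -> U) :
  continuous f -> injective f -> hausdorff_space U -> hausdorff_space T.
Proof.
move=> cf fi hU x y xy; apply: fi; apply: hU => A B nA nB.
have [z [zA zB]] := xy _ _ (cf x _ nA) (cf y _ nB).
by exists (f z).
Qed.

Lemma compact_surj (f : T -> U) : continuous f -> (forall y, exists x, f x = y) ->
  compact [set: T] -> compact [set: U].
Proof.
move=> cf fs cT; have := continuous_compact (continuous_subspaceT cf) cT.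
by congr compact; apply/seteqP; split => // y _; have [x <-] := fs y; exists x.
Qed.

Lemma closed_map (f : T -> U) : compact [set: T] -> hausdorff_space U ->
  continuous f -> forall A, closed A -> closed (f @` A).
Proof.
move=> cT hU cf A cA; apply: compact_closed => //.
by apply: (continuous_compact (continuous_subspaceT cf));
  exact: subclosed_compact cA cT _.
Qed.

Lemma compact_homeomorphism (f : T -> U) (g : U -> T) :
  compact [set: T] -> hausdorff_space U -> continuous f ->
  cancel f g -> cancel g f -> homeomorphism f.
Proof.
move=> cT hU cf fK gK; split => //; exists g; split => //.
apply/continuousP => A oA; rewrite -closedC.
have -> : ~` (g @^-1` A) = f @` (~` A).
  apply/seteqP; split => [y Ay|_ [x Ax <-]] /=; last by rewrite fK.
  by exists (g y); rewrite ?gK.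
by apply: closed_map => //; rewrite closedC.
Qed.

Lemma compact_bij_homeomorphism (f : T -> U) :
  compact [set: T] -> hausdorff_space U -> continuous f ->
  injective f -> (forall y, exists x, f x = y) -> homeomorphism f.
Proof.
move=> cT hU cf fi fs.
have gP y : {x | f x = y} by exact/cid/fs.
apply: (@compact_homeomorphism _ (fun y => sval (gP y))) => // [x|y].
  by apply: fi; exact: (svalP (gP _)).
exact: (svalP (gP y)).
Qed.

Lemma compact_quotient_map (f : T -> U) :
  compact [set: T] -> hausdorff_space U -> continuous f ->
  (forall y, exists x, f x = y) -> quotient_map f.
Proof.
move=> cT hU cf fs; split => // A; split => [|oA]; first by move/continuousP: cf;
  exact.
rewrite -[A]setCK openC.
have -> : ~` A = f @` (~` (f @^-1` A)).
  apply/seteqP; split => [y Ay|_ [x Ax <-]] //.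
  by have [x xy] := fs y; exists x => //=; rewrite xy.
by apply: closed_map => //; rewrite closedC.
Qed.

End CompactHausdorff.

Lemma homeomorphism_bij {T U : topologicalType} (f : T -> U) : homeomorphism f ->
  injective f /\ forall y, exists x, f x = y.
Proof.
by move=> [_ [g [_ fK gK]]]; split => [|y]; [exact: can_inj fK|exists (g y)].
Qed.

Lemma homeomorphism_comp {T U V : topologicalType} (f : T -> U) (g : U -> V) :
  homeomorphism f -> homeomorphism g -> homeomorphism (g \o f).
Proof.
move=> [cf [f' [cf' fK f'K]]] [cg [g' [cg' gK g'K]]]; split.
  by move=> x; apply: continuous_comp; [exact: cf|exact: cg].
exists (f' \o g'); split; [|exact: can_comp|exact: can_comp].
by move=> x; apply: continuous_comp; [exact: cg'|exact: cf'].
Qed.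

Section SetType.
Context {T U : topologicalType} {A : set T}.

Lemma set_val_continuous : continuous (\val : A -> T).
Proof. exact: (@initial_continuous A T set_val). Qed.

Lemma set_type_continuous (f : U -> A) :
  continuous (fun x => \val (f x) : T) -> continuous f.
Proof. exact: (@continuous_comp_initial A U T set_val). Qed.

Lemma set_type_hausdorff : hausdorff_space T -> hausdorff_space A.
Proof. apply: hausdorff_inj set_val_continuous _; exact: val_inj. Qed.

Lemma set_type_compact : compact A -> compact [set: A].
Proof.
move=> cA F FF _.
have FA : (\val @ F) A by rewrite /= /fmap /=; apply: filterE => x;
  exact: set_mem (valP x).
have [x [Ax clx]] := cA (\val @ F) _ FA.
exists (sub_elt Ax); split => // B C FB [_ [[W oW <-] Wx WC]].
have [] := clx (set_val @` B) W.
- by apply: (@filterS _ F _ B) => // b Bb; exists b.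
- exact: open_nbhs_nbhs.
by move=> _ [[b Bb <-] Wb]; exists b; split => //; exact: WC.
Qed.

End SetType.

Section QuotientTheory.
Context {T U : topologicalType} {E : T -> T -> Prop}.

Lemma class_continuous : continuous (@class T E).
Proof. exact: pi_continuous. Qed.

Lemma class_surj (y : quotient E) : exists x, class E x = y.
Proof. by exists (repr y); exact: reprK. Qed.

Lemma class_eqP x y : class E x = class E y <-> clos_refl_sym_trans T E x y.
Proof.
by split => [/eqmodP/asboolP//|xy]; apply/eqmodP/asboolP.
Qed.

Lemma class_eq x y : E x y -> class E x = class E y.
Proof. by move=> xy; apply/class_eqP; exact: rst_step. Qed.

Lemma class_open (A : set (quotient E)) : open A = open (class E @^-1` A).
Proof. by []. Qed.

Lemma quotient_fun_continuous (f : quotient E -> U) :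
  continuous (fun x => f (class E x)) -> continuous f.
Proof. by move=> cf; apply/quotient_continuous. Qed.

End QuotientTheory.

(** The lift evaluates [f] at the representative chosen by [repr]. As a sigma type, it lets maps out
    of quotients be defined together with their values on classes, and later arguments use only
    these values. *)
Lemma quotient_lift {T : topologicalType} {U : Type} {E : T -> T ->
  Prop} (f : T -> U) :
  (forall x y, E x y -> f x = f y) ->
  {g : quotient E -> U | forall x, g (class E x) = f x}.
Proof.
move=> fE; exists (fun y => f (repr y)) => x.
have fS a b : clos_refl_sym_trans T E a b -> f a = f b.
  by elim=> [|||? ? ? _ -> _ ->] //; exact: fE.
by apply/fS/class_eqP; exact: reprK.
Qed.

Lemma hausdorff_prod {T U : topologicalType} :
  hausdorff_space T -> hausdorff_space U -> hausdorff_space (T * U)%type.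
Proof.
move=> hT hU [x1 x2] [y1 y2] xy; congr (_, _); [apply: hT|apply: hU] => A B nA nB.
  have c (p : T * U) C : nbhs p.1 C -> nbhs p (fst @^-1` C) by exact: cvg_fst.
  by have [z [zA zB]] := xy _ _ (c (x1, x2) A nA) (c (y1, y2) B nB); exists z.1.
have c (p : T * U) C : nbhs p.2 C -> nbhs p (snd @^-1` C) by exact: cvg_snd.
by have [z [zA zB]] := xy _ _ (c (x1, x2) A nA) (c (y1, y2) B nB); exists z.2.
Qed.

Lemma pair_continuous {S T U : topologicalType} (f : S -> T) (g : S -> U) :
  continuous f -> continuous g -> continuous (fun x => (f x, g x)).
Proof. by move=> cf cg x; exact: (cvg_pair (cf x) (cg x)). Qed.

Lemma fst_continuous {T U : topologicalType} : continuous (@fst T U).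
Proof. by move=> p; exact: cvg_fst. Qed.

Lemma snd_continuous {T U : topologicalType} : continuous (@snd T U).
Proof. by move=> p; exact: cvg_snd. Qed.

(** * A local formula for mu *)

(** The states mu_{jk} that pass a carry on, with a maximal left label and a minimal right label,
    have jk = ad, be, eb or fc, that is k = [nu j]. The vertices c and d start no maximal edge, so
    their value is a default. *)
Definition nu (v : vertex) : vertex :=
  match v with va => vd | vf => vc | vb => ve | ve => vb | _ => v end.

(* The start vertex of mu(z) in terms of the first edge of z. *)
Definition mu_src (e : edge) : vertex :=
  if e.1 then nu (src e) else src (true, e.2).

(* If all digits of z before n are 1, the n-th edge of mu(z) is determined by the
   n-th and (n+1)-st edges of z; this also covers the four all-maximal paths. *)
Definition mu_local (e e' : edge) : edge :=
  if e.1 then (false, mu_src e') else (true, e.2).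

Definition all_ones (i : nat -> bool) (n : nat) : bool := [forall k : 'I_n, i k].

Definition digit (z : nat -> edge) (n : nat) : bool := (z n).1.
Definition vertex_at (z : nat -> edge) (n : nat) : vertex := src (z n).

Lemma all_onesP (i : nat -> bool) n : reflect (forall k, (k < n)%N ->
  i k) (all_ones i n).
Proof.
apply: (iffP forallP) => [h k kn|h k]; last exact: h.
exact: (h (Ordinal kn)).
Qed.

Lemma all_onesS (i : nat -> bool) n : all_ones i n.+1 = all_ones i n && i n.
Proof.
apply/all_onesP/andP => [h|[/all_onesP h hn] k].
  by split; [apply/all_onesP => k kn; apply: h; exact: ltnW|exact: h].
by rewrite ltnS leq_eqVlt => /predU1P[->//|]; exact: h.
Qed.

Lemma all_ones0 (i : nat -> bool) : all_ones i 0.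
Proof. by apply/all_onesP. Qed.

(** Propagating the carry one minimal edge to the left agrees with the local rule; this is what
    makes the rule produce a path. *)
Lemma src_mu_src (e e' : edge) : tgt e = src e' -> e.1 ->
  src (false, mu_src e') = mu_src e.
Proof. by move: e e' => [[] []] [[] []]. Qed.

Lemma mu_seqE (z : {ptws nat -> edge}) n : is_path z ->
  mu_seq z n = if all_ones (digit z) n then mu_local (z n) (z n.+1) else z n.
Proof.
move=> zP; rewrite /mu_seq; case: pselect => [hz|hz].
- case: ex_minnP => m zm mmin.
  have ones k : all_ones (digit z) k = (k <= m)%N.
    apply/all_onesP/idP => [h|km j jk].
      by rewrite leqNgt; apply/negP => /h; rewrite /digit (negbTE zm).
    by apply: contraTT (leq_trans jk km) => /mmin; rewrite -leqNgt.
  rewrite ones; case: ltngtP => //= [nm|->]; last by rewrite /mu_local (negbTE zm).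
  have zn : digit z n.
    by have := ones n.+1; rewrite nm => /all_onesP; apply.
  rewrite /mu_local -/(digit z n) zn.
  (* [d] is the distance to the first minimal edge, because the minimal prefix is built backwards
     from there. *)
  suff H d : (d < m)%N ->
      back (fun=> false) (src (true, (z m).2)) d = mu_src (z (m - d)%N).
    rewrite /left_path H ?subKn//.
    by rewrite ltn_subrL (leq_ltn_trans _ nm).
  elim: d => [_|d IH dm] /=.
    by rewrite subn0 /mu_src (negbTE zm).
  rewrite IH ?(ltnW dm)//; apply: src_mu_src.
    by rewrite zP subnSK// ltnW.
  have := ones m; rewrite leqnn => /all_onesP; apply.
  by rewrite ltn_subrL (leq_ltn_trans _ dm).
- have z1 k : (z k).1 by case E : (z k).1 => //; case: hz; exists k; rewrite E.
  have -> : all_ones (digit z) n by apply/all_onesP => k _; exact: z1.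
  rewrite /mu_local z1.
  have zS k : z k.+1 = (true, (z k.+1).2) by rewrite -[in RHS](z1 k.+1);
    case: (z k.+1).
  have step k : src (true, (z k.+1).2) = (z k).2 by rewrite -zS -zP.
  (* Targets of an all-maximal path follow one of the two cycles a, b and e, f: a maximal edge into
     c or d cannot be continued by a maximal one. *)
  pose sw v := match v with va => vb | vb => va | ve => vf | vf => ve | _ => v end.
  have alt k : (z k).2 = if odd k then sw (z 0%N).2 else (z 0%N).2.
    elim: k => //= k IH.
    have -> : (z k.+1).2 = sw (z k).2.
      by rewrite -(step k) -(step k.+1); case: (z k.+2).2.
    by rewrite IH if_neg -(step 0%N) -(step 1%N); case: odd => //; case: (z 2%N).2.
  rewrite /mu_src z1 zS /mu_maximal (alt n.+1) -(step 0%N) -(step 1%N) /alternate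
    /=.
  by case: (z 2%N).2 => //=; case: (odd n).
Qed.

(** * Paths as digits, a sign and a parity *)

(** The classes {a, d, e} and {b, c, f} are exchanged by the symmetry of the automaton; minimal
    edges stay inside a class and maximal edges change it. *)
Definition sgn (v : vertex) : bool :=
  match v with va | vd | ve => true | _ => false end.
Definition tau (v : vertex) : bool :=
  match v with vb | ve => false | _ => true end.

(* The digit i of the outgoing edge matters only if tau is true: vb and ve have
   outgoing edges of both digits. *)
Definition vertex_of (i t s : bool) : vertex :=
  if t then if i then (if s then va else vf) else (if s then vd else vc)
  else if s then ve else vb.

Lemma vertex_ofK (e : edge) : vertex_of e.1 (tau (src e)) (sgn (src e)) = src e.
Proof. by move: e => [[] []]. Qed.

Lemma sgn_src (e : edge) : sgn (src e) = e.1 (+) sgn (tgt e).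
Proof. by move: e => [[] []]. Qed.

(** This backward recursion explains the parity: a change of digit forces the value true, and along
    a run of equal digits the value alternates. Hence any later change of digit determines all
    earlier values. *)
Lemma tau_src (e e' : edge) : tgt e = src e' ->
  tau (src e) = ~~ (tau (src e') && (e.1 == e'.1)).
Proof. by move: e e' => [[] []] [[] []]. Qed.

Lemma sgn_vertex_of i t s : sgn (vertex_of i t s) = s.
Proof. by move: i t s => [] [] []. Qed.

Lemma tau_vertex_of i t s : tau (vertex_of i t s) = t.
Proof. by move: i t s => [] [] []. Qed.

Lemma src_vertex_of i i' t s :
  src (i, vertex_of i' t s) = vertex_of i (~~ (t && (i == i'))) (i (+) s).
Proof. by move: i i' t s => [] [] [] []. Qed.

Definition eventually_const (i : nat -> bool) : Prop :=
  exists N, forall m, (N <= m)%N -> i m = i N.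

(* tau of the n-th vertex: it is true just before a change of digit and alternates
   along each run of equal digits, so that t matters only on an infinite run. *)
Definition tau_seq (i : nat -> bool) (t : bool) (n : nat) : bool :=
  match pselect (exists m, i (n + m)%N != i (n + m).+1) with
  | left h => ~~ odd (ex_minn h)
  | right _ => t (+) odd n
  end.

Lemma tau_seqS i t n : tau_seq i t n = ~~ (tau_seq i t n.+1 && (i n == i n.+1)).
Proof.
rewrite /tau_seq; case: pselect => [h|h].
- case: ex_minnP => m mP mmin.
  have [in1|in1] := eqVneq (i n) (i n.+1); last first.
    have := mmin 0%N; rewrite addn0 => /(_ in1); rewrite leqn0 => /eqP ->.
    by rewrite andbF.
  case: m mP mmin => [|m]; first by rewrite addn0 in1 eqxx.
  rewrite addnS -addSn => mP mmin; rewrite andbT.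
  case: pselect => [h'|[]]; last by exists m.
  case: ex_minnP => k kP kmin /=; rewrite !negbK.
  suff -> : m = k by [].
  apply/eqP; rewrite eqn_leq kmin ?andbT// -ltnS.
  by apply: mmin; rewrite addnS -addSn.
- case: pselect => [[m mP]|_]; first by case: h; exists m.+1; rewrite addnS -addSn.
  have [in1|in1] := eqVneq (i n) (i n.+1); last by case: h; exists 0%N;
    rewrite addn0.
  by rewrite andbT /= addbN negbK.
Qed.

Lemma tau_seq_const i t n : (forall m, (n <= m)%N -> i m = i n) ->
  tau_seq i t n = t (+) odd n.
Proof.
move=> h; rewrite /tau_seq; case: pselect => // hm; exfalso.
by case: hm => m; rewrite (h _ (leq_addr m n)) (h (n + m).+1) ?eqxx// leqW//
  leq_addr.
Qed.

Lemma tau_seq_change i t n m : (forall k, (k < m)%N ->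
  i (n + k)%N = i (n + k).+1) ->
  i (n + m)%N != i (n + m).+1 -> tau_seq i t n = ~~ odd m.
Proof.
move=> h im; rewrite /tau_seq; case: pselect => [h'|[]]; last by exists m.
case: ex_minnP => k kP kmin; suff -> : k = m by [].
apply/eqP; rewrite eqn_leq kmin//= leqNgt; apply/negP => /h km.
by rewrite km eqxx in kP.
Qed.

Lemma not_eventually_const i : ~ eventually_const i ->
  forall n, exists m, i (n + m)%N != i (n + m).+1.
Proof.
move=> ic n; apply: contrapT => h; apply: ic; exists n => m nm.
rewrite -(subnKC nm); elim: (m - n)%N => [|k IH]; first by rewrite addn0.
rewrite addnS -IH; apply/esym/eqP/negPn/negP => hk; apply: h; by exists k.
Qed.

Definition sgn_seq (i : nat -> bool) (s : bool) (n : nat) : bool :=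
  s (+) odd (\sum_(k < n) i k).

Definition vertex_seq s i t n := vertex_of (i n) (tau_seq i t n) (sgn_seq i s n).

Definition path_seq s i t (n : nat) : edge := (i n, vertex_seq s i t n.+1).

Lemma src_path_seq s i t n : src (path_seq s i t n) = vertex_seq s i t n.
Proof.
rewrite src_vertex_of -tau_seqS /vertex_seq; congr vertex_of.
by rewrite /sgn_seq big_ord_recr /= oddD oddb; case: (i n) s (odd _) => [] [] [].
Qed.

Lemma path_seqP s i t : is_path (path_seq s i t : {ptws nat -> edge}).
Proof. by move=> n; rewrite src_path_seq. Qed.

Definition path_of s i t : L := sub_elt (path_seqP s i t).

Lemma L_path (q : L) : is_path (\val q).
Proof. exact: set_mem (valP q). Qed.

(** Adding [odd N] cancels the alternation of [tau] along the constant tail, so the choice of [N]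
    does not matter. The default false matches the tag that [Z2t_tag] gives to non-integers. *)
Definition parity (z : nat -> edge) : bool :=
  match pselect (eventually_const (digit z)) with
  | left h => let N := sval (cid h) in tau (vertex_at z N) (+) odd N
  | right _ => false
  end.

Lemma parityE (z : {ptws nat -> edge}) N : is_path z ->
  (forall m, (N <= m)%N -> digit z m = digit z N) ->
  parity z = tau (vertex_at z N) (+) odd N.
Proof.
move=> zP zN; rewrite /parity; case: pselect => [h|[]]; last by exists N.
case: (cid h) => M /= zM.
have step K n : (forall m, (K <= m)%N -> digit z m = digit z K) ->
    tau (vertex_at z (K + n)) (+) odd (K + n) = tau (vertex_at z K) (+) odd K.
  move=> zK; elim: n => [|n <-]; first by rewrite addn0.
  rewrite addnS /= (tau_src (zP (K + n)%N)).
  rewrite -/(digit z _) -/(digit z _.+1) !zK ?leq_addr// ?leqW ?leq_addr//.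
  by rewrite eqxx andbT addbN addNb.
by rewrite -(step M N) ?zM// addnC step.
Qed.

Lemma sgn_seqE (z : {ptws nat -> edge}) n : is_path z ->
  sgn (vertex_at z n) = sgn_seq (digit z) (sgn (vertex_at z 0)) n.
Proof.
move=> zP; rewrite /sgn_seq; elim: n => [|n IH]; first by rewrite big_ord0 addbF.
rewrite big_ord_recr /= oddD oddb addbA -IH (sgn_src (z n)) zP -/(digit z n).
by rewrite addbC addbA addbb.
Qed.

(** Both sides satisfy the same backward recursion, so agreement at one later index is enough:
    either in the constant tail or at a change of digit, where both are true. *)
Lemma tau_seqE (z : {ptws nat -> edge}) n : is_path z ->
  tau (vertex_at z n) = tau_seq (digit z) (parity z) n.
Proof.
move=> zP.
have step m : tau (vertex_at z (n + m)) = tau_seq (digit z) (parity z) (n + m)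
   -> tau (vertex_at z n) = tau_seq (digit z) (parity z) n.
  elim: m => [|m IH]; rewrite ?addn0// addnS => h; apply: IH.
  by rewrite tau_seqS -h (tau_src (zP _)).
have [[N zN]|zN] := pselect (eventually_const (digit z)).
  apply: (step N); rewrite (@parityE _ (n + N))// ?tau_seq_const => [|m nm|m nm].
  - by rewrite -addbA addbb addbF.
  - by rewrite !zN// ?leq_addl// (leq_trans _ nm)// leq_addl.
  - by rewrite !zN// ?leq_addl// (leq_trans _ nm)// leq_addl.
have [m zm] := not_eventually_const zN n; apply: (step m).
by rewrite tau_seqS (tau_src (zP (n + m)%N)) -/(digit z _) -/(digit z _.+1) (negbTE
  zm) !andbF.
Qed.

Lemma path_ofK (q : L) : path_of (sgn (vertex_at (\val q) 0)) (digit (\val q))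
  (parity (\val q)) = q.
Proof.
apply: val_inj; apply/funext => n /=; rewrite /path_seq /vertex_seq.
rewrite -tau_seqE -?sgn_seqE; [|exact: L_path..].
rewrite /digit vertex_ofK -/(vertex_at _ _).
by rewrite /vertex_at -(L_path q n) /tgt -surjective_pairing.
Qed.

Lemma digit_path_of s i t : digit (\val (path_of s i t)) = i.
Proof. by []. Qed.

Lemma sgn_path_of s i t : sgn (vertex_at (\val (path_of s i t)) 0) = s.
Proof.
by rewrite /vertex_at src_path_seq sgn_vertex_of /sgn_seq big_ord0 addbF.
Qed.

Lemma parity_path_of s i t : eventually_const i ->
  parity (\val (path_of s i t)) = t.
Proof.
move=> [N iN]; rewrite (@parityE _ N)//; last exact: path_seqP.
by rewrite /vertex_at src_path_seq tau_vertex_of tau_seq_const// -addbA addbb addbF.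
Qed.

Lemma parity_nonconst z : ~ eventually_const (digit z) -> parity z = false.
Proof. by rewrite /parity; case: pselect. Qed.

(** * The 2-adic integers and the conjugacy Psi *)

Section Z2Theory.
Implicit Types (x y : Z2) (i : nat -> bool) (n m : nat).

Lemma Z2_val x n : sval x n = (sval x n.+1 %% 2 ^ n)%N.
Proof. exact: (set_mem (valP x)). Qed.

Lemma Z2_eq x y : (forall n, sval x n = sval y n) -> x = y.
Proof. by move=> xy; apply: val_inj; apply/funext => n; exact: xy. Qed.

Lemma Z2_lt x n : (sval x n < 2 ^ n)%N.
Proof. by rewrite Z2_val ltn_mod expn_gt0. Qed.

Lemma Z2_modn x n : (sval x n %% 2 ^ n)%N = sval x n.
Proof. by rewrite modn_small// Z2_lt. Qed.

(** The residues of [x] modulo 2^n and 2^(n+1), taken in [0, 2^n) and [0, 2^(n+1)), are equal or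
    differ by 2^n. *)
Definition Z2_dig x n : bool := sval x n.+1 != sval x n.

Lemma Z2_valS x n : sval x n.+1 = (sval x n + Z2_dig x n * 2 ^ n)%N.
Proof.
rewrite /Z2_dig; case: eqP => [->|xn]; first by rewrite addn0.
have := Z2_lt x n.+1; rewrite expnS mul2n -addnn => h.
rewrite /= mul1n (Z2_val x n); have [hn|hn] := leqP (2 ^ n) (sval x n.+1).
  by rewrite -{2}(subnK hn) modnDr modn_small ?subnK// ltn_subLR.
by case: xn; rewrite [RHS]Z2_val modn_small.
Qed.

Lemma Z2_digits_seqS i n :
  Z2_digits_seq i n.+1 = (Z2_digits_seq i n + i n * 2 ^ n)%N.
Proof. by rewrite /Z2_digits_seq big_ord_recr. Qed.

Lemma Z2_digits_seqD i n m : Z2_digits_seq i (n + m) =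
  (Z2_digits_seq i n + 2 ^ n * Z2_digits_seq (fun k => i (n + k)%N) m)%N.
Proof.
elim: m => [|m IH]; first by rewrite addn0 /(Z2_digits_seq _ 0) big_ord0 muln0
  addn0.
by rewrite addnS !Z2_digits_seqS IH mulnDr -addnA expnD [(2 ^ n * (_ * _))%N]mulnCA.
Qed.

Lemma Z2_digitsK x : Z2_digits (Z2_dig x) = x.
Proof.
apply: Z2_eq; elim => [|n IH] /=.
  by have := Z2_lt x 0; rewrite /Z2_digits_seq big_ord0 ltnS leqn0 => /eqP.
by rewrite Z2_digits_seqS Z2_valS -IH.
Qed.

Lemma Z2_dig_digits i : Z2_dig (Z2_digits i) = i.
Proof.
apply/funext => n; rewrite /Z2_dig /= Z2_digits_seqS -[X in _ != X]addn0 eqn_add2l.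
by rewrite muln_eq0 expn_eq0 orbF; case: (i n).
Qed.

Lemma Z2_digits_inj : injective Z2_digits.
Proof. exact: can_inj Z2_dig_digits. Qed.

Lemma Z2_of_nat n m : sval (Z2_of_int n) m = (n %% 2 ^ m)%N.
Proof. by rewrite /= /Z2_of_int_seq modz_nat. Qed.

Lemma Z2_of_intE (a : int) n : (sval (Z2_of_int a) n)%:Z = (a %% (2 ^ n)%N%:Z)%Z.
Proof. by rewrite /= /Z2_of_int_seq gez0_abs// modz_ge0// eqz_nat expn_eq0. Qed.

Lemma Z2_addE x y n : (sval (Z2_add x y) n)%:Z = (((sval x n)%:Z + (sval y n)%:Z)%R
  %% (2 ^ n)%N%:Z)%Z.
Proof. by rewrite /= /Z2_add_seq -modz_nat PoszD. Qed.

Lemma Z2_addA x y z : Z2_add (Z2_add x y) z = Z2_add x (Z2_add y z).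
Proof. by apply: Z2_eq => n; rewrite /= /Z2_add_seq modnDml modnDmr addnA. Qed.

Lemma Z2_of_intD (a b : int) : Z2_add (Z2_of_int a) (Z2_of_int b) = Z2_of_int (a +
  b).
Proof.
apply: Z2_eq => n; apply/eqP; rewrite -eqz_nat Z2_addE !Z2_of_intE.
by rewrite modzDm.
Qed.

Lemma Z2_add0 x : Z2_add x (Z2_of_int 0) = x.
Proof.
apply: Z2_eq => n; apply/eqP; rewrite -eqz_nat Z2_addE Z2_of_intE.
by rewrite mod0z addr0 modz_nat Z2_modn.
Qed.

(** Once 2^n exceeds |a|, reducing a to [0, 2^n) adds 2^n or nothing; in digits, an integer ends in
    0s or in 1s according to its sign. *)
Lemma Z2_of_int_large (a : int) : exists N, forall n, (N <= n)%N ->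
  (sval (Z2_of_int a) n)%:Z = a + (if a < 0 then (2 ^ n)%N%:Z else 0).
Proof.
exists `|a|%N => n an; have := ltn_expl n (isT : (1 < 2)%N) => n2.
have {an n2} : (`|a| < 2 ^ n)%N by exact: leq_ltn_trans an n2.
rewrite Z2_of_intE; case: a => k /=; first by rewrite addr0 modz_nat =>
  /modn_small ->.
by move=> h; rewrite -(modzDr (Negz k)) modz_small//; move: (2 ^ n)%N h => p; lia.
Qed.

Lemma Z2_of_int_inj : injective Z2_of_int.
Proof.
move=> a b ab; have [M aM] := Z2_of_int_large a; have [N bN] := Z2_of_int_large b.
(* Two consecutive levels are compared: a single one would not exclude that a and b differ by
   2^n. *)
have := aM _ (leqW (leq_addr N M)); rewrite ab (bN _ (leqW (leq_addl M N))).
have := aM _ (leq_addr N M); rewrite ab (bN _ (leq_addl M N)).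
rewrite expnS mul2n -addnn PoszD.
set p := Posz (2 ^ (M + N)).
case: ifP => _; case: ifP => _; rewrite ?addr0; lia.
Qed.

Lemma Z2_digits_int i : (exists a, Z2_of_int a = Z2_digits i) <-> eventually_const
  i.
Proof.
split => [[a ai]|[N iN]].
- have [N aN] := Z2_of_int_large a; exists N => m Nm.
  suff H k : (N <= k)%N -> i k = (a < 0) by rewrite !H.
  move=> Nk; have := aN k.+1 (leqW Nk).
  have := aN k Nk; rewrite ai /= Z2_digits_seqS expnS mul2n -addnn !PoszD.
  set p := Posz (2 ^ k); have : 0 < p by rewrite ltz_nat expn_gt0.
  by case: ifP; case: (i k) => //= _; rewrite ?mul1n ?mul0n -/p; lia.
(* In Z_2 the tail 2^N + 2^(N+1) + ... sums to - 2^N; this gives the integer when the constant digit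
   is 1, and a tail of 0s contributes nothing. *)
- exists ((Z2_digits_seq i N)%:Z - (i N * 2 ^ N)%N%:Z); apply: Z2_eq => n.
  apply/eqP; rewrite -eqz_nat Z2_of_intE.
  have h : sval (Z2_digits i) (N + n)%N = (Z2_digits_seq i N + i N * 2 ^ N * (2 ^
    n).-1)%N.
    rewrite /= Z2_digits_seqD; congr (_ + _)%N;
      rewrite [(i N * _)%N]mulnC -mulnA; congr (_ * _)%N.
    elim: n => [|n IH]; first by rewrite /Z2_digits_seq big_ord0 muln0.
    rewrite Z2_digits_seqS IH (iN _ (leq_addr _ _)) expnS.
    by have := expn_gt0 2 n; case: (i N); case: (2 ^ n)%N => [|p] //=; lia.
  have -> : sval (Z2_digits i) n = (sval (Z2_digits i) (N + n)%N %% 2 ^ n)%N.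
    by rewrite /= [(N + n)%N]addnC Z2_digits_seqD addnC [(2 ^ n * _)%N]mulnC
      modnMDl (Z2_modn (Z2_digits i)).
  rewrite h -modz_nat; move: (i N * 2 ^ N)%N (Z2_digits_seq i N) (expn_gt0 2 n) =>
    c A.
  case: (2 ^ n)%N => // p _; rewrite -(modzMDl c) eq_sym; apply/eqP;
    congr (_ %% _)%Z.
  by rewrite PoszD PoszM /=; lia.
Qed.

Lemma Z2_layer_digits n i :
  Z2_layer n (Z2_digits i) <-> (forall k, (k < n)%N -> i k = false) /\ i n.
Proof.
have E y m : sval (Z2_mul (Z2_of_int (2 ^ n)%N) (Z2_add (Z2_mul (Z2_of_int 2) y)
  (Z2_of_int 1))) m
    = ((2 ^ n * (2 * sval y m).+1) %% 2 ^ m)%N.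
  rewrite /= /Z2_mul_seq /Z2_add_seq /Z2_mul_seq.
  move: (Z2_of_nat (2 ^ n) m) (Z2_of_nat 2 m) (Z2_of_nat 1 m) => /= -> -> ->.
  by rewrite modnDm modnMm -modnMmr -modnDml modnMml modnDml modnMmr addn1.
split => [[y iy]|[i0 i1]].
- have seqE m : Z2_digits_seq i m = ((2 ^ n * (2 * sval y m).+1) %% 2 ^ m)%N.
    by rewrite -E -iy.
  have s0 : Z2_digits_seq i n = 0%N by rewrite seqE modnMr.
  split => [k kn|].
    move: s0; rewrite -(subnKC kn) Z2_digits_seqD Z2_digits_seqS.
    by case: (i k) => //; have := expn_gt0 2 k; case: (2 ^ k)%N => //; lia.
  have := seqE n.+1; rewrite Z2_digits_seqS s0 expnS [(2 * 2 ^ n)%N]mulnC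
    -muln_modr modn2 /= oddM.
  by case: (i n) => //; have := expn_gt0 2 n; case: (2 ^ n)%N.
- exists (Z2_digits (fun k => i (n.+1 + k)%N)); apply: Z2_eq => m; rewrite E /=.
  have -> : (2 ^ n * (2 * Z2_digits_seq (fun k =>
    i (n.+1 + k)%N) m).+1)%N = Z2_digits_seq i (n.+1 + m).
    rewrite Z2_digits_seqD Z2_digits_seqS i1 mul1n.
    have -> : Z2_digits_seq i n = 0%N.
      by rewrite /Z2_digits_seq big1// => k _; rewrite i0.
    by rewrite mulnS mulnA -expnSr.
  by rewrite [(n.+1 + m)%N]addnC Z2_digits_seqD addnC [(2 ^ m * _)%N]mulnC modnMDl
    (Z2_modn (Z2_digits i)).
Qed.

Lemma Z2_digits_succ i i' :
  (forall n, i' n = if all_ones i n then ~~ i n else i n) ->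
  Z2_digits i' = Z2_add (Z2_digits i) (Z2_of_int 1).
Proof.
(* Invariant of schoolbook addition: the carry still pending at position n weighs 2^n. *)
move=> iS; have H n : (Z2_digits_seq i' n + all_ones i n * 2 ^ n)%N =
  (Z2_digits_seq i n).+1.
  elim: n => [|n IH]; first by rewrite /Z2_digits_seq !big_ord0 all_ones0.
  rewrite !Z2_digits_seqS all_onesS iS expnS.
  by move: IH; case: (all_ones i n); case: (i n) => /=; lia.
apply: Z2_eq => n; rewrite /= /Z2_add_seq; have /= -> := Z2_of_nat 1 n.
by rewrite modnDmr addn1 -H addnC modnMDl (Z2_modn (Z2_digits i')).
Qed.

End Z2Theory.

Definition Z2t_tag (z : Z2t) : bool := if z is inr (_, t) then t else false.

Lemma Z2t_eq (z z' : Z2t) : Z2t_proj z = Z2t_proj z' ->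
  Z2t_tag z = Z2t_tag z' -> z = z'.
Proof.
case: z z' => [x|[a t]] [x'|[a' t']] /=.
- by move=> xx' _; congr inl; exact: val_inj.
- by move=> xa; have []: ~ range Z2_of_int (\val x) by [exact: set_mem (valP x)];
    exists a'.
- by move=> xa; have []: ~ range Z2_of_int (\val x') by [exact: set_mem (valP x')];
    exists a.
- by move=> /Z2_of_int_inj -> ->.
Qed.

Lemma Z2t_proj_inr (z : Z2t) a : Z2t_proj z = Z2_of_int a -> z = inr (a, Z2t_tag z).
Proof.
case: z => [x|[b t]] /= xa; last by rewrite (Z2_of_int_inj xa).
by have []: ~ range Z2_of_int (\val x) by [exact: set_mem (valP x)]; exists a.
Qed.

(* The tag t is ignored unless x is an integer. *)
Definition to_Z2t (x : Z2) (t : bool) : Z2t :=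
  match pselect (range Z2_of_int x) with
  | left h => inr (sval (cid2 h), t)
  | right h => inl (@sub_elt _ Z2_irr x h)
  end.

Lemma to_Z2t_proj x t : Z2t_proj (to_Z2t x t) = x.
Proof. by rewrite /to_Z2t; case: pselect => //= h; case: (cid2 h). Qed.

Lemma to_Z2t_tag x t : range Z2_of_int x -> Z2t_tag (to_Z2t x t) = t.
Proof. by rewrite /to_Z2t; case: pselect. Qed.

Lemma to_Z2t_tagN x t : ~ range Z2_of_int x -> Z2t_tag (to_Z2t x t) = false.
Proof. by rewrite /to_Z2t; case: pselect. Qed.

Lemma Z2t_proj_shift k z : Z2t_proj (Z2t_shift k z) = Z2_add (Z2t_proj z)
  (Z2_of_int k).
Proof. by case: z => [x|[a t]] //=; rewrite Z2_of_intD. Qed.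

Lemma Z2t_tag_shift k z : Z2t_tag (Z2t_shift k z) = Z2t_tag z.
Proof. by case: z => [|[]]. Qed.

Lemma Z2t_shift0 z : Z2t_shift 0 z = z.
Proof. by apply: Z2t_eq; rewrite ?Z2t_proj_shift ?Z2_add0 ?Z2t_tag_shift. Qed.

Lemma Z2t_shiftD j k z : Z2t_shift j (Z2t_shift k z) = Z2t_shift (j + k) z.
Proof.
apply: Z2t_eq; rewrite ?Z2t_tag_shift// !Z2t_proj_shift.
by rewrite Z2_addA Z2_of_intD addrC.
Qed.

Lemma Z2t_shiftK k : cancel (Z2t_shift k) (Z2t_shift (- k)).
Proof. by move=> z; rewrite Z2t_shiftD addNr Z2t_shift0. Qed.

Lemma Z2t_shiftNK k : cancel (Z2t_shift (- k)) (Z2t_shift k).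
Proof. by move=> z; rewrite Z2t_shiftD subrr Z2t_shift0. Qed.

Lemma Z2_of_int0 : Z2_of_int 0 = Z2_digits (fun=> false).
Proof.
apply: Z2_eq => n; apply/eqP; rewrite -eqz_nat Z2_of_intE mod0z.
by rewrite /= /Z2_digits_seq big1// => k _; rewrite mul0n.
Qed.

Lemma Z2_layer_uniq x m n : Z2_layer m x -> Z2_layer n x -> m = n.
Proof.
rewrite -(Z2_digitsK x) !Z2_layer_digits => -[m0 m1] [n0 n1].
by case: (ltngtP m n) => // h; [rewrite n0 in m1|rewrite m0 in n1].
Qed.

(** The separate clause of [phi] at (0, t) does not interfere, because 0 lies in no layer. *)
Lemma phi_layer z n : Z2_layer n (Z2t_proj z) -> phi z = odd n.+1.
Proof.
move=> zn; have gn : get (fun n => Z2_layer n (Z2t_proj z)) = n.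
  by apply: (Z2_layer_uniq _ zn); apply: (@getPex _ (fun n =>
    Z2_layer n (Z2t_proj z))); exists n.
rewrite /phi; case: z zn gn => [x|[[[|a]|a] t]] zn gn; rewrite ?gn//.
by move: zn; rewrite /= Z2_of_int0 Z2_layer_digits => -[].
Qed.

Definition Psi (q : L) : bool * Z2t :=
  (sgn (vertex_at (\val q) 0), to_Z2t (Z2_digits (digit (\val q))) (parity (\val
    q))).

Definition Psi_inv (p : bool * Z2t) : L :=
  path_of p.1 (Z2_dig (Z2t_proj p.2)) (Z2t_tag p.2).

Lemma rangeP x : range Z2_of_int x <-> exists a, Z2_of_int a = x.
Proof. by split=> [[a _ <-]|[a <-]]; exists a. Qed.

Lemma PsiK : cancel Psi Psi_inv.
Proof.
move=> q; rewrite /Psi_inv /= to_Z2t_proj Z2_dig_digits -[RHS]path_ofK.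
congr path_of; rewrite /to_Z2t; case: pselect => //= h.
rewrite parity_nonconst// => qc; apply: h; apply/rangeP; exact/Z2_digits_int.
Qed.

Lemma Psi_invK : cancel Psi_inv Psi.
Proof.
move=> [s z]; rewrite /Psi sgn_path_of digit_path_of /= Z2_digitsK.
congr (_, _); apply: Z2t_eq; rewrite ?to_Z2t_proj//.
case: z => [x|[a t]] /=.
  by rewrite to_Z2t_tagN//; exact: set_mem (valP x).
rewrite to_Z2t_tag; last by exists a.
by apply: parity_path_of; apply/Z2_digits_int; exists a; rewrite Z2_digitsK.
Qed.

Lemma muE (q : L) n : sval (mu q) n =
  if all_ones (digit (\val q)) n then mu_local (sval q n) (sval q n.+1) else sval q
    n.
Proof. by rewrite /= mu_seqE//; exact: L_path. Qed.

Lemma digit_mu (q : L) n : digit (\val (mu q)) n =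
  if all_ones (digit (\val q)) n then ~~ digit (\val q) n else digit (\val q) n.
Proof.
by rewrite /digit [\val (mu q) n]muE /=; case: ifP => // _; rewrite /mu_local;
  case: (sval q n) => [[] v].
Qed.

(** If q has a digit 0, then q and mu(q) share a tail. If all digits are 1, both paths have constant
    digits from position 0 on, and their start vertices v and [nu v] have the same [tau]. *)
Lemma parity_mu (q : L) : eventually_const (digit (\val q)) ->
  parity (\val (mu q)) = parity (\val q).
Proof.
move=> [N qN]; have [|] := pselect (exists n, ~~ digit (\val q) n).
  move=> [n qn]; pose K := (N + n).+1.
  have ones m : (K <= m)%N -> all_ones (digit (\val q)) m = false.
    move=> Km; apply/negbTE/negP => /all_onesP h; move: qn; rewrite h//.
    by rewrite (leq_trans _ Km)// ltnS leq_addl.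
  have tailE : forall m, (K <= m)%N -> sval (mu q) m = sval q m.
    by move=> m Km; rewrite muE ones.
  have cK m : (K <= m)%N -> digit (\val q) m = digit (\val q) K.
    by move=> Km; rewrite qN ?(@qN K)// ?leqW ?leq_addr// (leq_trans _ Km)// leqW
      ?leq_addr.
  rewrite (@parityE _ K); [|exact: L_path|].
    rewrite (@parityE _ K); [|exact: L_path|exact: cK].
    by rewrite /vertex_at [\val (mu q) K]tailE.
  by move=> m Km; rewrite /digit [\val (mu q) K]tailE ?[\val (mu q) m]tailE//;
    exact: cK.
move=> h; have q1 n : digit (\val q) n by apply: contrapT => /negP ?; apply: h;
  exists n.
have ones n : all_ones (digit (\val q)) n by apply/all_onesP => k _; exact: q1.
rewrite (@parityE _ 0); [|exact: L_path|by move=> m _; rewrite !digit_mu !ones !q1].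
rewrite (@parityE _ 0); [|exact: L_path|by move=> m _; rewrite !q1].
rewrite !addbF /vertex_at [\val (mu q) 0%N]muE all_ones0 /mu_local.
move: (q1 0%N) (q1 1%N) (q1 2%N) (L_path q 0%N) (L_path q 1%N); rewrite /digit /=.
move: (sval q 0%N) (sval q 1%N) (sval q 2%N).
by move=> [[] []] [[] []] [[] []].
Qed.

(** Signs are compared at position n, the first 0 of q. Before it q has n maximal edges and mu(q)
    has none; at n itself, the edges 0_j and 1_j start at vertices of opposite signs. This makes n +
    1 changes. *)
Lemma sgn_mu (q : L) n : digit (\val q) n = false -> all_ones (digit (\val q)) n ->
  sgn (vertex_at (\val (mu q)) 0) = sgn (vertex_at (\val q) 0) (+) odd n.+1.
Proof.
move=> qn /[dup] ones /all_onesP q1.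
have := sgn_seqE n (L_path q); have := sgn_seqE n (L_path (mu q)).
rewrite /sgn_seq (eq_bigr (fun=> 0%N)); last first.
  move=> k _; rewrite digit_mu q1//; case: ifPn => // /negP[].
  by apply/all_onesP => j jk; apply: q1; exact: ltn_trans jk (ltn_ord k).
rewrite sum_nat_const muln0 addbF => <-.
rewrite (eq_bigr (fun=> 1%N)); last by move=> k _; rewrite q1.
rewrite sum_nat_const card_ord muln1 => qE.
have -> : sgn (vertex_at (\val q) 0) = sgn (vertex_at (\val q) n) (+) odd n.
  by rewrite qE -addbA addbb addbF.
rewrite /vertex_at [\val (mu q) n]muE ones /mu_local.
move: qn; rewrite /digit -[sval q n]/(\val q n); case: (\val q n) => [[] v] //= _.
by rewrite addbN -addbA addbb; case: v.
Qed.

(** The position n of the first 0 of q governs the change of sign, and it is also the layer of z +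
    1; this is why the cocycle evaluates [phi] at z + 1 and not at z. *)
Lemma Psi_mu (q : L) : Psi (mu q) = add_cocycle (Psi q).
Proof.
set z := (Psi q).2.
have zE : (Psi (mu q)).2 = Z2t_shift 1 z.
  have pE : Z2t_proj (Psi (mu q)).2 = Z2t_proj (Z2t_shift 1 z).
    rewrite Z2t_proj_shift !to_Z2t_proj; apply: Z2_digits_succ; exact: digit_mu.
  apply: Z2t_eq => //; rewrite Z2t_tag_shift /=.
  have [qc|qc] := pselect (eventually_const (digit (\val q))).
    have qr : range Z2_of_int (Z2_digits (digit (\val q))) by apply/rangeP;
      apply/Z2_digits_int.
    rewrite !to_Z2t_tag ?parity_mu//.
    move: pE; rewrite Z2t_proj_shift !to_Z2t_proj => ->.
    by move: qr => [a _ <-]; rewrite Z2_of_intD; exists (a + 1).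
  have qr : ~ range Z2_of_int (Z2_digits (digit (\val q))) by move=> /rangeP
    /Z2_digits_int.
  rewrite [RHS]to_Z2t_tagN// to_Z2t_tagN// => h; apply: qr; move: h pE;
    rewrite Z2t_proj_shift !to_Z2t_proj => -[a _ <-] aE.
  by exists (a - 1) => //; rewrite -Z2_of_intD aE Z2_addA Z2_of_intD subrr Z2_add0.
rewrite [LHS]surjective_pairing zE /add_cocycle; congr (_, _).
rewrite -zE.
have [h|h] := pselect (exists n, ~~ digit (\val q) n).
  case: (ex_minnP h) => n /negbTE qn nmin.
  have ones : all_ones (digit (\val q)) n.
    by apply/all_onesP => k; rewrite ltnNge; apply: contraR => /nmin.
  rewrite (@phi_layer _ n); first exact: sgn_mu.
  rewrite to_Z2t_proj Z2_layer_digits; split => [k kn|].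
    rewrite digit_mu (all_onesP _ _ ones k kn); case: ifPn => // /negP[].
    by apply/all_onesP => j jk; apply: (all_onesP _ _ ones); exact: ltn_trans jk kn.
  by rewrite digit_mu ones qn.
(* All digits are 1: q lies over -1 and mu(q) over 0, where the cocycle is given by the clause
   phi(0, t) = t + 1 and the tag is read off the start vertex. *)
have q1 n : digit (\val q) n by apply: contrapT => /negP ?; apply: h; exists n.
have ones n : all_ones (digit (\val q)) n by apply/all_onesP => k _; exact: q1.
have mq0 n : digit (\val (mu q)) n = false by rewrite digit_mu ones q1.
rewrite (@Z2t_proj_inr (Psi (mu q)).2 0); last first.
  rewrite to_Z2t_proj Z2_of_int0; congr Z2_digits; exact/funext.
have phi0 t : phi (inr (0%:Z, t)) = ~~ t by [].
rewrite phi0 to_Z2t_tag; last first.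
  by apply/rangeP; apply/Z2_digits_int; exists 0%N => m _; rewrite !mq0.
rewrite (@parityE _ 0); [|exact: L_path|by move=> m _; rewrite !mq0].
rewrite addbF [(Psi _).1]/(sgn _) [(Psi q).1]/(sgn _) /vertex_at [\val (mu q)
  0%N]muE all_ones0 /mu_local.
move: (q1 0%N) (q1 1%N) (q1 2%N) (L_path q 0%N) (L_path q 1%N); rewrite /digit /=.
move: (sval q 0%N) (sval q 1%N) (sval q 2%N).
by move=> [[] []] [[] []] [[] []].
Qed.

(** * Expansions of real numbers *)

Section Expansion.
Context {R : realType}.
Implicit Types (b : R) (a : nat -> nat).

(** Common frame for base 2, which gives the real coordinate of a bi-infinite path, and base 24,
    which codes points of L and Z_2 by real numbers. *)
Definition expansion b a : R := limn (series (fun k => (a k)%:R / b ^+ k.+1)).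

Definition shift_seq {T : Type} (n : nat) (a : nat ->
  T) (k : nat) : T := a (n + k)%N.

Definition digit_seq b a := 2 <= b /\ forall k, (a k)%:R <= b - 1.

Lemma digit_seq_shift b a n : digit_seq b a -> digit_seq b (shift_seq n a).
Proof. by move=> [b2 ab]; split => // k; exact: ab. Qed.

Lemma expansion_partial b a n : digit_seq b a ->
  series (fun k => (a k)%:R / b ^+ k.+1) n <= 1 - b ^- n.
Proof.
move=> [b2 ab]; have b0 : 0 < b by apply: lt_le_trans b2.
rewrite /series /=; elim: n => [|n IH]; first by rewrite big_geq// expr0 invr1
  subrr.
rewrite big_nat_recr//=; apply: le_trans (lerD IH (lexx _)) _.
rewrite -lerBrDl; have bn : b ^- n = b ^- n.+1 * b by rewrite exprSr invfM mulfVK//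
  gt_eqF.
rewrite bn; have : 0 < b ^- n.+1 by rewrite invr_gt0 exprn_gt0.
by move: (b ^- n.+1) => y y0; have := ab n; nra.
Qed.

Lemma expansion_cvg b a : digit_seq b a ->
  cvgn (series (fun k => (a k)%:R / b ^+ k.+1)).
Proof.
move=> ab; have b0 : 0 < b by case: ab => b2 _; apply: lt_le_trans b2.
apply: nondecreasing_is_cvgn.
  apply/nondecreasing_seqP => n; rewrite /series /= [leRHS]big_nat_recr//= lerDl.
  by rewrite divr_ge0// exprn_ge0// ltW.
exists 1 => _ [n _ <-]; apply: le_trans (expansion_partial n ab) _.
by rewrite gerBl invr_ge0 exprn_ge0// ltW.
Qed.

Lemma expansionS b a : digit_seq b a ->
  expansion b a = ((a 0%N)%:R + expansion b (shift_seq 1 a)) / b.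
Proof.
move=> ab; have b0 : 0 < b by case: ab => b2 _; apply: lt_le_trans b2.
apply: cvg_lim; first exact: Rhausdorff.
rewrite -cvg_shiftS /=.
have -> : (fun n => series (fun k => (a k)%:R / b ^+ k.+1) n.+1) =
   (fun n => ((a 0%N)%:R + series (fun k => (shift_seq 1 a k)%:R / b ^+ k.+1) n) /
     b).
  apply/funext => n; rewrite /series /= big_nat_recl//= mulrDl; congr (_ + _).
  rewrite big_distrl /=; apply: eq_bigr => k _.
  by rewrite /shift_seq add1n exprSr invfM mulrA.
apply: cvgM; last exact: cvg_cst.
apply: cvgD; first exact: cvg_cst.
exact/expansion_cvg/digit_seq_shift.
Qed.

Lemma expansion_ge0 b a : digit_seq b a -> 0 <= expansion b a.
Proof.
move=> ab; have b0 : 0 < b by case: ab => b2 _; apply: lt_le_trans b2.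
apply: limr_ge; first exact: expansion_cvg.
near=> n; rewrite /series /=; apply: sumr_ge0 => k _.
by rewrite divr_ge0// exprn_ge0// ltW.
Unshelve. all: by end_near. Qed.

Lemma expansion_le b a (m : R) : digit_seq b a -> (forall k, (a k)%:R <= m) ->
  expansion b a <= m / (b - 1).
Proof.
move=> ab am; have b2 : 2 <= b by case: ab.
have b0 : 0 < b by apply: lt_le_trans b2.
have b1 : 0 < b - 1 by lra.
have m0 : 0 <= m by apply: le_trans (am 0%N).
have P n : series (fun k => (a k)%:R / b ^+ k.+1) n <= m / (b - 1) * (1 - b ^- n).
  rewrite /series /=; elim: n => [|n IH]; first by rewrite big_geq// expr0 invr1
    subrr mulr0.
  rewrite big_nat_recr//=; apply: le_trans (lerD IH (lexx _)) _.
  have bn : b ^- n = b ^- n.+1 * b by rewrite exprSr invfM mulfVK// gt_eqF.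
  rewrite bn; have : 0 < b ^- n.+1 by rewrite invr_gt0 exprn_gt0.
  move: (b ^- n.+1) => y y0; rewrite -lerBrDl -mulrBr.
  have -> : m / (b - 1) * (1 - y - (1 - y * b)) = m * y by field; lra.
  by rewrite ler_wpM2r// ltW.
apply: limr_le; first exact: expansion_cvg.
near=> n; apply: le_trans (P n) _; apply: ler_piMr; first by rewrite divr_ge0// ltW.
by rewrite gerBl invr_ge0 exprn_ge0// ltW.
Unshelve. all: by end_near. Qed.

Lemma expansion_le1 b a : digit_seq b a -> expansion b a <= 1.
Proof.
move=> ab; have [b2 a1] := ab; apply: le_trans (expansion_le ab a1) _.
by rewrite divff//; apply: lt0r_neq0; lra.
Qed.

Lemma expansion_agree b a a' n : digit_seq b a -> digit_seq b a' ->
  (forall k, (k < n)%N -> a k = a' k) ->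
  expansion b a - expansion b a' =
  (expansion b (shift_seq n a) - expansion b (shift_seq n a')) / b ^+ n.
Proof.
elim: n a a' => [|n IH] a a' ha ha' aa'; first by rewrite expr0 divr1.
have b0 : b != 0 by case: ha => b2 _; apply: lt0r_neq0; lra.
rewrite (expansionS ha) (expansionS ha') aa'//.
have -> x y z : (x + y) / b - (x + z) / b = (y - z) / b by field.
rewrite (IH (shift_seq 1 a) (shift_seq 1 a')); [|exact: digit_seq_shift..|].
  have sE (c : nat -> nat) : shift_seq n (shift_seq 1 c) = shift_seq n.+1 c.
    by apply/funext => k; rewrite /shift_seq addnA.
  by rewrite !sE exprSr invfM mulrA.
by move=> k kn; exact: aa'.
Qed.

Lemma expansion_close b a a' n : digit_seq b a -> digit_seq b a' ->
  (forall k, (k < n)%N -> a k = a' k) -> `|expansion b a - expansion b a'| <= b ^-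
    n.
Proof.
move=> ha ha' /expansion_agree -> //.
have b0 : 0 < b by case: ha => b2 _; apply: lt_le_trans b2.
have bn : 0 <= b ^- n by rewrite invr_ge0 exprn_ge0// ltW.
rewrite normrM [X in _ * X]ger0_norm//; apply: ler_piMl => //.
have := expansion_ge0 (digit_seq_shift n ha);
  have := expansion_le1 (digit_seq_shift n ha).
have := expansion_ge0 (digit_seq_shift n ha');
  have := expansion_le1 (digit_seq_shift n ha').
by move=> *; rewrite ler_norml; lra.
Qed.

Lemma exprV_small b (e : R) : 1 < b -> 0 < e -> exists n, b^-1 ^+ n < e.
Proof.
move=> b1 e0; have bV : 0 < b^-1 by rewrite invr_gt0; lra.
have : (fun n => b^-1 ^+ n) @ \oo --> 0.
  by apply: cvg_expr; rewrite gtr0_norm// invf_lt1//; lra.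
move=> /cvgrPdist_lt/(_ _ e0)[n _ /(_ _ (leqnn n))] /=.
by rewrite sub0r normrN gtr0_norm ?exprn_gt0//; exists n.
Qed.

Lemma first_diff {T : eqType} (a a' : nat -> T) : a <> a' ->
  exists n, (forall k, (k < n)%N -> a k = a' k) /\ a n != a' n.
Proof.
move=> aa'; have h : exists n, a n != a' n.
  by apply: contrapT => h; apply: aa'; apply/funext => n;
    apply/eqP/negPn/negP => ?; apply: h; exists n.
case: (ex_minnP h) => n an nmin; exists n; split => // k; rewrite ltnNge =>
  /negP kn.
by apply/eqP/negPn/negP => /nmin.
Qed.

(* Base 24 leaves a gap: the tails lie in [0, 11/23], so that distinct sequences of
   digits at most 11 (the codes of the 12 edges) have distinct values. *)
Lemma digit_seq24 a : (forall k, (a k <= 11)%N) -> digit_seq 24 a.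
Proof.
by move=> a11; split => [|k]; [lra|rewrite (@le_trans _ _ 11%:R) ?ler_nat//; lra].
Qed.

Lemma expansion24_inj a a' : (forall k, (a k <= 11)%N) ->
  (forall k, (a' k <= 11)%N) ->
  expansion 24 a = expansion 24 a' -> a = a'.
Proof.
move=> ha ha' aa'; apply: contrapT => /first_diff[n [an nn]].
have := expansion_agree (digit_seq24 ha) (digit_seq24 ha') an.
have sE (c : nat -> nat) : shift_seq 1 (shift_seq n c) = shift_seq n.+1 c.
  by apply/funext => k; rewrite /shift_seq addnA addn1.
rewrite aa' subrr (expansionS (digit_seq_shift n (digit_seq24 ha))) (expansionS
  (digit_seq_shift n (digit_seq24 ha'))) !sE.
have B c : (forall k, (c k <= 11)%N) -> 0 <= expansion 24 (shift_seq n.+1 c) <= 11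
  / 23.
  move=> hc; have d := digit_seq_shift n.+1 (digit_seq24 hc).
  have -> : (23 : R) = 24 - 1 by lra.
  by rewrite expansion_ge0//=; apply: expansion_le => // k; rewrite ler_nat;
    exact: hc.
move: (B _ ha) (B _ ha'); rewrite /shift_seq addn0.
move: (expansion _ _) (expansion _ _) => x y xb yb /esym/eqP.
rewrite mulf_eq0 invr_eq0 expf_eq0 /= => /orP[/eqP xy|/andP[_ /eqP ?]]; last by lra.
case: (ltngtP (a n) (a' n)) nn => // h _.
  have : (a n)%:R + 1 <= (a' n)%:R :> R by rewrite natr1 ler_nat.
  by move: (a n)%:R (a' n)%:R xy xb yb => p p' xy /andP[? ?] /andP[? ?] ?; lra.
have : (a' n)%:R + 1 <= (a n)%:R :> R by rewrite natr1 ler_nat.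
by move: (a n)%:R (a' n)%:R xy xb yb => p p' xy /andP[? ?] /andP[? ?] ?; lra.
Qed.

End Expansion.

Section RealDigits.
Context {R : realType}.
Implicit Types (i : nat -> bool).

Let D (i : nat -> bool) : R := real_digits R i.

Lemma digit_seq2 i : digit_seq (2 : R) (fun k => i k).
Proof. by split => [|k]; [lra|case: (i k) => /=; lra]. Qed.

Lemma real_digitsE i : D i = expansion 2 (fun k => i k). Proof. by []. Qed.

Lemma real_digitsS i : D i = ((i 0%N)%:R + D (shift_seq 1 i)) / 2.
Proof. exact: (expansionS (digit_seq2 i)). Qed.

Lemma real_digits_itv i : 0 <= D i <= 1.
Proof. by rewrite expansion_ge0 ?expansion_le1//; exact: digit_seq2. Qed.

Lemma shift_seqD {T : Type} m n (i : nat -> T) : shift_seq m (shift_seq n i) =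
  shift_seq (n + m) i.
Proof. by apply/funext => k; rewrite /shift_seq addnA. Qed.

Lemma real_digits0 i : D i = 0 <-> forall k, i k = false.
Proof.
have step j : D j = 0 -> j 0%N = false /\ D (shift_seq 1 j) = 0.
  rewrite real_digitsS; have := real_digits_itv (shift_seq 1 j).
  by case: (j 0%N) => /=; move=> *; split => //; lra.
split => [i0 k|i0].
  have : D (shift_seq k i) = 0.
    by elim: k => [//|k IH]; rewrite -addn1 -shift_seqD; have [] := step _ IH.
  by move=> /step[]; rewrite /shift_seq addn0.
have : D i = D i / 2.
  rewrite {1}real_digitsS i0 add0r; congr (D _ / _).
  by apply/funext => k; rewrite /shift_seq !i0.
by lra.
Qed.

Lemma real_digits1 i : D i = 1 <-> forall k, i k.
Proof.
have step j : D j = 1 -> j 0%N /\ D (shift_seq 1 j) = 1.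
  rewrite real_digitsS; have := real_digits_itv (shift_seq 1 j).
  by case: (j 0%N) => /=; move=> *; split => //; lra.
split => [i0 k|i0].
  have : D (shift_seq k i) = 1.
    by elim: k => [//|k IH]; rewrite -addn1 -shift_seqD; have [] := step _ IH.
  by move=> /step[]; rewrite /shift_seq addn0.
have : D i = (1 + D i) / 2.
  rewrite {1}real_digitsS i0; congr ((_ + D _) / _).
  by apply/funext => k; rewrite /shift_seq !i0.
by lra.
Qed.

(** The two expansions of a dyadic number, with tails 0111... in [i] and 1000... in [i'] from
    position [n] on. *)
Definition carry i i' : Prop := exists n, [/\ forall k, (k < n)%N -> i k = i' k,
  i n = false, i' n, forall k, (n < k)%N -> i k & forall k, (n < k)%N ->
    i' k = false].

(** At the first difference, the tail starting with 0 has value at most 1/2 and the one starting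
    with 1 at least 1/2. Equality forces both to be 1/2, hence only 1s after the 0 and only 0s after
    the 1. *)
Lemma real_digits_eq i i' : D i = D i' <-> [\/ i = i', carry i i' | carry i' i].
Proof.
have agree j j' n : (forall k, (k < n)%N -> j k = j' k) ->
    D j - D j' = (D (shift_seq n j) - D (shift_seq n j')) / 2 ^+ n.
  move=> jj'; apply: (expansion_agree (digit_seq2 j) (digit_seq2 j')) => k kn.
  by rewrite jj'.
have two n : 2 ^+ n != 0 :> R by rewrite expf_eq0; apply/negP => /andP[_ /eqP]; lra.
have tail n j b : (forall k, shift_seq 1 (shift_seq n j) k = b) <-> forall k, (n <
  k)%N -> j k = b.
  split=> [h k nk|h k]; last by rewrite /shift_seq h// addnA addn1 ltnS leq_addr.
  by have := h (k - n.+1)%N; rewrite /shift_seq addnA addn1 subnKC.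
have s0 n (j : nat -> bool) : shift_seq n j 0%N = j n by rewrite /shift_seq addn0.
have fwd j j' n : (forall k, (k < n)%N -> j k = j' k) -> j n = false -> j' n ->
  D j = D j' -> carry j j'.
  move=> jj' jn jn' /eqP; rewrite -subr_eq0 (agree _ _ n)// mulf_eq0 invr_eq0
    (negbTE (two n)) orbF.
  rewrite (real_digitsS (shift_seq n j)) (real_digitsS (shift_seq n j')) !s0 jn jn'
    => /eqP.
  have := real_digits_itv (shift_seq 1 (shift_seq n j)).
  have := real_digits_itv (shift_seq 1 (shift_seq n j')) => h1 h2 h3.
  exists n; split => //; apply/tail.
    by apply/real_digits1; rewrite /= in h3; lra.
  by apply/real_digits0; rewrite /= in h3; lra.
have bwd j j' : carry j j' -> D j = D j'.
  move=> [n [jj' jn jn' /tail j1 /tail j0]]; apply/eqP;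
    rewrite -subr_eq0 (agree _ _ n)//.
  rewrite (real_digitsS (shift_seq n j)) (real_digitsS (shift_seq n j')).
  rewrite (proj2 (real_digits1 _) j1) (proj2 (real_digits0 _) j0).
  by rewrite !s0 jn jn' add0r addr0 subrr mul0r.
split => [ii'|[->//|/bwd//|/bwd//]].
have [->|/first_diff[n [ni nn]]] := pselect (i = i'); first by constructor 1.
case ein : (i n) nn; case ein' : (i' n) => // _.
- by constructor 3; apply: (fwd _ _ n) => // k kn; rewrite ni.
- by constructor 2; apply: (fwd _ _ n).
Qed.

Lemma real_digits_surj (x : R) : 0 <= x <= 1 -> exists i, D i = x.
Proof.
(* The doubling map on the closed interval: digits record the branch taken, and the fixed point 1
   receives only 1s. *)
pose T (x : R) : R := if 2^-1 <= x then 2 * x - 1 else 2 * x.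
move=> x01; pose i n := 2^-1 <= iter n T x; exists i.
have Tx n : 0 <= iter n T x <= 1.
  elim: n => //= n; move: (iter n T x) => y /andP[y0 y1].
  by rewrite /T; case: ifPn; rewrite -?ltNge => h; apply/andP; split; lra.
have H n : D i - x = (D (shift_seq n i) - iter n T x) / 2 ^+ n.
  elim: n => [|n ->]; first by rewrite expr0 divr1.
  rewrite exprSr invfM mulrA [in LHS]real_digitsS shift_seqD addn1 /shift_seq addn0.
  rewrite /= /i; move: (iter n T x) (D _) => y z; rewrite /T;
    case: (2^-1 <= y) => /=.
    by field; rewrite expf_eq0; apply/negP => /andP[_ /eqP ?]; lra.
  by field; rewrite expf_eq0; apply/negP => /andP[_ /eqP ?]; lra.
apply/eqP; rewrite -subr_eq0 -normr_le0; apply/ler_addgt0Pr => e e0; rewrite add0r.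
have [n ne] : exists n, (2^-1 : R) ^+ n < e by apply: exprV_small => //; lra.
apply: le_trans (ltW ne); rewrite (H n) normrM exprVn.
have bn : 0 <= 2 ^- n :> R by rewrite invr_ge0 exprn_ge0//; lra.
rewrite [X in _ * X]ger0_norm//; apply: ler_piMl => //.
by have := Tx n; have := real_digits_itv (shift_seq n i); move=> *;
  rewrite ler_norml; lra.
Qed.

End RealDigits.

(** * Topology of L, Z_2 and its cover *)

Section PtwsSet.
Context {I : eqType} {E : topologicalType} {A : set {ptws I -> E}}.

Lemma eval_continuous (i : I) : continuous (fun a : A => \val a i).
Proof.
move=> a; apply: (@continuous_comp _ _ _ (\val : A -> {ptws I -> E}) (fun f =>
  f i)).
  exact: set_val_continuous.
exact: (@proj_continuous I (fun=> E) i).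
Qed.

Lemma ptws_set_continuous {U : topologicalType} (f : U -> A) :
  (forall i, continuous (fun u => \val (f u) i)) -> continuous f.
Proof.
move=> cf; apply: set_type_continuous => u.
apply/cvg_sup => i; apply: (@continuous_comp_initial _ U E (fun g : I -> E => g i)).
exact: cf.
Qed.

Lemma ptws_set_hausdorff : hausdorff_space E -> hausdorff_space A.
Proof.
move=> hE; apply: set_type_hausdorff.
exact: (@hausdorff_product I (fun=> E) (fun=> hE)).
Qed.

End PtwsSet.

Lemma edge_open (B : set edge) : open B.
Proof.
rewrite openE => -[b v] Bbv; exists ([set b], [set v]) => /=;
  last by move=> [? ?] /= [-> ->].
by split; exact: discrete_set1.
Qed.

Lemma edge_continuous {U : topologicalType} (f : U -> edge) :
  continuous f <-> forall u, \forall u' \near u, f u' = f u.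
Proof.
split=> [cf u|cf u B]; last first.
  by move=> /nbhs_singleton Bu; apply: filterS (cf u) => u' /= ->.
apply: (cf u [set f u]); apply: open_nbhs_nbhs; split => //; exact: edge_open.
Qed.

Lemma nat_continuous {U : topologicalType} (f : U -> nat) :
  continuous f <-> forall u, \forall u' \near u, f u' = f u.
Proof.
split=> [cf u|cf u B]; last first.
  by move=> /nbhs_singleton Bu; apply: filterS (cf u) => u' /= ->.
apply: (cf u [set f u]); exact: discrete_set1.
Qed.

Lemma bool_continuous {U : topologicalType} (f : U -> bool) :
  continuous f <-> forall u, \forall u' \near u, f u' = f u.
Proof.
split=> [cf u|cf u B]; last first.
  by move=> /nbhs_singleton Bu; apply: filterS (cf u) => u' /= ->.
apply: (cf u [set f u]); exact: discrete_set1.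
Qed.

Lemma near_prefix {U : topologicalType} {T : Type} (f : U -> nat -> T) u N :
  (forall n, \forall u' \near u, f u' n = f u n) ->
  \forall u' \near u, forall n, (n < N)%N -> f u' n = f u n.
Proof.
move=> fn; elim: N => [|N IH]; first by apply: filterE.
apply: filterS2 IH (fn N) => u' h hN n; rewrite ltnS leq_eqVlt =>
  /predU1P[->//|]; exact: h.
Qed.

Lemma L_near (q : L) n : \forall q' \near q, sval q' n = sval q n.
Proof. by move: q; apply/edge_continuous; exact: eval_continuous. Qed.

Lemma L_near_prefix (q : L) N :
  \forall q' \near q, forall n, (n < N)%N -> sval q' n = sval q n.
Proof. by apply: near_prefix; exact: L_near. Qed.

Lemma Lhat_near (w : Lhat) n : \forall w' \near w, sval w' n = sval w n.
Proof. by move: w; apply/edge_continuous; exact: eval_continuous. Qed.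

Lemma Z2_near (x : Z2) n : \forall x' \near x, sval x' n = sval x n.
Proof. by move: x; apply/nat_continuous; exact: eval_continuous. Qed.

Lemma L_continuous {U : topologicalType} (f : U -> L) :
  (forall u n, \forall u' \near u, sval (f u') n = sval (f u) n) -> continuous f.
Proof.
by move=> h; apply: ptws_set_continuous => n; apply/edge_continuous => u; exact: h.
Qed.

Lemma Z2_continuous {U : topologicalType} (f : U -> Z2) :
  (forall u n, \forall u' \near u, sval (f u') n = sval (f u) n) -> continuous f.
Proof.
by move=> h; apply: ptws_set_continuous => n; apply/nat_continuous => u; exact: h.
Qed.

Lemma edge_compact : compact [set: edge].
Proof.
apply: finite_compact.
have B : finite_set [set: bool] by exact: finite_finset.
have V : finite_set [set: vertex].
  apply: (@sub_finite_set _ _ ([set va] `|` [set vb] `|` [set vc] `|` [set vd] `|`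
    [set ve] `|` [set vf])).
    by case; rewrite /setU /=; tauto.
  by rewrite !finite_setU; do !split; exact: finite_set1.
apply: sub_finite_set (finite_setX B V) => -[b v] _.
by split.
Qed.

Lemma L_compact : compact [set: L].
Proof.
apply: set_type_compact; apply: (subclosed_compact _ (@tychonoff nat (fun=> edge)
  (fun=> setT) (fun=> edge_compact))) => //.
have -> : is_path = \bigcap_(n in [set: nat]) [set z : {ptws nat ->
  edge} | tgt (z n) = src (z n.+1)].
  by apply/seteqP; split => [z zP n _|z zP n]; [exact: zP|exact: (zP n I)].
apply: closed_bigI => n _; rewrite -openC openE => z zn.
have ev k : \forall z' \near z, z' k = z k.
  have /edge_continuous/(_ z)// : continuous (fun z : {ptws nat -> edge} => z k).
  exact: (@proj_continuous nat (fun=> edge) k).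
by apply: filterS2 (ev n) (ev n.+1) => z' /= -> ->.
Qed.

Lemma Lhat_compact : compact [set: Lhat].
Proof.
apply: set_type_compact; apply: (subclosed_compact _ (@tychonoff int (fun=> edge)
  (fun=> setT) (fun=> edge_compact))) => //.
have -> : is_bipath = \bigcap_(n in [set: int]) [set z : {ptws int ->
  edge} | tgt (z n) = src (z (n + 1))].
  by apply/seteqP; split => [z zP n _|z zP n]; [exact: zP|exact: (zP n I)].
apply: closed_bigI => n _; rewrite -openC openE => z zn.
have ev k : \forall z' \near z, z' k = z k.
  have /edge_continuous/(_ z)// : continuous (fun z : {ptws int -> edge} => z k).
  exact: (@proj_continuous int (fun=> edge) k).
by apply: filterS2 (ev n) (ev (n + 1)) => z' /= -> ->.
Qed.

Lemma mu_continuous : continuous mu.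
Proof.
apply: L_continuous => q n; apply: filterS (L_near_prefix q n.+2) => q' qq'.
rewrite !muE !qq'//; congr (if _ then _ else _).
apply/all_onesP/all_onesP => h k kn; have := h k kn; rewrite /digit.
  by rewrite [\val q' k]qq'// ltnW// ltnW.
by rewrite [\val q' k]qq'// ltnW// ltnW.
Qed.

(** * Real codes of paths and of 2-adic integers *)

Section Codes.
Context {R : realType}.

Lemma expansion24_continuous {U : topologicalType} (f : U -> nat -> nat) :
  (forall u k, (f u k <= 11)%N) -> (forall u n, \forall u' \near u, f u' n = f u n)
    ->
  continuous (fun u => expansion 24 (f u) : R).
Proof.
move=> f11 fn u; apply/cvgrPdist_le => e e0.
have [n ne] : exists n, (24^-1 : R) ^+ n < e by apply: exprV_small => //; lra.
apply: filterS (near_prefix n (fn u)) => u' uu'.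
rewrite distrC; apply: le_trans (expansion_close _ _ uu') _; try exact: digit_seq24.
by rewrite -exprVn ltW.
Qed.

Definition edge_code (e : edge) : nat := (6 * e.1 + vertex_code e.2)%N.

Lemma edge_code_inj : injective edge_code.
Proof. by move=> [[] []] [[] []]. Qed.

Lemma edge_code_le e : (edge_code e <= 11)%N.
Proof. by move: e => [[] []]. Qed.

Definition L_code (q : L) : R := expansion 24 (fun n => edge_code (sval q n)).

Lemma L_code_continuous : continuous L_code.
Proof.
apply: (@expansion24_continuous L (fun q n => edge_code (sval q n))) => [q k|q n].
  exact: edge_code_le.
by apply: filterS (L_near q n) => q' ->.
Qed.

Lemma L_code_inj : injective L_code.
Proof.
move=> q q' /expansion24_inj qq'; apply: val_inj; apply/funext => n.
by apply: edge_code_inj; exact: (congr1 (fun f =>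
  f n) (qq' (fun=> edge_code_le _) (fun=> edge_code_le _))).
Qed.

Definition Z2_code (x : Z2) : R := expansion 24 (fun n => Z2_dig x n).

Lemma Z2_dig_near (x : Z2) n : \forall x' \near x, Z2_dig x' n = Z2_dig x n.
Proof. by apply: filterS2 (Z2_near x n) (Z2_near x n.+1) => x' h h';
  rewrite /Z2_dig h h'. Qed.

Lemma Z2_code_continuous : continuous Z2_code.
Proof.
apply: (@expansion24_continuous Z2 (fun x n => Z2_dig x n)) => [x k|x n].
  by case: Z2_dig.
by apply: filterS (Z2_dig_near x n) => x' ->.
Qed.

Lemma Z2_code_inj : injective Z2_code.
Proof.
move=> x x' /expansion24_inj xx'; rewrite -(Z2_digitsK x) -(Z2_digitsK x');
  congr Z2_digits.
apply/funext => n; have b11 (b : bool) : (b <= 11)%N by case: b.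
have := congr1 (fun f => f n) (xx' (fun=> b11 _) (fun=> b11 _)).
by case: (Z2_dig x n); case: (Z2_dig x' n).
Qed.

Lemma real_digits_continuous {U : topologicalType} (f : U -> nat -> bool) :
  (forall u n, \forall u' \near u, f u' n = f u n) ->
  continuous (fun u => real_digits R (f u)).
Proof.
move=> fn u; apply/cvgrPdist_le => e e0.
have [n ne] : exists n, (2^-1 : R) ^+ n < e by apply: exprV_small => //; lra.
apply: filterS (near_prefix n (fn u)) => u' uu'; rewrite distrC !real_digitsE.
apply: le_trans (expansion_close (n := n) (digit_seq2 _) (digit_seq2 _) _) _.
  by move=> k kn; rewrite uu'.
by rewrite -exprVn ltW.
Qed.

End Codes.

Lemma L_hausdorff : hausdorff_space L.
Proof.
apply: ptws_set_hausdorff; apply: hausdorff_prod; exact: discrete_hausdorff.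
Qed.

Lemma Z2_hausdorff : hausdorff_space Z2.
Proof. by apply: ptws_set_hausdorff; exact: discrete_hausdorff. Qed.

Lemma Z2t_subbase_open (A : set Z2t) : Z2t_subbase A -> open A.
Proof.
move=> SA; exists [set A]; last by rewrite bigcup_set1.
move=> _ ->; exists [fset A]%fset; first by move=> B /fset1P ->; exact: mem_set.
by apply/seteqP; split => [z zA|z zA B] /=; [apply: zA;
  rewrite /= inE|rewrite inE => /eqP ->].
Qed.

Lemma Z2t_continuous {U : topologicalType} (f : U -> Z2t) :
  (forall A, Z2t_subbase A -> open (f @^-1` A)) -> continuous f.
Proof.
move=> fo; apply/continuousP => A [D DS <-].
rewrite preimage_bigcup; apply: bigcup_open => B /DS[F FS <-].
rewrite preimage_bigcap openE => u uF; rewrite /interior.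
apply: filter_bigI => C CF; have /FS/set_mem SC := CF.
by apply: open_nbhs_nbhs; split; [exact: fo|exact: uF].
Qed.

Lemma Z2t_proj_continuous : continuous Z2t_proj.
Proof.
by apply/continuousP => A oA; apply: Z2t_subbase_open; left; exists A.
Qed.

Definition Z2t_cell (t : bool) (N : nat) : set Z2t :=
  [set z | z = inr (0, t) \/
     exists2 n, (N <= n)%N & Z2_layer (2 * n + t)%N (Z2t_proj z)].

Lemma Z2_layer_int0 n : ~ Z2_layer n (Z2_of_int 0).
Proof. by rewrite Z2_of_int0 Z2_layer_digits => -[]. Qed.

(** Points over different elements of Z_2 are separated there. The two points over an integer are
    separated by translated cells: their layers have indices of opposite parity, and a point lies in
    at most one layer. *)
Lemma Z2t_hausdorff : hausdorff_space Z2t.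
Proof.
rewrite open_hausdorff => z z' zz'; have [pz|pz] := eqVneq (Z2t_proj z) (Z2t_proj
  z'); last first.
  have := Z2_hausdorff; rewrite open_hausdorff =>
    /(_ _ _ pz) [[A B] /= [zA zB] [oA oB AB]].
  exists (Z2t_proj @^-1` A, Z2t_proj @^-1` B) => /=;
    first by rewrite !inE in zA zB *.
  split; [exact: open_comp (in1W Z2t_proj_continuous) oA|exact: open_comp (in1W
    Z2t_proj_continuous) oB|].
  by rewrite -preimage_setI (eqP AB) preimage_set0.
case: z z' pz zz' => [x|[a t]] [x'|[a' t']] /= pz zz'.
- by case/eqP: zz'; congr inl; exact: val_inj.
- by have []: ~ range Z2_of_int (\val x) by [exact: set_mem (valP x)]; exists a'.
- by have []: ~ range Z2_of_int (\val x') by [exact: set_mem (valP x')]; exists a.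
- have aa' := Z2_of_int_inj pz; rewrite -aa' in zz' * => {a' aa' pz}.
  have tt' : t != t' by apply: contra_neq zz' => ->.
  exists (Z2t_shift a @` Z2t_cell t 0, Z2t_shift a @` Z2t_cell t' 0) => /=.
    by rewrite !inE; split; [exists (inr (0, t))|exists (inr (0, t'))];
      rewrite /= ?add0r//; left.
  split; [apply: Z2t_subbase_open; right; by exists t, 0%N, a|apply:
    Z2t_subbase_open; right; by exists t', 0%N, a|].
  apply/eqP/seteqP; split => // _ [[z zt <-] [z' zt' /(can_inj (@Z2t_shiftK a))
    zz2]]; subst z'.
  case: zt zt' => [->|[n _ zn]] [].
  + by move=> [tt2]; rewrite tt2 eqxx in tt'.
  + by move=> [n _ /= /Z2_layer_int0].
  + by move=> zE; move: zn; rewrite zE /= => /Z2_layer_int0.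
  + move=> [n' _ zn']; have := Z2_layer_uniq zn zn'; move: tt'.
    by case: t t' {zn zn' zz'} => [] []//= _; lia.
Qed.

Lemma add_cocycle_inj : injective add_cocycle.
Proof.
move=> [s z] [s' z'] [] /[swap] /(can_inj (@Z2t_shiftK 1)) ->.
by move/addIb => ->.
Qed.

Lemma add_cocycle_surj p : exists p', add_cocycle p' = p.
Proof.
case: p => s z; exists (s (+) phi z, Z2t_shift (-1) z).
by rewrite /add_cocycle /= Z2t_shiftNK -addbA addbb addbF.
Qed.

Lemma Psi_inj : injective Psi. Proof. exact: can_inj PsiK. Qed.

(** Bijectivity is read off the conjugate [add_cocycle]. Here [Psi] enters only as a bijection,
    since the proof of its continuity relies on this lemma. *)
Lemma mu_homeomorphism : homeomorphism mu.
Proof.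
apply: compact_bij_homeomorphism.
- exact: L_compact.
- exact: (L_hausdorff).
- exact: mu_continuous.
- by move=> q q' qq'; apply/Psi_inj/add_cocycle_inj; rewrite -!Psi_mu qq'.
- move=> q; have [p pq] := add_cocycle_surj (Psi q).
  by exists (Psi_inv p); apply: Psi_inj; rewrite Psi_mu Psi_invK.
Qed.

Lemma digits_continuous : continuous (fun q : L => Z2_digits (digit (\val q))).
Proof.
apply: Z2_continuous => q n; apply: filterS (L_near_prefix q n) => q' qq'.
by apply: eq_bigr => k _; rewrite /digit [\val q' k]qq'.
Qed.

(** Translation by k is realized on L by a power of [mu], so the preimage of a translated cell is
    the preimage of a cell under a continuous map, and only the cells around the points (0, t) have
    to be examined. *)
Lemma Psi_shift (k : int) : exists m : L -> L,
  continuous m /\ forall q, (Psi (m q)).2 = Z2t_shift k (Psi q).2.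
Proof.
have [_ [m [cm mK Km]]] := mu_homeomorphism.
have step q : (Psi (mu q)).2 = Z2t_shift 1 (Psi q).2 by rewrite Psi_mu.
have stepm q : (Psi (m q)).2 = Z2t_shift (-1) (Psi q).2.
  by rewrite -[in RHS](Km q) step Z2t_shiftK.
case: k => n; elim: n => [|n [f [cf fE]]].
- by exists id; split => q; [exact: cvg_id|exact/esym/Z2t_shift0].
- exists (mu \o f); split => [q|q]; last by rewrite /comp step fE Z2t_shiftD -intS.
  by apply: continuous_comp; [exact: cf|exact: mu_continuous].
- by exists m; split.
- exists (m \o f); split => [q|q].
    by apply: continuous_comp; [exact: cf|exact: cm].
  by rewrite /comp stepm fE Z2t_shiftD !NegzE -opprD -intS.
Qed.

(** If q lies over (0, t), a nearby path starts at the same vertex with a long run of 0s. The value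
    of [tau] at this vertex is t, and it is also the parity of the position of the first 1 of the
    nearby path, or its tag if there is no 1. *)
Lemma Psi_cell t N : open ((fun q => (Psi q).2) @^-1` Z2t_cell t N).
Proof.
rewrite openE => q []; last first.
  move=> [n Nn]; rewrite to_Z2t_proj Z2_layer_digits => -[q0 q1].
  apply: filterS (L_near_prefix q (2 * n + t).+1) => q' qq'.
  right; exists n => //; rewrite to_Z2t_proj Z2_layer_digits /digit.
  split => [k kn|]; rewrite [\val q' _]qq'//; last exact: ltnW.
  exact: q0.
move=> qt; have := congr1 Z2t_proj qt; rewrite to_Z2t_proj /= Z2_of_int0 =>
  /Z2_digits_inj q0.
have pt : parity (\val q) = t.
  rewrite -[RHS]/(Z2t_tag (inr (0%:Z, t))) -qt to_Z2t_tag// q0 -Z2_of_int0.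
  by exists 0.
(* With this prefix the first 1 of q', at position m, satisfies m > 2N + t; as m has the parity of
   t, it equals 2n + t for some n >= N. *)
apply: filterS (L_near_prefix q (2 * N + t).+1) => q' qq'.
have d0 k : (k < (2 * N + t).+1)%N -> digit (\val q') k = false.
  by move=> kN; rewrite -[RHS]/((fun=> false) k) -q0 /digit [\val q' k]qq'.
have tq' : tau (vertex_at (\val q') 0) = t.
  rewrite /vertex_at [\val q' 0%N]qq'// -[src _]/(vertex_at (\val q) 0) -pt.
  by rewrite (@parityE _ 0) ?addbF//; [exact: L_path|move=> m _; rewrite q0].
have [[n qn]|h] := pselect (exists n, digit (\val q') n).
  have [] := ex_minnP (ex_intro _ n qn) => m qm mmin.
  have mN : ((2 * N + t) < m)%N.
    by rewrite ltnNge; apply/negP => mN; move: qm; rewrite d0// ltnS.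
  have m0 k : (k < m)%N -> digit (\val q') k = false.
    by move=> km; apply/negP => /mmin; rewrite leqNgt km.
  have odd_m : odd m = t.
    rewrite -tq' (tau_seqE _ (L_path q')).
    case: m {qm mmin} (qm) mN m0 => // m qm _ m0.
    rewrite (@tau_seq_change _ _ _ m) //.
      by move=> k km; rewrite !add0n !m0// ltnW.
    by rewrite !add0n qm m0.
  right; exists m./2.
    by rewrite -leq_double -mul2n -[X in (_ <= X)%N]mul2n;
      move: (odd_double_half m); rewrite odd_m -mul2n; lia.
  rewrite to_Z2t_proj Z2_layer_digits mul2n addnC -odd_m odd_double_half.
  by split.
have q'0 : digit (\val q') = fun=> false.
  by apply/funext => n; apply/negP => ?; apply: h; exists n.
left; apply: (etrans (@Z2t_proj_inr (Psi q').2 0 _)).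
  by rewrite to_Z2t_proj q'0 Z2_of_int0.
congr (inr (_, _)); rewrite to_Z2t_tag; last by rewrite q'0 -Z2_of_int0; exists 0.
by rewrite (@parityE _ 0) ?addbF//; [exact: L_path|move=> m _; rewrite q'0].
Qed.

Lemma Psi_continuous : continuous Psi.
Proof.
suff [c1 c2] : continuous (fun q => (Psi q).1) /\ continuous (fun q => (Psi q).2).
  exact: pair_continuous c1 c2.
split.
  apply/bool_continuous => q; apply: filterS (L_near q 0%N) => q' qq'.
  by rewrite /= /vertex_at [\val q' 0%N]qq'.
apply: Z2t_continuous => A [[U oU ->]|[t [N [k ->]]]].
  rewrite (_ : _ @^-1` _ = (fun q : L => Z2_digits (digit (\val q))) @^-1` U).
    exact: open_comp (in1W digits_continuous) oU.
  by apply/seteqP; split => q /=; rewrite to_Z2t_proj.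
have [m [cm mE]] := Psi_shift (- k).
rewrite (_ : _ @^-1` _ = m @^-1` ((fun q => (Psi q).2) @^-1` Z2t_cell t N)).
  by apply: open_comp; [move=> q _; exact: cm|exact: Psi_cell].
apply/seteqP; split => q => [[z zt zq]|h].
  by have : Z2t_cell t N (Psi (m q)).2 by rewrite mE -zq Z2t_shiftK.
have {}h : Z2t_cell t N (Psi (m q)).2 by []; rewrite mE in h.
by exists (Z2t_shift (- k) (Psi q).2); rewrite ?Z2t_shiftNK.
Qed.

Lemma Psi_homeomorphism : homeomorphism Psi.
Proof.
apply: (@compact_homeomorphism _ _ _ Psi_inv).
- exact: L_compact.
- by apply: hausdorff_prod; [exact: discrete_hausdorff|exact: Z2t_hausdorff].
- exact: Psi_continuous.
- exact: PsiK.
- exact: Psi_invK.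
Qed.

(** * Mapping tori *)

(** Serves both coverings, [dev] and [circle_class]: each is an open map, and [J] is a piece on
    which it is injective. *)
Lemma local_section_continuous {A B : topologicalType} (g : A ->
  B) (J : set A) (l : B -> A) :
  (forall O, open O -> open (g @` O)) -> open J ->
  (forall a a', J a -> J a' -> g a = g a' -> a = a') ->
  (forall b, (g @` J) b -> J (l b) /\ g (l b) = b) ->
  forall b, (g @` J) b -> {for b, continuous l}.
Proof.
move=> go oJ gi lP b Jb O; rewrite {1}nbhsE => -[O' [oO' O'b] sO].
have [Jl gl] := lP b Jb.
have : nbhs b (g @` (O' `&` J)).
  apply: open_nbhs_nbhs; split; first by apply: go; exact: openI.
  by exists (l b).
apply: filterS => _ [a [O'a Ja] <-] /=; apply: sO.
have Ga : (g @` J) (g a) by exists a.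
by have [Jl' gl'] := lP _ Ga; rewrite (gi _ _ Jl' Ja gl').
Qed.

Section Metrizable.
Context {R : realType}.

(** An alias of [T]; the injectivity proof is part of the type so that the metric instance can
    retrieve the map. *)
Definition pullback_metric {T : choiceType} {V : normedModType R} (e : T -> V)
  of injective e : Type := T.

Section Instance.
Context {T : choiceType} {V : normedModType R} {e : T -> V} (ei : injective e).

Let dist (x y : T) : R := `|e x - e y|.

Let distxx x : dist x x = 0. Proof. by rewrite /dist subrr normr0. Qed.

Let dist_positivity x y : dist x y = 0 -> x = y.
Proof. by move/normr0_eq0/eqP; rewrite subr_eq0 => /eqP/ei. Qed.

Let dist_sym x y : dist x y = dist y x. Proof. exact: distrC. Qed.

Let dist_triangle y x z : dist x z <= dist x y + dist y z.
Proof. exact: ler_distD. Qed.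

HB.instance Definition _ := Choice.copy (pullback_metric ei) T.
HB.instance Definition _ := @isMetric.Build R (pullback_metric ei)
  dist distxx dist_positivity dist_sym dist_triangle.

End Instance.

Lemma embedding_metrizable {T : topologicalType} {V : normedModType R} (e : T -> V)
  :
  compact [set: T] -> continuous e -> injective e -> metrizable R T.
Proof.
move=> cT ce ei; pose M : metricType R := pullback_metric ei.
exists M, (id : T -> M); apply: compact_bij_homeomorphism => //.
- exact: (@metric_hausdorff _ M).
- move=> x; apply/cvg_ballP => r r0.
  have /cvgrPdist_lt/(_ _ r0) := ce x.
  by apply: filterS => y; rewrite ballEmdist.
- by move=> y; exists y.
Qed.

End Metrizable.

Section Torus.
Context {R : realType} {X : topologicalType} {f g : X -> X}.
Hypotheses (fK : cancel f g) (gK : cancel g f).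
Hypotheses (cf : continuous f) (cg : continuous g).

Local Notation I := (unit_interval R).
Local Notation T := (mapping_torus R f).
Local Notation cls := (@torus_class R X f).

Fact clamp_subproof (t : R) : `[0, 1]%classic (Num.max 0 (Num.min 1 t)).
Proof. by rewrite /= in_itv /= le_max lexx /= ge_max ler01 ge_min lexx. Qed.

(** A retraction of R onto the unit interval: it makes points of [unit_interval] from arbitrary
    reals, and keeps [chart] defined and continuous everywhere. *)
Definition clamp (t : R) : I := sub_elt (clamp_subproof t).

Lemma clampE t : 0 <= t <= 1 -> \val (clamp t) = t.
Proof. by move=> /andP[t0 t1] /=; rewrite (min_idPr t1) (max_idPr t0). Qed.

Lemma unit_intervalP (x : I) : 0 <= \val x <= 1.
Proof. by have := set_mem (valP x); rewrite /= in_itv. Qed.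

Lemma clampK (x : I) : clamp (\val x) = x.
Proof. by apply: val_inj; rewrite clampE// unit_intervalP. Qed.

Lemma clamp_continuous : continuous clamp.
Proof.
apply: set_type_continuous => /=; move=> t.
apply: (@continuous_max R R (fun=> 0) (Num.min 1) t); first exact: cst_continuous.
by apply: (@continuous_min R R (fun=> 1) id t);
  [exact: cst_continuous|exact: cvg_id].
Qed.

Lemma torus_class_continuous : continuous cls.
Proof. exact: class_continuous. Qed.

Lemma torus_class_surj (y : T) : exists q x, cls (q, x) = y.
Proof. by have [[q x] <-] := class_surj y; exists q, x. Qed.

Lemma torus_glue q : cls (q, clamp 1) = cls (f q, clamp 0).
Proof. by apply: class_eq; rewrite !clampE ?lexx ?ler01. Qed.

Definition iterz (k : int) : X -> X :=
  match k with Posz n => iter n f | Negz n => iter n.+1 g end.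

Lemma iterz1D k q : iterz (1 + k) q = f (iterz k q).
Proof.
case: k => [n|[|n]]; first by rewrite -intS.
  by rewrite /= gK.
by rewrite NegzE intS opprD addrA subrr add0r -NegzE /= gK.
Qed.

Lemma iterzD j k q : iterz (j + k) q = iterz j (iterz k q).
Proof.
elim/int_rect: j => [|n IH|n IH].
- by rewrite add0r.
- by rewrite intS -addrA (iterz1D (n%:Z + k)) IH (iterz1D n).
- apply: (can_inj fK); rewrite -(iterz1D (- n.+1%:Z)) -iterz1D.
  have e : 1 + - n.+1%:Z = - n%:Z by rewrite intS opprD addrA subrr add0r.
  by rewrite addrA e.
Qed.

Lemma iterzK k : cancel (iterz k) (iterz (- k)).
Proof. by move=> q; rewrite -iterzD addNr. Qed.

Lemma iterz_continuous k : continuous (iterz k).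
Proof.
have it (h : X -> X) n : continuous h -> continuous (iter n h).
  move=> ch; elim: n => [|n IH] q; first exact: cvg_id.
  exact: (@continuous_comp X X X (iter n h) h q (IH q) (ch _)).
by case: k => n; exact: it.
Qed.

(** The covering over the strip between heights k and k + 1, extended to all heights by [clamp]. *)
Definition chart (k : int) (p : X * R) : T := cls (iterz k p.1, clamp (p.2 -
  k%:~R)).

Lemma chart_continuous k : continuous (chart k).
Proof.
move=> p; apply: continuous_comp; last exact: torus_class_continuous.
apply: pair_continuous => {}p.
  by apply: continuous_comp; [exact: fst_continuous|exact: iterz_continuous].
apply: continuous_comp; last exact: clamp_continuous.
by apply: cvgB; [exact: cvg_snd|exact: cvg_cst].
Qed.

(* The covering of the mapping torus by X * R, whose deck group is generated by
   (q, t + 1) |-> (f q, t). *)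
Definition dev (p : X * R) : T := chart (Num.floor p.2) p.

Lemma chart_glue k q : chart k (q, (k + 1)%:~R) = chart (k + 1) (q, (k + 1)%:~R).
Proof.
by rewrite /chart /= subrr intrD addrAC subrr add0r torus_glue [k + 1]addrC iterz1D.
Qed.

Lemma devE k q t : k%:~R <= t <= k%:~R + 1 -> dev (q, t) = chart k (q, t).
Proof.
move=> /andP[kt]; rewrite le_eqVlt => /predU1P[tk|tk]; last first.
  by rewrite /dev (@floor_def _ _ k)// kt intrD.
have -> : t = (k + 1)%:~R by rewrite intrD.
by rewrite chart_glue /dev /= intrKfloor.
Qed.

Lemma dev_class q (x : I) : dev (q, \val x) = cls (q, x).
Proof.
by rewrite (@devE 0) ?add0r ?unit_intervalP// /chart /= subr0 clampK.
Qed.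

Lemma dev_continuous : continuous dev.
Proof.
move=> [q t] A; set k := Num.floor t => nA.
have /andP[kt tk] := floor_itv t; rewrite -/k in kt tk.
have nk : \forall p \near (q, t), A (chart k p) by exact: (@chart_continuous k (q,
  t) _ nA).
have tk1 : \forall p \near (q, t), p.2 < k%:~R + 1.
  apply: (@snd_continuous X R (q, t) [set s | s < k%:~R + 1]).
  by apply: open_nbhs_nbhs; split; [exact: open_lt|rewrite /= -intrD1].
move: kt; rewrite le_eqVlt => /predU1P[kt|kt]; last first.
  have tk2 : \forall p \near (q, t), k%:~R < p.2.
    apply: (@snd_continuous X R (q, t) [set s | k%:~R < s]).
    by apply: open_nbhs_nbhs; split; [exact: open_gt|].
  apply: filterS2 nk (filterI tk1 tk2) => -[q' t'] /= Ap [p1 p2].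
  by rewrite /= (@devE k)// ?(ltW p1) ?(ltW p2).
(* At an integer height the strips k - 1 and k meet; by [chart_glue] both charts take the same value
   at the point, so both stay in [A] nearby. *)
have tk2 : \forall p \near (q, t), (k - 1)%:~R < p.2.
  apply: (@snd_continuous X R (q, t) [set s | (k - 1)%:~R < s]).
  by apply: open_nbhs_nbhs; split; [exact: open_gt|rewrite /= -kt ltr_int ltrBlDr
    ltrDl].
have nk1 : \forall p \near (q, t), A (chart (k - 1) p).
  apply: (@chart_continuous (k - 1) (q, t)).
  by have := chart_glue (k - 1) q; rewrite subrK kt => ->.
apply: filterS2 (filterI nk nk1) (filterI tk1 tk2) => -[q' t'] /= [A1 A2] [p1 p2].
have [h|h] := leP k%:~R t'.
  by rewrite /= (@devE k)// h ltW.
by rewrite /= (@devE (k - 1))// -intrD1 subrK (ltW p2) (ltW h).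
Qed.

Lemma dev_shift k q t : dev (q, t + k%:~R) = dev (iterz k q, t).
Proof.
rewrite /dev /chart /= [Num.floor (t + _)](_ : _ = Num.floor t + k).
  by rewrite iterzD intrD opprD addrACA subrr addr0.
by rewrite floorDrz ?intr_int// intrKfloor.
Qed.

(** Coordinates in the fundamental domain X * [0, 1[, where height 1 is moved to height 0. This
    section of the covering decides equality in the torus. *)
Definition torus_coord : T -> X * R.
Proof.
refine (sval (@quotient_lift _ _ _ (fun p : X * I =>
  if \val p.2 == 1 then (f p.1, 0) else (p.1, \val p.2)) _)).
by move=> [q x] [q' x'] /= [-> -> ->]; rewrite eqxx eq_sym oner_eq0.
Defined.

Lemma torus_coordE q x : torus_coord (cls (q, x)) =
  if \val x == 1 then (f q, 0) else (q, \val x).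
Proof. by rewrite /torus_coord; case: quotient_lift => h /= ->. Qed.

Lemma torus_coord_dev q t : torus_coord (dev (q, t)) =
  (iterz (Num.floor t) q, t - (Num.floor t)%:~R).
Proof.
have /andP[kt tk] := floor_itv t.
rewrite torus_coordE clampE /=; last by rewrite subr_ge0 kt lerBlDl -intrD1 ltW.
by rewrite lt_eqF// ltrBlDl -intrD1.
Qed.

Lemma dev_eq q t q' t' : dev (q, t) = dev (q', t') ->
  exists k : int, t' = t + k%:~R /\ q = iterz k q'.
Proof.
move=> /(congr1 torus_coord); rewrite !torus_coord_dev => -[qq' tt'].
exists (Num.floor t' - Num.floor t); split.
  by rewrite intrD rmorphN /= addrCA tt' subrKC.
by rewrite addrC iterzD -qq' iterzK.
Qed.

Lemma dev_inj q q' t : dev (q, t) = dev (q', t) -> q = q'.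
Proof.
move=> /dev_eq[k [/eqP]]; rewrite -[X in X == _]addr0 (inj_eq (addrI t)) eq_sym
  intr_eq0.
by move=> /eqP ->.
Qed.

Lemma dev_open (O : set (X * R)) : open O -> open (dev @` O).
Proof.
move=> oO; rewrite class_open.
(* The set of points mapped into the image of [O] is the union of the translates of [O] under the
   deck group. *)
have -> : class _ @^-1` (dev @` O) =
    \bigcup_(k in [set: int]) ((fun p : X * I =>
      (iterz (- k) p.1, \val p.2 + k%:~R)) @^-1` O).
  apply/seteqP; split => [[q x] /= [[q' t] Ot]|[q x] [k _ /= Ok]].
    rewrite -[class _ _]/(cls (q, x)) -dev_class => /esym/dev_eq[k [tk qk]].
    by exists k => //=; rewrite qk iterzK -tk.
  exists (iterz (- k) q, \val x + k%:~R) => //.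
  by rewrite dev_shift -{1}(opprK k) iterzK dev_class.
apply: bigcup_open => k _; apply: open_comp => // p _.
apply: pair_continuous => {}p.
  by apply: continuous_comp; [exact: fst_continuous|exact: iterz_continuous].
apply: cvgD; last exact: cvg_cst.
by apply: continuous_comp; [exact: snd_continuous|exact: set_val_continuous].
Qed.

Lemma dev_surj y : exists p, dev p = y.
Proof. by have [q [x <-]] := torus_class_surj y; exists (q, \val x);
  rewrite dev_class. Qed.

(** * Embedding of a mapping torus in a Euclidean space *)

Section Embedding.
Context {c : X -> R}.
Hypotheses (cc : continuous c) (ci : injective c).

Lemma tent0 (a b : R) : Num.max 0 (1 - 2 * 0) * a + Num.max 0 (2 * 0 - 1) * b = a.
Proof.
by rewrite mulr0 subr0 sub0r (max_idPr ler01) (max_idPl (lerN10 _)) mul1r mul0r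
  addr0.
Qed.

Lemma tent1 (a b : R) : Num.max 0 (1 - 2 * 1) * a + Num.max 0 (2 * 1 - 1) * b = b.
Proof.
have -> : 1 - 2 * 1 = -1 :> R by ring.
have -> : 2 * 1 - 1 = 1 :> R by ring.
by rewrite (max_idPr ler01) (max_idPl (lerN10 _)) mul1r mul0r add0r.
Qed.

(* The first two coordinates determine x up to 0 ~ 1, the third one separates the
   points of a fibre over ]0, 1[, the last one those of the fibre over 0 ~ 1. *)
Definition torus_emb_fun (p : X * I) : R * R * R * R :=
  let x := \val p.2 in
  (x * (1 - x), x * (1 - x) * (1 - 2 * x), x * (1 - x) * c p.1,
   Num.max 0 (1 - 2 * x) * c p.1 + Num.max 0 (2 * x - 1) * c (f p.1)).

Definition torus_emb : T -> R * R * R * R.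
Proof.
refine (sval (@quotient_lift _ _ _ torus_emb_fun _)).
move=> [q x] [q' x'] /= [x1 x0 ->]; rewrite /torus_emb_fun /= in x1 x0 *;
  rewrite x1 x0.
by rewrite tent0 tent1; congr (_, _, _, _); ring.
Defined.

Lemma torus_embE p : torus_emb (cls p) = torus_emb_fun p.
Proof. by rewrite /torus_emb; case: quotient_lift => h /= ->. Qed.

Lemma torus_emb_continuous : continuous torus_emb.
Proof.
apply: quotient_fun_continuous.
have -> : (fun x => torus_emb (class _ x)) = torus_emb_fun.
  by apply/funext => p; exact: torus_embE.
have cv : continuous (fun p : X * I => \val p.2 : R).
  move=> p; apply: continuous_comp; [exact: snd_continuous|exact:
    set_val_continuous].
have c1 : continuous (fun p : X * I => c p.1).
  move=> p; apply: continuous_comp; [exact: fst_continuous|exact: cc].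
have c2 : continuous (fun p : X * I => c (f p.1)).
  move=> p; apply: (@continuous_comp _ _ _ (fun p : X * I => f p.1) c);
    last exact: cc.
  by apply: continuous_comp; [exact: fst_continuous|exact: cf].
have one : continuous (fun _ : X * I => 1 : R) by exact: cst_continuous.
have two : continuous (fun _ : X * I => 2 : R) by exact: cst_continuous.
have zero : continuous (fun _ : X * I => 0 : R) by exact: cst_continuous.
have cu : continuous (fun p : X * I => \val p.2 * (1 - \val p.2) : R).
  by move=> p; apply: cvgM; [exact: cv|apply: cvgB; [exact: one|exact: cv]].
have cw : continuous (fun p : X * I => 1 - 2 * \val p.2 : R).
  by move=> p; apply: cvgB; [exact: one|apply: cvgM; [exact: two|exact: cv]].
have cw' : continuous (fun p : X * I => 2 * \val p.2 - 1 : R).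
  by move=> p; apply: cvgB; [apply: cvgM; [exact: two|exact: cv]|exact: one].
apply: pair_continuous; first apply: pair_continuous; first apply: pair_continuous.
- exact: cu.
- by move=> p; apply: cvgM; [exact: cu|exact: cw].
- by move=> p; apply: cvgM; [exact: cu|exact: c1].
- move=> p; apply: cvgD; apply: cvgM.
  + exact: (@continuous_max R (X * I)%type (fun=> 0) (fun p : X * I =>
      1 - 2 * \val p.2) p (zero p) (cw p)).
  + exact: c1.
  + exact: (@continuous_max R (X * I)%type (fun=> 0) (fun p : X * I =>
      2 * \val p.2 - 1) p (zero p) (cw' p)).
  + exact: c2.
Qed.

Lemma torus_emb_inj : injective torus_emb.
Proof.
move=> y y'; have [q [x <-]] := torus_class_surj y;
  have [q' [x' <-]] := torus_class_surj y'.
rewrite !torus_embE /torus_emb_fun /= => -[e1 e2 e3 e4].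
rewrite -(clampK x) -(clampK x') -[\val x]/(sval x) -[\val x']/(sval x').
move: (sval x) (sval x') e1 e2 e3 e4 => u v e1 e2 e3 e4.
have [u0|u0] := eqVneq (u * (1 - u)) 0; last first.
  have uu : u = v.
    have /(mulfI u0) : u * (1 - u) * (1 - 2 * u) = u * (1 - u) * (1 - 2 * v) by
      rewrite e2 e1.
    by move=> ?; lra.
  by move: e3; rewrite -uu => /(mulfI u0)/ci ->.
have x0 : v * (1 - v) = 0 by rewrite -e1.
have cas (s : R) : s * (1 - s) = 0 -> s = 0 \/ s = 1.
  by move=> /eqP; rewrite mulf_eq0 => /orP[/eqP|/eqP ?]; [left|right; lra].
case: (cas _ u0) e4 => ->; case: (cas _ x0) => ->; rewrite ?tent0 ?tent1 => /ci.
- by move=> ->.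
- by move=> ->; rewrite torus_glue.
- by move=> <-; rewrite torus_glue.
- by move=> /(can_inj fK) ->.
Qed.

Lemma torus_hausdorff : hausdorff_space T.
Proof.
apply: hausdorff_inj torus_emb_continuous torus_emb_inj _.
by do !apply: hausdorff_prod; exact: Rhausdorff.
Qed.

End Embedding.

End Torus.

(** * The relation sim and the mapping torus of mu *)

(** A run that passes through states mu_{jk} up to position n and leaves them there along an edge
    0_j|1_j, into the identity part. *)
Definition carry_at (w w' : int -> edge) (n : int) : Prop :=
  [/\ forall k, k < n -> (w k).1 /\ (w' k).1 = false, (w n).1 = false, (w' n).1,
    tgt (w n) = tgt (w' n) & forall k, n < k -> w k = w' k].

(** A run that stays among the carry states forever; these are then of the form (v, [nu v]). *)
Definition carry_infinite (w w' : int -> edge) : Prop :=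
  forall k, [/\ (w k).1, (w' k).1 = false & src (w' k) = nu (src (w k))].

(* The ten pairs jk for which mu_{jk} is a state of A_mu. *)
Definition legit (m : vertex * vertex) : bool :=
  m \in [:: (vc, va); (vb, va); (vc, ve); (vd, vf); (ve, vf); (vd, vb);
            (va, vd); (vb, ve); (vf, vc); (ve, vb)].

(** On every edge leaving mu_{jk}, the vertices j and k are the start vertices of the two labels, so
    the labels of a run determine its carry states. *)
Lemma mu_edgesP m (x y : edge) t : (m, x, y, t) \in mu_edges ->
  m = (src x, src y) /\
  ((exists v, [/\ x = (false, v), y = (true, v) & t = inl v]) \/
   [/\ x.1, y.1 = false, src y = nu (src x) & t = inr (tgt x, tgt y)]).
Proof.
rewrite !inE.
have fin x' y' t' m' : (m, x, y, t) == (m', x', y', t') -> 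
    [\/ m' = (src x', src y') /\ exists v, [/\ x' = (false, v), y' = (true, v) &
      t' = inl v] |
      m' = (src x', src y') /\ [/\ x'.1, y'.1 = false, src y' = nu (src x') &
        t' = inr (tgt x', tgt y')]] ->
    m = (src x, src y) /\
    ((exists v, [/\ x = (false, v), y = (true, v) & t = inl v]) \/
      [/\ x.1, y.1 = false, src y = nu (src x) & t = inr (tgt x, tgt y)]).
  by move=> /eqP[-> -> -> ->] [] [mE h]; split => //; [left|right].
(* The first six entries of [mu_edges] leave for the identity part, the other ten pass the carry
   on. *)
do 6! (case/orP; first by move/fin; apply; left; split => //; eexists).
do 9! (case/orP; first by move/fin; apply; right).
by move/fin; apply; right.
Qed.

Lemma mu_edges_exit v : ((src (false, v), src (true, v)), (false, v), (true, v),
  inl v) \in mu_edges.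
Proof. by case: v. Qed.

Lemma mu_edges_stay (x y : edge) : x.1 -> y.1 = false -> legit (tgt x, tgt y) ->
  ((src x, src y), x, y, inr (tgt x, tgt y)) \in mu_edges.
Proof. by move: x y => [[] []] [[] []]. Qed.

Lemma legit_exit v : legit (src (false, v), src (true, v)).
Proof. by case: v. Qed.

Lemma legit_stay (x y : edge) : x.1 -> y.1 = false -> legit (tgt x, tgt y) ->
  legit (src x, src y).
Proof. by move: x y => [[] []] [[] []]. Qed.

Lemma legit_nu (x : edge) : x.1 -> legit (src x, nu (src x)).
Proof. by move: x => [[] []]. Qed.

Lemma int_up (P : int -> Prop) n : P n -> (forall k, P k -> P (k + 1)) ->
  forall k, n <= k -> P k.
Proof.
move=> Pn step k nk; rewrite -(subrKC n k).
case: (k - n) (subr_ge0 n k) => m; rewrite nk//; elim: m => [|m IH] _;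
  first by rewrite addr0.
by rewrite -addn1 PoszD addrA; apply: step; exact: IH.
Qed.

Lemma int_down (P : int -> Prop) n : P n -> (forall k, P (k + 1) -> P k) ->
  forall k, k <= n -> P k.
Proof.
move=> Pn step k kn; rewrite -(opprK k).
apply: (@int_up (fun j => P (- j)) (- n)); rewrite ?opprK ?lerN2// => j Pj.
by apply: step; rewrite opprD subrK.
Qed.

Definition mu_run (w w' : int -> edge) : Prop :=
  exists s : int -> Amu_state, forall n, Amu_edge (s n) (w n) (w' n) (s (n + 1)).

Lemma Lhat_path (w : Lhat) n : tgt (sval w n) = src (sval w (n + 1)).
Proof. exact: (set_mem (valP w)). Qed.

(** The identity part is absorbing to the right. A run therefore stays in it, never enters it, or
    enters it after exactly one position n. Conversely, the pairs of start vertices serve as carry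
    states. *)
Lemma mu_runP (w w' : Lhat) : mu_run (sval w) (sval w') <->
  [\/ w = w', exists n, carry_at (sval w) (sval w') n | carry_infinite (sval w)
    (sval w')].
Proof.
split=> [[s sP]|].
- pose isl k := if s k is inl _ then true else false.
  have step k : isl k -> isl (k + 1) /\ sval w k = sval w' k.
    rewrite /isl; have := sP k; case: (s k) => //= v /and3P[_ /eqP -> /eqP ->].
    by [].
  have [h|h] := pselect (forall k, isl k).
    by constructor 1; apply: val_inj; apply/funext => k; exact: (step k (h k)).2.
  have [n0 n0P] : exists n0, ~~ isl n0.
    by apply: contrapT => h'; apply: h => k; apply: contrapT => /negP hk;
      apply: h'; exists k.
  have edgeP k : ~~ isl k -> let x := sval w k in let y := sval w' k in
      (exists v, [/\ x = (false, v), y = (true, v) & isl (k + 1)]) \/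
      [/\ x.1, y.1 = false, src y = nu (src x) & ~~ isl (k + 1)].
    rewrite /isl; have := sP k; case: (s k) => //= m /mu_edgesP[_ H] _.
    case: H => [[v [-> -> ->]]|[-> -> -> ->]]; last by right.
    by left; exists v.
  have [[n1 n1P]|h1] := pselect (exists n, isl n); last first.
    constructor 3 => k; have nk j : ~~ isl j by apply/negP => ?; apply: h1;
      exists j.
    by case: (edgeP k (nk k)) => [[v [_ _]]|[]//]; rewrite (negbTE (nk _)).
  have [n [nP nP1]] : exists n, ~~ isl n /\ isl (n + 1).
    apply: contrapT => h2; suff : ~~ isl n1 by rewrite n1P.
    case: (leP n0 n1) => [|/ltW] n01.
      by apply: (@int_up (fun k => ~~ isl k) n0 n0P _ n1 n01) => k nk;
        apply/negP => k1; apply: h2; exists k.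
    apply: (@int_down (fun k => ~~ isl k) n0 n0P _ n1 n01) => k nk;
      apply/negP => /step[k1 _].
    by rewrite k1 in nk.
  have before k : k <= n -> ~~ isl k.
    by apply: (@int_down (fun k => ~~ isl k) n nP) => j nj; apply/negP =>
      /step[j1 _]; rewrite j1 in nj.
  have after k : n + 1 <= k -> isl k by apply: (@int_up isl (n + 1) nP1) =>
    j /step[].
  constructor 2; exists n; split.
  + move=> k kn; case: (edgeP k (before _ (ltW kn))) => [[v [_ _]]|[]//].
    by rewrite (negbTE (before _ _))// lezD1.
  + by case: (edgeP n nP) => [[v [->]]//|[_ _ _]]; rewrite nP1.
  + by case: (edgeP n nP) => [[v [_ ->]]//|[_ _ _]]; rewrite nP1.
  + by case: (edgeP n nP) => [[v [-> ->]]//|[_ _ _]]; rewrite nP1.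
  + by move=> k nk; apply: (step k (after k _)).2; rewrite lezD1.
- case=> [<-|[n [before wn w'n tn after]]|inf].
  + exists (fun k => inl (src (sval w k))) => k /=; rewrite eqxx/= eqxx/=.
    by rewrite -Lhat_path.
  + exists (fun k => if k <= n then inr (src (sval w k), src (sval w' k)) else inl
      (src (sval w k))) => k.
    have wnE : sval w n = (false, tgt (sval w n)) by rewrite -wn
      -surjective_pairing.
    have w'nE : sval w' n = (true, tgt (sval w n)) by rewrite tn -w'n
      -surjective_pairing.
    (* Admissibility of the pairs of start vertices is traced leftwards from the exit: going back
       along a maximal and a minimal edge preserves it. *)
    have leg j : j <= n -> legit (src (sval w j), src (sval w' j)).
      move=> jn; move: jn (jn); apply: (@int_down (fun j => j <= n ->
        legit (src (sval w j), src (sval w' j))) n) => [_|l lP ln].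
        by rewrite wnE w'nE; exact: legit_exit.
      have [l1|l1] := leP (l + 1) n.
        have [wl w'l] : (sval w l).1 /\ (sval w' l).1 = false by apply: before;
          rewrite -lezD1.
        by apply: legit_stay => //; rewrite !Lhat_path; exact: lP.
      have -> : l = n by apply/eqP; rewrite eq_le ln -ltzD1.
      by rewrite wnE w'nE; exact: legit_exit.
    case: (ltgtP k n) => [kn|nk|->].
    * rewrite lezD1 kn; have [wk w'k] := before k kn.
      rewrite -!Lhat_path; apply: mu_edges_stay => //; rewrite !Lhat_path;
        apply: leg.
      by rewrite lezD1.
    * have nk1 : n < k + 1 by rewrite (lt_trans nk)// ltrDl.
      by rewrite (lt_geF nk1) /= -Lhat_path (after k nk) !eqxx.
    * have nn1 : n < n + 1 by rewrite ltrDl.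
      rewrite (lt_geF nn1) -Lhat_path wnE w'nE; exact: mu_edges_exit.
  + exists (fun k => inr (src (sval w k), src (sval w' k))) => k.
    rewrite -!Lhat_path; have [wk w'k _] := inf k; apply: mu_edges_stay => //.
    rewrite !Lhat_path; have [wk1 _ ->] := inf (k + 1); exact: legit_nu.
Qed.

(** A run that is in a carry state was in the same copy of the carry states at all earlier
    positions, since no edge returns to them from the identity part; so it cannot use both
    copies. *)
Lemma sim_run (w w' : Lhat) : sim w w' <-> mu_run (sval w) (sval w') \/ mu_run
  (sval w') (sval w).
Proof.
split => [[s sP]|[[s sP]|[s sP]]]; last 2 first.
- by exists (fun n => N_embed false (s n)) => n; exists (s n), (s (n + 1)); left.
- by exists (fun n => N_embed true (s n)) => n; exists (s n), (s (n + 1)); right.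
pose Iv b k := exists m, s k = inr (b, m).
have back b k : Iv b (k + 1) -> Iv b k.
  move=> [m sk1]; have [t [t' [[]|[]]]] := sP k; rewrite sk1; case: t => [v|m'].
  - by move=> /= /and3P[_ _ /eqP ->].
  - by move=> _ skE; case: t' => //= m'' [bb _]; exists m'; rewrite skE bb.
  - by move=> /= /and3P[_ _ /eqP ->].
  - by move=> _ skE; case: t' => //= m'' [bb _]; exists m'; rewrite skE bb.
have inlP k v : s k = inl v -> Amu_edge (inl v) (sval w k) (sval w' k) (inl (tgt
  (sval w k)))
    /\ s (k + 1) = inl (tgt (sval w k)).
  move=> sk; have [t [t' [[]|[]]]] := sP k; rewrite sk; case: t =>
    [v'|m'] //= /and3P[/eqP <- /eqP -> /eqP ->] [->] ->.
    by rewrite !eqxx.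
  by rewrite !eqxx.
have dich b k0 : Iv b k0 -> forall k, (exists v, s k = inl v) \/ Iv b k.
  move=> Ik0 k; case: (leP k k0) => kk0; first by right;
    exact: (int_down Ik0 (back b) kk0).
  case sk : (s k) => [v|[b' m]]; first by left; exists v.
  right; suff <- : b' = b by exists m.
  have [m' e'] : Iv b' k0 by apply: (int_down _ (back b') (ltW kk0)); exists m.
  by case: Ik0 => m0; rewrite e' => -[].
have [[k0 Ik0]|hf] := pselect (exists k, Iv true k).
  right; exists (fun k => match s k with inl v => inl v | inr (_, m) =>
    inr m end) => k.
  case: (dich _ _ Ik0 k) => [[v sk]|[m sk]].
    rewrite sk; have [e ->] := inlP _ _ sk; move: e => /= /and3P[/eqP <- /eqP -> _].
    by rewrite !eqxx.
  rewrite sk; have [t [t' [[]|[]]]] := sP k; rewrite sk.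
    by case: t => [v|m'] //= _ [].
  by case: t => [v|m'] // e [->] ->; case: t' e.
left; exists (fun k => match s k with inl v => inl v | inr (_, m) =>
  inr m end) => k.
have [[k0 Ik0]|hf'] := pselect (exists k, Iv false k).
  case: (dich _ _ Ik0 k) => [[v sk]|[m sk]].
    by rewrite sk; have [e ->] := inlP _ _ sk.
  rewrite sk; have [t [t' [[]|[]]]] := sP k; rewrite sk.
    by case: t => [v|m'] // e [->] ->; case: t' e.
  by case: t => [v|m'] //= _ [].
case sk : (s k) => [v|[[] m]]; last 2 first.
- by case: hf; exists k, m.
- by case: hf'; exists k, m.
by have [e ->] := inlP _ _ sk.
Qed.

(** Each vertex has exactly one incoming edge of each digit, so a prefix is recovered from its
    digits and its end vertex. *)
Lemma path_backward (z z' : {ptws nat -> edge}) n : is_path z -> is_path z' ->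
  (forall k, (k < n)%N -> (z k).1 = (z' k).1) -> src (z n) = src (z' n) ->
  forall k, (k < n)%N -> z k = z' k.
Proof.
move=> zP z'P; elim: n => // n IH dz sz k; rewrite ltnS => kn.
have zn : z n = z' n.
  by rewrite [z n]surjective_pairing [z' n]surjective_pairing dz// -!/(tgt _) zP
    z'P sz.
move: kn; rewrite leq_eqVlt => /predU1P[->//|]; apply: IH; last by rewrite zn.
by move=> j jn; apply: dz; exact: ltnW.
Qed.

Definition carry_at_nat (z z' : nat -> edge) (n : nat) : Prop :=
  [/\ forall k, (k < n)%N -> (z k).1 /\ (z' k).1 = false, (z n).1 = false, (z' n).1,
    tgt (z n) = tgt (z' n) & forall k, (n < k)%N -> z k = z' k].

Definition carry_infinite_nat (z z' : nat -> edge) : Prop :=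
  forall k, [/\ (z k).1, (z' k).1 = false & src (z' k) = nu (src (z k))].

Lemma mu_carry (q : L) : (exists n, carry_at_nat (sval q) (sval (mu q)) n) \/
  carry_infinite_nat (sval q) (sval (mu q)).
Proof.
have [h|h] := pselect (exists n, ~~ digit (\val q) n).
  case: (ex_minnP h) => n qn nmin; left; exists n.
  have q1 k : (k < n)%N -> digit (\val q) k.
    by rewrite ltnNge; apply: contraR => /nmin.
  have ones k : all_ones (digit (\val q)) k = (k <= n)%N.
    apply/all_onesP/idP => [H|kn j jk]; last by apply: q1; exact: leq_trans jk kn.
    by rewrite leqNgt; apply/negP => /H; rewrite (negbTE qn).
  split.
  - move=> k kn; rewrite muE ones ltnW// /mu_local.
    by have := q1 k kn; rewrite /digit => ->.
  - exact: negbTE.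
  - by rewrite muE ones leqnn /mu_local; have := negbTE qn; rewrite /digit => ->.
  - by rewrite muE ones leqnn /mu_local; have := negbTE qn; rewrite /digit => ->.
  - by move=> k nk; rewrite muE ones leqNgt nk.
have q1 n : digit (\val q) n by apply: contrapT => /negP ?; apply: h; exists n.
right=> k; have ones : all_ones (digit (\val q)) k by apply/all_onesP => j _;
  exact: q1.
have qk : (sval q k).1 := q1 k; rewrite muE ones /mu_local qk.
by split => //; rewrite (src_mu_src (L_path q k) qk) /mu_src qk.
Qed.

(** Each alternative determines q' from q: in the first, n is the first 0 of q and the prefix is
    recovered by [path_backward]; in the second, the vertices of q' are images under [nu]. The
    digits of q exclude having both. *)
Lemma mu_charP (q q' : L) : q' = mu q <->
  (exists n, carry_at_nat (sval q) (sval q') n) \/ carry_infinite_nat (sval q)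
    (sval q').
Proof.
split=> [->|h]; first exact: mu_carry.
apply: val_inj; apply/funext => k; rewrite -[\val q']/(sval q') -[\val (mu
  q)]/(sval (mu q)).
case: h => [[n [b qn q'n tn a]]|inf]; case: (mu_carry q) =>
  [[m [b' qm mqm tm a']]|inf'].
- have nm : n = m.
    case: (ltngtP n m) => // h; first by have [] := b' _ h; rewrite qn.
    by have [] := b _ h; rewrite qm.
  rewrite -{m}nm in qm mqm tm a' b' *.
  have en : sval q' n = sval (mu q) n.
    by rewrite [LHS]surjective_pairing [RHS]surjective_pairing q'n mqm -!/(tgt _)
      -tn tm.
  case: (ltngtP k n) => [kn|kn|->//]; last by rewrite -a// -a'.
  apply: (path_backward (L_path q') (L_path (mu q)) _ _ kn);
    last by rewrite [\val q' n]en.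
  by move=> j jn; have [_ ->] := b j jn; have [_ ->] := b' j jn.
- by have [] := inf' n; rewrite qn.
- by have [] := inf m; rewrite qm.
- rewrite [LHS]surjective_pairing [RHS]surjective_pairing.
  have [_ -> _] := inf k; have [_ -> _] := inf' k.
  congr (_, _); rewrite -!/(tgt _) (L_path q') (L_path (mu q)).
  by have [_ _ ->] := inf k.+1; have [_ _ ->] := inf' k.+1.
Qed.

Lemma sval_left_path (w : Lhat) k :
  sval w (Negz k) = left_path (left_digits (sval w)) (src (sval w 0)) k.
Proof.
elim: k => [|k IH].
  rewrite [LHS]surjective_pairing /left_path /=; congr (_, _).
  by rewrite -[LHS]/(tgt _) Lhat_path.
rewrite [LHS]surjective_pairing /left_path /=; congr (_, _).
by rewrite -[RHS]/(src (left_path (left_digits (sval w)) (src (sval w 0)) k)) -IH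
  -[LHS]/(tgt _) Lhat_path NegzE intS opprD addrAC addNr add0r -NegzE.
Qed.

Lemma left_path_agree (d d' : nat -> bool) v k : (forall j, (j < k)%N ->
  d j = d' j) ->
  back d v k = back d' v k.
Proof.
elim: k => //= k IH dd'; rewrite dd'// IH// => j jk; apply: dd'; exact: ltnW.
Qed.

Lemma Lhat_eq (w w' : Lhat) : right_part w = right_part w' ->
  left_digits (sval w) = left_digits (sval w') -> w = w'.
Proof.
move=> rr ll; have r n : sval w (Posz n) = sval w' (Posz n).
  exact: (congr1 (fun q : L => sval q n) rr).
by apply: val_inj; apply/funext => -[n|k]; [exact: r|rewrite /= !sval_left_path ll
  r].
Qed.

Lemma right_part_glue d q : right_part (Defs.glue d q) = q.
Proof. by apply: val_inj. Qed.

Lemma left_digits_glue d q : left_digits (sval (Defs.glue d q)) = d.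
Proof. by apply/funext. Qed.

Section SimTorus.
Context {R : realType}.

Local Notation T := (mapping_torus R mu).

Definition theta (w : Lhat) : T :=
  torus_class mu (right_part w, clamp (real_digits R (left_digits (sval w)))).

(** Left digits are indexed away from the dot, so the indices beyond n, with 1s against 0s, are the
    positions where the carry is still pending. *)
Lemma carry_negz (w w' : Lhat) : right_part w = right_part w' ->
  carry (left_digits (sval w)) (left_digits (sval w')) ->
  exists n, carry_at (sval w) (sval w') n.
Proof.
move=> rr [n [ag wn w'n w1 w0]]; exists (Negz n).
have r m : sval w (Posz m) = sval w' (Posz m).
  exact: (congr1 (fun q : L => sval q m) rr).
have agree k : Negz n < k -> sval w k = sval w' k.
  case: k => // k kn; rewrite !sval_left_path r /left_path ag//.
  by rewrite (@left_path_agree _ (left_digits (sval w')))// => j jk; apply: ag;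
    exact: ltn_trans jk kn.
split=> //.
- move=> k; case: k => // k kn; split; [exact: w1|exact: w0].
- by rewrite !Lhat_path agree// ltrDl.
Qed.

Lemma carry_at_negz (w w' : Lhat) n : carry_at (sval w) (sval w') (Negz n) ->
  right_part w = right_part w' /\ carry (left_digits (sval w)) (left_digits (sval
    w')).
Proof.
move=> [b wn w'n _ a]; split.
  by apply: val_inj; apply/funext => k; exact: a.
exists n; split => // k kn.
- by rewrite /left_digits a.
- by have [] := b (Negz k) kn.
- by have [] := b (Negz k) kn.
Qed.

Lemma carry_at_posz (w w' : Lhat) n : carry_at (sval w) (sval w') (Posz n) <->
  [/\ forall k, left_digits (sval w) k, forall k, left_digits (sval w') k = false &
    carry_at_nat (sval (right_part w)) (sval (right_part w')) n].
Proof.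
split=> [[b wn w'n tn a]|[l1 l0 [b wn w'n tn a]]].
  split=> [k|k|]; [by have [] := b (Negz k)|by have [] := b (Negz k)|].
  by split => // k kn; [exact: (b (Posz k))|exact: (a (Posz k))].
split => // -[k|k] kn //; first exact: b.
  by split; [exact: l1|exact: l0].
exact: a.
Qed.

Lemma carry_infiniteE (w w' : Lhat) : carry_infinite (sval w) (sval w') <->
  [/\ forall k, left_digits (sval w) k, forall k, left_digits (sval w') k = false &
    carry_infinite_nat (sval (right_part w)) (sval (right_part w'))].
Proof.
split=> [h|[l1 l0 h]].
  by split=> k; [have [] := h (Negz k)|have [] := h (Negz k)|exact: (h (Posz k))].
move=> [k|k]; first exact: h.
have : src (sval w' (Negz k)) = nu (src (sval w (Negz k))).
  (* Left of the dot only digits are given; the condition on vertices spreads leftwards from the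
     dot, one edge at a time. *)
  have step (e e' : edge) : e.1 -> e'.1 = false -> legit (tgt e, tgt e') ->
    src e' = nu (src e).
    by move: e e' => [[] []] [[] []].
  elim: k => [|k IH]; (apply: step; [exact: l1|exact: l0|rewrite !Lhat_path]).
    have [w1 _ e] := h 0%N; have -> : src (sval w' (Negz 0 + 1)) = nu (src (sval w
      (Negz 0 + 1))) by exact: e.
    exact: legit_nu.
  have -> : Negz k.+1 + 1 = Negz k by rewrite !NegzE [k.+2%:Z]intS opprD addrAC
    addNr add0r.
  by rewrite IH; apply: legit_nu; exact: l1.
by move=> e; split => //; [exact: l1|exact: l0].
Qed.

Lemma sim_carry (w w' : Lhat) :
  [\/ w = w', exists n, carry_at (sval w) (sval w') n | carry_infinite (sval w)
    (sval w')] <->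
  [\/ w = w',
      right_part w = right_part w' /\ carry (left_digits (sval w)) (left_digits
        (sval w')) |
      [/\ forall k, left_digits (sval w) k, forall k, left_digits (sval w') k =
        false &
        right_part w' = mu (right_part w)]].
Proof.
split.
- case=> [->|[[n|n]]|/carry_infiniteE[l1 l0 h]]; first by constructor 1.
  + move=> /carry_at_posz[l1 l0 h]; constructor 3; split => //; apply/mu_charP.
    by left; exists n.
  + by move=> /carry_at_negz; constructor 2.
  + by constructor 3; split => //; apply/mu_charP; right.
- case=> [->|[r c]|[l1 l0 /mu_charP[[n h]|h]]]; first by constructor 1.
  + by constructor 2; exact: carry_negz.
  + by constructor 2; exists (Posz n); apply/carry_at_posz.
  + by constructor 3; apply/carry_infiniteE.
Qed.

Lemma torus_eqP (q q' : L) (x x' : unit_interval R) :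
  torus_class mu (q, x) = torus_class mu (q', x') <->
  [\/ q = q' /\ x = x', [/\ \val x = 1, \val x' = 0 & q' = mu q] |
      [/\ \val x' = 1, \val x = 0 & q = mu q']].
Proof.
have [mi _] := homeomorphism_bij (mu_homeomorphism).
have ext (a b : unit_interval R) : sval a = sval b -> a = b by move=> ?;
  exact: val_inj.
split=> [/(congr1 torus_coord)|].
- rewrite !torus_coordE; case: eqP => x1; case: eqP => x'1.
  + by move=> /(congr1 fst)/mi ->; constructor 1; split => //; apply: ext;
      rewrite [LHS]x1 [RHS]x'1.
  + by move=> e; constructor 2; split => //; [exact: (esym (congr1 snd e))|exact:
      (esym (congr1 fst e))].
  + by move=> e; constructor 3; split => //; [exact: (congr1 snd e)|exact: (congr1
      fst e)].
  + move=> e; constructor 1; split; first exact: (congr1 fst e).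
    by apply: ext; exact: (congr1 snd e).
- case=> [[-> ->]//|[x1 x0 ->]|[x1 x0 ->]]; first exact: class_eq.
  by symmetry; exact: class_eq.
Qed.

Lemma val_clamp_digits (d : nat -> bool) : \val (clamp (real_digits R d)) =
  real_digits R d.
Proof. by rewrite clampE// real_digits_itv. Qed.

Lemma sim_theta (w w' : Lhat) : sim w w' <-> theta w = theta w'.
Proof.
have clampI d d' : clamp (real_digits R d) = clamp (real_digits R d') ->
  real_digits R d = real_digits R d'.
  by move=> /(congr1 val); rewrite !val_clamp_digits.
rewrite sim_run !mu_runP !sim_carry /theta torus_eqP !val_clamp_digits; split.
- case; case=> [->|[-> c]|[l1 l0 r]]; try by constructor 1.
  + constructor 1; split => //; congr clamp; apply/real_digits_eq; by constructor 2.
  + by constructor 2; split => //; [exact/real_digits1|exact/real_digits0].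
  + constructor 1; split => //; congr clamp; apply/real_digits_eq; by constructor 3.
  + by constructor 3; split => //; [exact/real_digits1|exact/real_digits0].
- case=> [[r /clampI/real_digits_eq[l|c|c]]|[/real_digits1 l1 /real_digits0 l0
    r]|[/real_digits1 l1 /real_digits0 l0 r]].
  + by left; constructor 1; exact: Lhat_eq.
  + by left; constructor 2.
  + by right; constructor 2.
  + by left; constructor 3.
  + by right; constructor 3.
Qed.

(** The relation is the kernel of [theta], so transitivity requires no composition of automata. *)
Lemma sim_equivalence : RelationClasses.Equivalence sim.
Proof.
split.
- by move=> w; apply/sim_theta.
- by move=> w w' /sim_theta ww'; apply/sim_theta.
- by move=> w w' w'' /sim_theta ww' /sim_theta w'w''; apply/sim_theta; rewrite ww'.
Qed.

Lemma theta_continuous : continuous theta.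
Proof.
move=> w; apply: continuous_comp; last exact: torus_class_continuous.
apply: pair_continuous => {}w.
  move: w; apply: L_continuous => w n; exact: Lhat_near.
apply: continuous_comp; last exact: clamp_continuous.
move: w; apply: real_digits_continuous => w n.
by apply: filterS (Lhat_near w (Negz n)) => w' ww'; rewrite /left_digits ww'.
Qed.

Lemma theta_glue d q : theta (Defs.glue d q) = torus_class mu (q, clamp
  (real_digits R d)).
Proof. by rewrite /theta right_part_glue left_digits_glue. Qed.

Lemma theta_surj y : exists w, theta w = y.
Proof.
have [q [x <-]] := torus_class_surj y.
have [d dx] := real_digits_surj (unit_intervalP x).
by exists (Defs.glue d q); rewrite theta_glue dx clampK.
Qed.

Definition Theta : Sfrak -> T.
Proof.
by refine (sval (@quotient_lift _ _ _ theta _)) => w w' /sim_theta.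
Defined.

Lemma ThetaE w : Theta (Sfrak_class w) = theta w.
Proof. by rewrite /Theta; case: quotient_lift => h /= ->. Qed.

Lemma T_hausdorff : hausdorff_space T.
Proof.
have [_ [g [_ gK _]]] := mu_homeomorphism.
exact: (torus_hausdorff gK mu_continuous (@L_code_continuous R) (@L_code_inj R)).
Qed.

Lemma Theta_homeomorphism : homeomorphism Theta.
Proof.
apply: compact_bij_homeomorphism.
- apply: (@compact_surj _ _ Sfrak_class); [exact: class_continuous|exact:
    class_surj|exact: Lhat_compact].
- exact: T_hausdorff.
- apply: quotient_fun_continuous.
  have -> : (fun w => Theta (class _ w)) = theta by apply/funext => w;
    exact: ThetaE.
  exact: theta_continuous.
- move=> y y'; have [w <-] := class_surj y; have [w' <-] := class_surj y'.
  by rewrite !ThetaE => /sim_theta ww'; exact: class_eq.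
- by move=> y; have [w <-] := theta_surj y; exists (Sfrak_class w); exact: ThetaE.
Qed.

End SimTorus.

Lemma pair_continuous_at {S T U : topologicalType} (f : S -> T) (g : S ->
  U) (x : S) :
  {for x, continuous f} -> {for x, continuous g} ->
    {for x, continuous (fun x => (f x, g x))}.
Proof. by move=> cf cg; exact: (cvg_pair cf cg). Qed.

Lemma homeomorphism_inv {T U : topologicalType} (f : T -> U) : homeomorphism f ->
  exists g : U -> T, [/\ homeomorphism g, cancel f g & cancel g f].
Proof. by move=> [cf [g [cg fK gK]]]; exists g; split => //; split => //;
  exists f. Qed.

Lemma connected_bool {T : topologicalType} (A : set T) (h : T -> bool) :
  connected A -> {within A, continuous h} -> forall x y, A x -> A y -> h x = h y.
Proof.
move=> cA ch x y Ax Ay.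
have hA : h @` A `&` [set h x] = h @` A.
  apply: (connected_continuous_connected cA ch).
  - by exists (h x); split => //; exists x.
  - by exists [set h x] => //; exact: discrete_open.
  - by exists [set h x] => //; exact: discrete_closed.
by have : (h @` A) (h y) by [exists y]; rewrite -hA => -[_ ->].
Qed.

(** * Functoriality of mapping tori *)

Section TorusMap.
Context {R : realType} {X Y : topologicalType} {f : X -> X} {f' : Y ->
  Y} {e : X -> Y}.
Hypothesis ef : forall q, e (f q) = f' (e q).

Definition torus_map : mapping_torus R f -> mapping_torus R f'.
Proof.
refine (sval (@quotient_lift _ _ _ (fun p : X * unit_interval R =>
  torus_class f' (e p.1, p.2)) _)).
by move=> [q x] [q' x'] /= [x1 x0 ->]; apply: class_eq; split => //=; exact: ef.
Defined.

Lemma torus_mapE q x : torus_map (torus_class f (q, x)) = torus_class f' (e q, x).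
Proof. by rewrite /torus_map; case: quotient_lift => h /= ->. Qed.

Lemma torus_map_continuous : continuous e -> continuous torus_map.
Proof.
move=> ce; apply: quotient_fun_continuous.
have -> : (fun p => torus_map (class _ p)) = (fun p => torus_class f' (e p.1, p.2)).
  by apply/funext => -[q x]; exact: torus_mapE.
move=> p; apply: continuous_comp; last exact: torus_class_continuous.
apply: pair_continuous => {}p; last exact: snd_continuous.
by apply: continuous_comp; [exact: fst_continuous|exact: ce].
Qed.

End TorusMap.

Lemma torus_map_homeomorphism {R : realType} {X Y : topologicalType} {f : X -> X}
    {f' : Y -> Y} {e : X -> Y} (ef : forall q, e (f q) = f' (e q)) :
  homeomorphism e -> homeomorphism (@torus_map R _ _ _ _ _ ef).
Proof.
move=> [ce [e' [ce' eK e'K]]]; split; first exact: torus_map_continuous.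
have ef' q : e' (f' q) = f (e' q) by rewrite -{1}(e'K q) -ef eK.
exists (torus_map ef'); split; first exact: torus_map_continuous.
- by move=> y; have [q [x <-]] := torus_class_surj y; rewrite !torus_mapE eK.
- by move=> y; have [q [x <-]] := torus_class_surj y; rewrite !torus_mapE e'K.
Qed.

Section Coordinates.
Context {R : realType} {X : topologicalType} {f g : X -> X}.
Hypothesis gK : cancel g f.

Lemma torus_coord_itv (y : mapping_torus R f) : 0 <= (torus_coord y).2 < 1.
Proof.
have [q [x <-]] := torus_class_surj y; rewrite torus_coordE.
have /andP[x0 x1] := unit_intervalP x.
by case: eqP => [|/eqP] x1' /=; rewrite ?lexx ?ltr01// x0/= lt_neqAle x1'.
Qed.

Lemma torus_coordK (y : mapping_torus R f) : dev (g := g) (torus_coord y) = y.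
Proof.
have [q [x <-]] := torus_class_surj y; rewrite torus_coordE; case: eqP => [x1|_];
  last exact: dev_class gK _ _.
have -> : (0 : R) = \val (clamp (0 : R)) by rewrite clampE ?lexx ?ler01.
rewrite (dev_class gK) -torus_glue; congr (torus_class f (_, _)).
by rewrite -(clampK x) [\val x]x1.
Qed.

Lemma devK q t : 0 <= t < 1 -> torus_coord (dev (f := f) (g := g) (q, t)) = (q, t)
  :> X * R.
Proof.
move=> /andP[t0 t1]; have -> : t = \val (clamp t) by rewrite clampE// t0 ltW.
rewrite (dev_class gK) torus_coordE clampE ?t0 ?ltW// ifF//.
by apply/negbTE; rewrite lt_eqF.
Qed.

End Coordinates.

(** * The bundle over the circle *)

Section Circle.
Context {R : realType}.

Lemma circle_classD (t : R) (k : int) : circle_class (t + k%:~R) = circle_class t.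
Proof.
have step s : circle_class (s + 1 : R) = circle_class s by apply/esym/class_eq.
elim/int_rect: k => [|n IH|n IH]; first by rewrite addr0.
  by rewrite intS addrC intrD -addrA addrC step addrC.
by rewrite -step -addrA intS opprD rmorphD /= [-1 + _]addrC -addrA addNr addr0.
Qed.

Lemma circle_class_eq (t t' : R) : circle_class t = circle_class t' ->
  exists k : int, t' = t + k%:~R.
Proof.
move=> /class_eqP; elim => [x y ->|x|x y _ [k ->]|x y z _ [k ->] _ [l ->]].
- by exists 1.
- by exists 0; rewrite addr0.
- by exists (- k); rewrite rmorphN addrK.
- by exists (k + l); rewrite intrD addrA.
Qed.

Lemma circle_class_open (O : set R) : open O -> open (@circle_class R @` O).
Proof.
move=> oO; rewrite class_open.
have -> : class _ @^-1` (@circle_class R @` O) = \bigcup_(k in [set: int]) ((fun t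
  => t + k%:~R) @^-1` O).
  apply/seteqP; split => [t [s Os /esym/circle_class_eq[k st]]|t [k _ /= Ok]].
    by exists k => //=; rewrite -st.
  by exists (t + k%:~R) => //; exact: circle_classD.
apply: bigcup_open => k _; apply: open_comp => // t _.
by apply: cvgD; [exact: cvg_id|exact: cvg_cst].
Qed.

Lemma half_int (t t' x0 : R) (k : int) : `|t - x0| < 2^-1 -> `|t' - x0| < 2^-1 ->
  t' = t + k%:~R -> k = 0.
Proof.
move=> tx tx' tt'; have : `|k%:~R| < 1 :> R.
  have -> : k%:~R = (t' - x0) - (t - x0) by rewrite tt'; ring.
  by apply: le_lt_trans (ler_normB _ _) _; lra.
by rewrite -intr_norm -[1]/(1%:~R) ltr_int => k1; apply/eqP;
  rewrite -normr_le0 -ltzD1.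
Qed.

Definition local_section {A B : Type} (g : A -> B) (J : set A) (d : B ->
  A) (b : B) : A :=
  match pselect (exists2 a, J a & g a = b) with
  | left h => sval (cid2 h)
  | right _ => d b
  end.

Lemma local_sectionP {A B : Type} (g : A -> B) (J : set A) (d : B -> A) b :
  (g @` J) b -> J (local_section g J d b) /\ g (local_section g J d b) = b.
Proof. by rewrite /local_section; case: pselect => // h _; case: (cid2 h). Qed.

End Circle.

Section Bundle.
Context {R : realType} {X E : topologicalType} {f g : X -> X}.
Hypotheses (fK : cancel f g) (gK : cancel g f).
Hypotheses (cf : continuous f) (cg : continuous g).
Local Notation T := (mapping_torus R f).
Context {H : E -> T} {H' : T -> E}.
Hypotheses (cH : continuous H) (cH' : continuous H') (HK : cancel H H') (H'K :
  cancel H' H).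

Local Notation dev := (@dev R X f g).

Definition torus_base : T -> circle R.
Proof.
refine (sval (@quotient_lift _ _ _ (fun p : X * unit_interval R =>
  circle_class (\val p.2)) _)).
move=> [q x] [q' x'] /= [-> -> _].
by have := circle_classD (0 : R) 1; rewrite add0r.
Defined.

Lemma torus_baseE q x : torus_base (torus_class f (q, x)) = circle_class (\val x).
Proof. by rewrite /torus_base; case: quotient_lift => h /= ->. Qed.

Lemma torus_base_dev q t : torus_base (dev (q, t)) = circle_class t.
Proof.
have /andP[kt tk] := floor_itv t.
rewrite torus_baseE clampE; last by rewrite /= subr_ge0 kt lerBlDl -intrD1 ltW.
by rewrite -[RHS](circle_classD _ (- Num.floor t)) rmorphN.
Qed.

Lemma torus_base_continuous : continuous torus_base.
Proof.
apply: quotient_fun_continuous.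
have -> : (fun p => torus_base (class _ p)) = (fun p => circle_class (\val p.2)).
  by apply/funext => -[q x]; exact: torus_baseE.
move=> p; apply: (@continuous_comp _ _ _ (fun p : X * unit_interval R =>
  \val p.2) (@circle_class R)); last exact: class_continuous.
by apply: continuous_comp; [exact: snd_continuous|exact: set_val_continuous].
Qed.

Lemma torus_base_fibre y t : torus_base y = circle_class t ->
  exists q, y = dev (q, t).
Proof.
have [[q s] <-] := @dev_surj _ _ f g gK y; rewrite torus_base_dev =>
  /circle_class_eq[k ->].
exists (iterz (f := f) (g := g) (- k) q).
by rewrite (dev_shift fK gK) -(iterzD fK gK) subrr.
Qed.

(** Two points of this arc differ by less than 1, so both coverings are injective over it. *)
Definition arc (x0 : R) : set R := [set t | `|t - x0| < 2^-1].

Lemma arc_open x0 : open (arc x0).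
Proof.
have -> : arc x0 = ball x0 (2^-1 : R) by apply/seteqP; split => t;
  rewrite /arc /ball /= distrC.
exact: ball_open.
Qed.

Definition tube (x0 : R) : set (X * R) := snd @^-1` arc x0.

Lemma tube_open x0 : open (tube x0).
Proof. by apply: open_comp; [move=> p _; exact: snd_continuous|exact: arc_open].
  Qed.

Lemma dev_tube_inj x0 p p' : tube x0 p -> tube x0 p' -> dev p = dev p' -> p = p'.
Proof.
case: p p' => [q t] [q' t'] /= Jt Jt' /(dev_eq fK gK)[k [tt' ->]].
by have k0 := half_int Jt Jt' tt'; rewrite tt' k0 addr0.
Qed.

Lemma circle_arc_inj x0 t t' : arc x0 t -> arc x0 t' ->
  circle_class t = circle_class t' -> t = t'.
Proof.
move=> Jt Jt' /circle_class_eq[k tt'].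
by rewrite tt' (half_int Jt Jt' tt') addr0.
Qed.

Definition dev_section x0 : T -> X * R := local_section dev (tube x0) torus_coord.
Definition circle_section x0 : circle R -> R := local_section (@circle_class R)
  (arc x0) (fun=> 0).

Lemma dev_section_continuous x0 y : (dev @` tube x0) y ->
  {for y, continuous (dev_section x0)}.
Proof.
apply: (@local_section_continuous _ _ dev (tube x0)).
- exact: dev_open.
- exact: tube_open.
- exact: dev_tube_inj.
- by move=> b; exact: local_sectionP.
Qed.

Lemma circle_section_continuous x0 b : (@circle_class R @` arc x0) b ->
  {for b, continuous (circle_section x0)}.
Proof.
apply: (@local_section_continuous _ _ (@circle_class R) (arc x0)).
- exact: circle_class_open.
- exact: arc_open.
- exact: circle_arc_inj.
- by move=> {}b; exact: local_sectionP.
Qed.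

Lemma dev_sectionK x0 p : tube x0 p -> dev_section x0 (dev p) = p.
Proof.
move=> Jp; have [Jl gl] : tube x0 (dev_section x0 (dev p)) /\
  dev (dev_section x0 (dev p)) = dev p.
  by apply: local_sectionP; exists p.
exact: (dev_tube_inj Jl Jp gl).
Qed.

Lemma circle_sectionK x0 t : arc x0 t -> circle_section x0 (circle_class t) = t.
Proof.
move=> Jt; have [Jl gl] : arc x0 (circle_section x0 (circle_class t)) /\
    circle_class (circle_section x0 (circle_class t)) = circle_class t.
  by apply: local_sectionP; exists t.
exact: (circle_arc_inj Jl Jt gl).
Qed.

Lemma tube_image x0 y : (@circle_class R @` arc x0) (torus_base y) ->
  (dev @` tube x0) y.
Proof. by move=> [t Jt /esym/torus_base_fibre[q ->]]; exists (q, t). Qed.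

Definition bundle_map (y : E) : circle R := torus_base (H y).

Lemma bundle_map_continuous : continuous bundle_map.
Proof. by move=> y; apply: continuous_comp; [exact: cH|exact:
  torus_base_continuous]. Qed.

(** Over the image of an arc, the trivialization is the inverse of [dev] on the tube above the arc;
    its own inverse is [dev] composed with a local section of the covering of the circle. *)
Lemma torus_fibre_bundle : fibre_bundle X bundle_map.
Proof.
split; first exact: bundle_map_continuous.
move=> b; have [x0 <-] := class_surj b; pose U := @circle_class R @` arc x0.
have Jx0 : arc x0 x0 by rewrite /arc /= subrr normr0; lra.
exists U; split; [by apply: circle_class_open; exact: arc_open|by exists x0|].
pose phi (y : bundle_map @^-1` U) : U * X :=
  (sub_elt (set_mem (valP y) : U (bundle_map (\val y))), (dev_section x0 (H (\val
    y))).1).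
have psiP (p : U * X) : (bundle_map @^-1` U) (H' (dev (p.2, circle_section x0 (\val
  p.1)))).
  rewrite /bundle_map /= H'K torus_base_dev.
  by have [_ ->] := @local_sectionP _ _ (@circle_class R) (arc x0) (fun=> 0) _
    (set_mem (valP p.1)); exact: (set_mem (valP p.1)).
exists phi; split => //; split.
- apply: pair_continuous.
    apply: set_type_continuous => y.
    apply: (@continuous_comp (bundle_map @^-1` U) E (circle R) \val bundle_map);
      [exact: set_val_continuous|exact: bundle_map_continuous].
  move=> y; apply: (@continuous_comp (bundle_map @^-1` U) (X * R)%type X (fun y =>
    dev_section x0 (H (\val y))) fst); last exact: fst_continuous.
  apply: (@continuous_comp (bundle_map @^-1` U) T (X * R)%type (fun y =>
    H (\val y)) (dev_section x0)).
    by apply: (@continuous_comp (bundle_map @^-1` U) E T \val H);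
      [exact: set_val_continuous|exact: cH].
  by apply: dev_section_continuous; apply: tube_image; exact: (set_mem (valP y)).
- exists (fun p => sub_elt (psiP p)); split.
  + apply: set_type_continuous => p.
    apply: (@continuous_comp (U * X)%type T E (fun p =>
      dev (p.2, circle_section x0 (\val p.1))) H'); last exact: cH'.
    apply: (@continuous_comp (U * X)%type (X * R)%type T (fun p =>
      (p.2, circle_section x0 (\val p.1))) dev); last exact: dev_continuous.
    apply: pair_continuous_at; first exact: snd_continuous.
    apply: (@continuous_comp (U * X)%type (circle R) R (fun p =>
      \val p.1) (circle_section x0)).
      by apply: (@continuous_comp (U * X)%type U (circle R) fst \val);
        [exact: fst_continuous|exact: set_val_continuous].
    by apply: circle_section_continuous; exact: (set_mem (valP p.1)).
  + move=> y; apply: val_inj; rewrite /= -[RHS]HK; congr H'.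
    have [[q t] /= Jt qt] := tube_image (set_mem (valP y)).
    by rewrite /bundle_map -!qt dev_sectionK// torus_base_dev circle_sectionK.
  + move=> [u q]; have [t Jt tu] := set_mem (valP u).
    rewrite /phi; congr (_, _).
      apply: val_inj; rewrite /= /bundle_map H'K torus_base_dev -[\val u]/(sval u)
        -tu.
      by rewrite circle_sectionK.
    by rewrite /= H'K -[\val u]/(sval u) -tu circle_sectionK// dev_sectionK.
Qed.

Fact iota_subproof z : (bundle_map @^-1` [set circle_class 0]) (H' (dev (z, 0))).
Proof. by rewrite /bundle_map /= H'K torus_base_dev. Qed.

Definition fibre_inclusion (z : X) : bundle_map @^-1` [set circle_class 0] :=
  sub_elt (iota_subproof z).

Lemma fibre_inclusion_homeomorphism : compact [set: X] -> hausdorff_space E ->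
  homeomorphism fibre_inclusion.
Proof.
move=> cX hE; apply: compact_bij_homeomorphism => //.
- exact: set_type_hausdorff.
- apply: set_type_continuous => z.
  apply: (@continuous_comp X T E (fun z => dev (z, 0)) H'); last exact: cH'.
  apply: (@continuous_comp X (X * R)%type T (fun z => (z, 0)) dev);
    last exact: dev_continuous.
  by apply: pair_continuous_at; [exact: cvg_id|exact: cvg_cst].
- move=> z z' /(congr1 (fun y => H (\val y))); rewrite /= !H'K; exact: dev_inj.
- move=> y; have [q qy] := torus_base_fibre (set_mem (valP y)).
  by exists q; apply: val_inj; rewrite /= -qy HK.
Qed.

(** Unique lifting of paths: a lift has the form [dev (c t, t)] with [c] continuous, and since maps
    to [bool] separate the points of X, connectedness of [0, 1] makes [c] constant. *)
Lemma lift_eq (z : X) (ga : R -> T) :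
  (forall q q' : X, q <> q' -> exists h : X -> bool, continuous h /\ h q <> h q') ->
  {within `[0, 1], continuous ga} ->
  (forall t, 0 <= t <= 1 -> torus_base (ga t) = circle_class t) ->
  ga 0 = dev (z, 0) -> forall t, 0 <= t <= 1 -> ga t = dev (z, t).
Proof.
move=> sep cga gaP ga0.
have cP t : {q | 0 <= t <= 1 -> ga t = dev (q, t)}.
  apply: cid; have [t01|t01] := boolP (0 <= t <= 1); last by exists z.
  by have [q qt] := torus_base_fibre (gaP t t01); exists q.
pose c t := sval (cP t); have cE t : 0 <= t <= 1 ->
  ga t = dev (c t, t) by exact: (svalP (cP t)).
(* Near t, [c] is the first coordinate of the local inverse of [dev] applied to the lift. *)
have cc : {within `[0, 1], continuous c}.
  apply/subspace_continuousP => t t01.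
  have Jt : tube t (c t, t) by rewrite /tube /arc /= subrr normr0; lra.
  have gat : ga t = dev (c t, t) by apply: cE; move: t01; rewrite /= in_itv.
  have cs : {for ga t, continuous (dev_section t)}.
    by apply: dev_section_continuous; exists (c t, t).
  move=> A nA.
  have n1 : nbhs (ga t) [set y | A (dev_section t y).1].
    apply: (cs (fst @^-1` A)); rewrite gat dev_sectionK//.
    exact: (@fst_continuous X R (c t, t)).
  have n2 : \forall s \near t, `[0, 1]%classic s -> A (dev_section t (ga s)).1.
    exact: (proj1 (subspace_continuousP _ _) cga t t01 _ n1).
  have n3 : \forall s \near t, arc t s.
    by apply: open_nbhs_nbhs; split; [exact: arc_open|exact: Jt].
  apply: filterS2 n2 n3 => s As Js s01.
  by have := As s01; rewrite (cE s) ?dev_sectionK//; move: s01; rewrite /= in_itv.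
have zero : `[0, 1]%classic (0 : R) by rewrite /= in_itv /= lexx ler01.
have c0 : c 0 = z.
  have e0 : dev (z, 0) = dev (c 0, 0) by rewrite -ga0 cE ?lexx ?ler01.
  exact: (esym (dev_inj fK gK e0)).
move=> t t01; rewrite cE//; congr (dev (_, _)); rewrite -c0.
apply: contrapT => /sep[h [ch]]; apply.
have hc : {within `[0, 1], continuous (h \o c)}.
  by move=> s; exact: (@continuous_comp (subspace (`[0, 1]%classic : set R)) X bool
    c h s (cc s) (ch _)).
have t01' : `[0, 1]%classic t by rewrite /= in_itv.
exact: (connected_bool (@segment_connected R 0 1) hc t01' zero).
Qed.

Lemma monodromyP (z : X) (y : E) :
  (forall q q' : X, q <> q' -> exists h : X -> bool, continuous h /\ h q <> h q') ->
  monodromy bundle_map (\val (fibre_inclusion z)) y <-> y = \val (fibre_inclusion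
    (f z)).
Proof.
have dev1 : dev (z, 1) = dev (f z, 0).
  by have -> : (1 : R) = 0 + 1%:~R; [rewrite add0r|rewrite (dev_shift fK gK)].
move=> sep; split=> [[ga [cga gaP ga0 ga1]]|->].
- have cHga : {within `[0, 1], continuous (H \o ga)}.
    move/subspace_continuousP : cga => cga; apply/subspace_continuousP =>
      t t01 A nA.
    exact: (cga t t01 _ (@cH (ga t) _ nA)).
  have start : (H \o ga) 0 = dev (z, 0) by rewrite /= ga0 H'K.
  have h1 : (H \o ga) 1 = dev (z, 1).
    by apply: (lift_eq sep cHga _ start); rewrite ?ler01 ?lexx.
  by rewrite -ga1 -[LHS]HK -[H (ga 1)]/((H \o ga) 1) h1 dev1.
- exists (fun t => H' (dev (z, t))); split => [|t _||].
  + apply: continuous_subspaceT => t.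
    apply: (@continuous_comp R T E (fun t => dev (z, t)) H'); last exact: cH'.
    apply: (@continuous_comp R (X * R)%type T (fun t => (z, t)) dev);
      last exact: dev_continuous.
    by apply: pair_continuous_at; [exact: cvg_cst|exact: cvg_id].
  + by rewrite /bundle_map H'K torus_base_dev.
  + by [].
  + by rewrite /= dev1.
Qed.

End Bundle.

(** * Minimality of mu and connectedness *)

Section Minimality.

(** A digit is enough to prepend an edge, since each vertex has exactly one incoming edge of each
    digit. *)
Definition cons_seq (b : bool) (z : nat -> edge) (n : nat) : edge :=
  if n is m.+1 then z m else (b, src (z 0%N)).

Fact cons_subproof b (q : L) : is_path (cons_seq b (sval q) : {ptws nat -> edge}).
Proof. by case=> [|n] //; exact: (L_path q n). Qed.

Definition L_cons b (q : L) : L := sub_elt (cons_subproof b q).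

Fact tail_subproof (q : L) : is_path ((fun n => sval q n.+1) : {ptws nat -> edge}).
Proof. by move=> n; exact: (L_path q n.+1). Qed.

Definition L_tail (q : L) : L := sub_elt (tail_subproof q).

Lemma L_cons_tail q : L_cons (sval q 0%N).1 (L_tail q) = q.
Proof.
apply: val_inj; apply/funext => -[|n] //.
rewrite -[LHS]/((sval q 0%N).1, src (sval q 1%N)) -[RHS]/(sval q 0%N).
by rewrite -[src _](L_path q 0%N) -surjective_pairing.
Qed.

Lemma all_ones_cons b (q : L) n :
  all_ones (digit (\val (L_cons b q))) n.+1 = b && all_ones (digit (\val q)) n.
Proof.
apply/all_onesP/andP => [h|[b1 /all_onesP h] [|k] //]; last exact: h.
by split; [exact: (h 0%N)|apply/all_onesP => k kn; exact: (h k.+1)].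
Qed.

Lemma mu_cons0 (q : L) : mu (L_cons false q) = L_cons true q.
Proof.
apply: val_inj; apply/funext => -[|n]; rewrite -[LHS]/(sval (mu _) _) muE.
  by rewrite all_ones0.
by rewrite all_ones_cons.
Qed.

Lemma src_mu (q : L) : src (sval (mu q) 0%N) = mu_src (sval q 0%N).
Proof.
rewrite muE all_ones0 /mu_local; case: ifP => q0; last by rewrite /mu_src q0.
exact: (src_mu_src (L_path q 0%N)).
Qed.

(** Together with [mu_cons0] this is the odometer recursion; composing the two gives the
    renormalisation of [mu] by its square. *)
Lemma mu_cons1 (q : L) : mu (L_cons true q) = L_cons false (mu q).
Proof.
apply: val_inj; apply/funext => -[|n]; rewrite -[LHS]/(sval (mu _) _) muE.
  by rewrite all_ones0 -[RHS]/(false, src (sval (mu q) 0%N)) src_mu.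
by rewrite all_ones_cons -[RHS]/(sval (mu q) n) muE.
Qed.

(** A sample path for each start vertex, used to turn a function of the start vertex into relations
    between six values. *)
Definition from_vertex_seq (v : vertex) : nat -> edge :=
  match v with
  | va => alternate (true, vb) (true, va)
  | vb => alternate (true, va) (true, vb)
  | vc => alternate (false, vb) (false, vc)
  | vd => alternate (false, ve) (false, vd)
  | ve => alternate (false, vd) (false, ve)
  | vf => alternate (true, ve) (true, vf)
  end.

Fact from_vertex_subproof v : is_path (from_vertex_seq v : {ptws nat -> edge}).
Proof. by move=> n; case: v; rewrite /= /alternate /=; case: (odd n). Qed.

Definition from_vertex v : L := sub_elt (from_vertex_subproof v).

Lemma src_from_vertex v : src (sval (from_vertex v) 0%N) = v.
Proof. by case: v. Qed.

(** The start vertex is kept apart from the edges so that it is still visible for n = 0, where the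
    induction ends. *)
Definition depends_on_prefix {T : Type} (F : L ->
  T) (n : nat) : Prop := forall q q' : L,
  src (sval q 0%N) = src (sval q' 0%N) -> (forall k, (k < n)%N ->
    sval q k = sval q' k) -> F q = F q'.

(* Induction on n by renormalisation: mu^2 (0 z) = 0 mu(z), so F (0 _) is again
   invariant, and it depends on one edge less. *)
Lemma invariant_const {T : Type} (F : L -> T) n : (forall q, F (mu q) = F q) ->
  depends_on_prefix F n -> forall q q', F q = F q'.
Proof.
elim: n F => [|n IH] F Fmu Fn.
- have FE q : F q = F (from_vertex (src (sval q 0%N))).
    by apply: Fn => //; rewrite src_from_vertex.
  (* [mu] replaces a first edge 0_v by 1_v, so F takes the same value at the start vertices of both;
     the six resulting relations link the vertices in the cycle a, b, d, f, e, c. *)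
  have step v : F (from_vertex (src (false, v))) = F (from_vertex (src (true, v))).
    have := Fmu (L_cons false (from_vertex v)); rewrite mu_cons0 FE [RHS]FE.
    by rewrite /= /cons_seq src_from_vertex.
  have FV v : F (from_vertex v) = F (from_vertex va).
    move: (step va) (step vb) (step vc) (step vd) (step ve) (step vf) => /=.
    by case: v => // *; congruence.
  by move=> q q'; rewrite (FE q) (FE q') !FV.
- have Gc : forall q q', F (L_cons false q) = F (L_cons false q').
    apply: (IH (fun q => F (L_cons false q))) => [q|q q' sq qq'].
      by rewrite -mu_cons1 Fmu -mu_cons0 Fmu.
    apply: Fn => [|[|k] kn]; rewrite /= /cons_seq ?sq//.
    exact: qq'.
  have FG q : F q = F (L_cons false (L_tail q)).
    rewrite -{1}(L_cons_tail q); case: (sval q 0%N).1 => //.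
    by rewrite -mu_cons0 Fmu.
  by move=> q q'; rewrite FG (Gc _ (L_tail q')) -FG.
Qed.

(** Compactness of L * L gives a uniform n: F is locally constant around a point of the diagonal,
    and around any other pair some edge distinguishes the two paths. *)
Lemma continuous_prefix (F : L -> bool) : continuous F ->
  exists n, depends_on_prefix F n.
Proof.
move=> /bool_continuous Fc.
have cLL : compact [set: L * L] by rewrite -setXTT; apply: compact_setX;
  exact: L_compact.
pose P (n : nat) (p : L * L) := (forall k, (k < n)%N ->
  sval p.1 k = sval p.2 k) -> F p.1 = F p.2.
have : \forall n \near \oo, [set: L * L] `<=` P n.
  apply: (proj1 (compact_near_coveringP _) cLL) => -[q q'] _.
  have [<-|qq'] := pselect (q = q').
    exists ([set p : L * L | F p.1 = F q /\ F p.2 = F q], setT) => /=; last first.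
      by move=> [p n] /= [[e1 e2] _] _; rewrite e1 e2.
    split; last exact: filterT.
    by apply: filterI; [apply: (@fst_continuous L L (q, q) [set y | F y = F q])|
      apply: (@snd_continuous L L (q, q) [set y | F y = F q])]; exact: Fc.
  have [k qk] : exists k, sval q k <> sval q' k.
    apply: contrapT => h; apply: qq'; apply: val_inj; apply/funext => k.
    by apply: contrapT => ?; apply: h; exists k.
  exists ([set p : L * L | sval p.1 k = sval q k /\ sval p.2 k = sval q' k],
    [set n | (k < n)%N]) => /=.
    split; last by exists k.+1.
    by apply: filterI; [apply: (@fst_continuous L L (q, q') [set y | sval y k =
      sval q k])|
      apply: (@snd_continuous L L (q, q') [set y | sval y k = sval q' k])];
        exact: L_near.
  by move=> [p n] /= [[e1 e2] kn] h; case: qk; rewrite -e1 -e2; exact: h.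
move=> [n _ /(_ _ (leqnn n)) nP]; exists n => q q' _ qq'.
exact: (nP (q, q')).
Qed.

Lemma continuous_invariant_const (F : L -> bool) : continuous F ->
  (forall q, F (mu q) = F q) -> forall q q', F q = F q'.
Proof. by move=> /continuous_prefix[n Fn] Fmu; exact: invariant_const Fmu Fn. Qed.

End Minimality.

Lemma L_separated (q q' : L) : q <> q' -> exists h : L -> bool, continuous h /\
  h q <> h q'.
Proof.
move=> qq'; have [k qk] : exists k, sval q k <> sval q' k.
  apply: contrapT => h; apply: qq'; apply: val_inj; apply/funext => k.
  by apply: contrapT => ?; apply: h; exists k.
exists (fun y => sval y k == sval q k); split; last by rewrite eqxx =>
  /esym/eqP/esym.
by apply/bool_continuous => y; apply: filterS (L_near y k) => y' ->.
Qed.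

(** The indicator of a clopen set is constant along each segment of the flow from height 0 to height
    1, so its restriction to the fibre at height 0 is invariant under [mu], hence constant. *)
Lemma torus_connected (R : realType) : connected [set: mapping_torus R mu].
Proof.
have [_ [g [cg fK gK]]] := mu_homeomorphism.
move=> B [y0 By0] [C oC BC] [D cD BD].
have oB : open B by rewrite BC setTI.
have cB : closed B by rewrite BD setTI.
pose b (y : mapping_torus R mu) : bool := `[< B y >].
have bc : continuous b.
  apply/bool_continuous => y; rewrite /b; have [By|By] := pselect (B y).
    have : nbhs y B by exact: open_nbhs_nbhs.
    by apply: filterS => y' By' /=; rewrite !asboolT.
  have : nbhs y (~` B) by apply: open_nbhs_nbhs; split => //; rewrite openC.
  by apply: filterS => y' By' /=; rewrite !asboolF.
have dc := dev_continuous gK (@mu_continuous) cg.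
have bd q t : 0 <= t <= 1 -> b (dev (f := mu) (g := g) (q, t)) = b (dev (f := mu)
  (g := g) (q, 0)).
  move=> t01; pose h (t : R) := b (dev (f := mu) (g := g) (q, t)).
  have hc : continuous h.
    move=> s; apply: (@continuous_comp R (mapping_torus R mu) bool (fun s =>
      dev (f := mu) (g := g) (q, s)) b); last exact: bc.
    apply: (@continuous_comp R (L * R)%type (mapping_torus R mu) (fun s =>
      (q, s)) (dev (f := mu) (g := g))); last exact: dc.
    by apply: pair_continuous_at; [exact: cvg_cst|exact: cvg_id].
  apply: (connected_bool (@segment_connected R 0 1) (continuous_subspaceT hc)).
    by rewrite /= in_itv.
  by rewrite /= in_itv /= lexx ler01.
have Fc : continuous (fun q => b (dev (f := mu) (g := g) (q, 0 : R))).
  move=> q; apply: (@continuous_comp L (mapping_torus R mu) bool (fun q =>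
    dev (f := mu) (g := g) (q, 0)) b); last exact: bc.
  apply: (@continuous_comp L (L * R)%type (mapping_torus R mu) (fun q =>
    (q, 0)) (dev (f := mu) (g := g))); last exact: dc.
  by apply: pair_continuous_at; [move=> A nA; exact: nA|exact: cst_continuous].
have Fmu q : b (dev (f := mu) (g := g) (mu q, 0 : R)) = b (dev (f := mu) (g := g)
  (q, 0 : R)).
  rewrite -[RHS](bd q 1) ?ler01 ?lexx//; congr b.
  have -> : (1 : R) = 0 + 1%:~R by rewrite add0r.
  by rewrite (dev_shift fK gK).
have Fconst := continuous_invariant_const Fc Fmu.
apply/seteqP; split => // y _; apply/asboolP; rewrite -/(b y).
have reduce z : exists q, b z = b (dev (f := mu) (g := g) (q, 0 : R)).
  have [q [x <-]] := torus_class_surj z; exists q.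
  by rewrite -(dev_class gK) bd// unit_intervalP.
have [q ->] := reduce y; have [q0 q0E] := reduce y0.
by rewrite (Fconst _ q0) -q0E; exact/asboolP.
Qed.

(** * The solenoid, the suspension and the theorem *)

Section Solenoid.
Context {R : realType}.

Definition Z2_succ (x : Z2) : Z2 := Z2_add x (Z2_of_int 1).
Definition Z2_pred (x : Z2) : Z2 := Z2_add x (Z2_of_int (-1)).

Lemma Z2_succK : cancel Z2_succ Z2_pred.
Proof. by move=> x; rewrite /Z2_succ /Z2_pred Z2_addA Z2_of_intD subrr Z2_add0. Qed.

Lemma Z2_predK : cancel Z2_pred Z2_succ.
Proof. by move=> x; rewrite /Z2_succ /Z2_pred Z2_addA Z2_of_intD addNr Z2_add0. Qed.

Lemma Z2_add_continuous y : continuous (fun x => Z2_add x y).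
Proof.
apply: Z2_continuous => x n; apply: filterS (Z2_near x n) => x' xx'.
by rewrite /= /Z2_add_seq xx'.
Qed.

Local Notation sdev := (@dev R Z2 Z2_succ Z2_pred).
Local Notation siter := (@iterz Z2 Z2_succ Z2_pred).

Lemma solenoid_glue z (t : R) : solenoid_class (z, t + 1) = solenoid_class (Z2_succ
  z, t).
Proof. by apply: class_eq; exists z, t. Qed.

Lemma solenoid_shift (k : int) z (t : R) :
  solenoid_class (z, t + k%:~R) = solenoid_class (siter k z, t).
Proof.
have nat_shift (n : nat) x s : solenoid_class (x, s + n%:~R) = solenoid_class
  (siter n x, s : R).
  elim: n x s => [|n IH] x s; first by rewrite addr0.
  by rewrite -addn1 PoszD intrD1 addrA solenoid_glue IH (iterzD Z2_succK Z2_predK).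
case: k => n; first exact: nat_shift.
rewrite -{1}(iterzK Z2_succK Z2_predK (Negz n) z) NegzE opprK -nat_shift.
by rewrite -NegzE NegzE rmorphN /= subrK.
Qed.

(** Compares the solenoid with the mapping torus of z |-> z + 1, from which it inherits separation
    and the normal form with height in [0, 1[. *)
Definition solenoid_to_torus : solenoid R -> mapping_torus R Z2_succ.
Proof.
refine (sval (@quotient_lift _ _ _ sdev _)).
move=> _ _ [z [t [-> ->]]].
by rewrite -[1]/(1%:~R) (dev_shift Z2_succK Z2_predK).
Defined.

Lemma solenoid_to_torusE p : solenoid_to_torus (solenoid_class p) = sdev p.
Proof. by rewrite /solenoid_to_torus; case: quotient_lift => h /= ->. Qed.

Lemma solenoid_to_torus_inj : injective solenoid_to_torus.
Proof.
move=> y y'; have [[z t] <-] := class_surj y; have [[z' t'] <-] := class_surj y'.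
rewrite !solenoid_to_torusE => /(dev_eq Z2_succK Z2_predK)[k [-> ->]].
by rewrite -[RHS]/(solenoid_class _) solenoid_shift.
Qed.

Lemma solenoid_hausdorff : hausdorff_space (solenoid R).
Proof.
apply: hausdorff_inj _ solenoid_to_torus_inj _.
  apply: quotient_fun_continuous.
  have -> : (fun p => solenoid_to_torus (class _ p)) = sdev.
    by apply/funext => p; exact: solenoid_to_torusE.
  by apply: (dev_continuous Z2_predK); exact: Z2_add_continuous.
apply: (torus_hausdorff Z2_succK _ (@Z2_code_continuous R) (@Z2_code_inj R)).
exact: Z2_add_continuous.
Qed.

Lemma solenoid_class_inj z z' (t t' : R) : 0 <= t < 1 -> 0 <= t' < 1 ->
  solenoid_class (z, t) = solenoid_class (z', t') -> z = z' /\ t = t'.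
Proof.
move=> t01 t'01 /(congr1 (torus_coord \o solenoid_to_torus)) /=.
by rewrite !solenoid_to_torusE !(devK Z2_predK)// => -[-> ->].
Qed.

Lemma solenoid_class_surj (y : solenoid R) : exists z t, 0 <= t < 1 /\
  solenoid_class (z, t) = y.
Proof.
have [[z t] <-] := class_surj y; exists (siter (Num.floor t) z), (t - (Num.floor
  t)%:~R).
have /andP[t0 t1] := floor_itv t; split.
  by rewrite subr_ge0 t0 ltrBlDl -intrD1.
by rewrite -solenoid_shift subrK.
Qed.

Definition Z2_part (q : L) : Z2 := Z2_digits (digit (\val q)).

Lemma Z2_part_mu q : Z2_part (mu q) = Z2_succ (Z2_part q).
Proof. by apply: Z2_digits_succ; exact: digit_mu. Qed.

Local Notation T := (mapping_torus R mu).

Definition torus_solenoid : T -> solenoid R.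
Proof.
refine (sval (@quotient_lift _ _ _ (fun p : L * unit_interval R =>
  solenoid_class (Z2_part p.1, \val p.2)) _)).
move=> [q x] [q' x'] /= [-> -> ->].
by rewrite Z2_part_mu -solenoid_glue add0r.
Defined.

Lemma torus_solenoidE q x : torus_solenoid (torus_class mu (q, x)) = solenoid_class
  (Z2_part q, \val x).
Proof. by rewrite /torus_solenoid; case: quotient_lift => h /= ->. Qed.

Lemma torus_solenoid_continuous : continuous torus_solenoid.
Proof.
apply: quotient_fun_continuous.
have -> : (fun p => torus_solenoid (class _ p)) = (fun p =>
  solenoid_class (Z2_part p.1, \val p.2)).
  by apply/funext => -[q x]; exact: torus_solenoidE.
move=> p; apply: (@continuous_comp _ _ _ (fun p : L * unit_interval R =>
  (Z2_part p.1, \val p.2)) (@solenoid_class R)); last exact: class_continuous.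
apply: pair_continuous_at.
  apply: (@continuous_comp (L * unit_interval R)%type L Z2 fst Z2_part);
    [exact: fst_continuous|exact: digits_continuous].
by apply: continuous_comp; [exact: snd_continuous|exact: set_val_continuous].
Qed.

Lemma Z2_part_surj x : exists q, Z2_part q = x.
Proof.
exists (Psi_inv (false, to_Z2t x false)).
by rewrite /Z2_part digit_path_of /= to_Z2t_proj Z2_digitsK.
Qed.

Lemma torus_solenoid_surj y : exists y', torus_solenoid y' = y.
Proof.
have [z [t [/andP[t0 t1] <-]]] := solenoid_class_surj y;
  have [q <-] := Z2_part_surj z.
exists (torus_class mu (q, clamp t)); rewrite torus_solenoidE clampE// t0 ltW//.
Qed.

Lemma torus_solenoid_dev g q t : cancel g mu -> 0 <= t < 1 ->
  torus_solenoid (dev (f := mu) (g := g) (q, t)) = solenoid_class (Z2_part q, t).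
Proof.
move=> gK /andP[t0 t1]; have e : t = \val (clamp t) by rewrite clampE// t0 ltW.
by rewrite {1}e (dev_class gK) torus_solenoidE -e.
Qed.

End Solenoid.

Lemma range_card (A : finType) {B : Type} (d : A) (e : A -> B) : injective e ->
  (range e #= `I_(#|A|))%card.
Proof.
move=> ei; have -> : range e = (fun n => e (nth d (enum A) n)) @` `I_(#|A|).
  apply/seteqP; split => [_ [a _ <-]|_ [n _ <-]]; last by eexists.
  exists (index a (enum A)); first by rewrite /= cardE index_mem mem_enum.
  by rewrite nth_index// mem_enum.
apply: inj_card_eq => m n; rewrite !inE /= => mA nA /ei /eqP.
by rewrite nth_uniq ?enum_uniq -?cardE// => /eqP.
Qed.

Section Suspension.
Context {R : realType}.

Local Notation susp := (suspension R).

Definition Tfrak_to_suspension : Tfrak R -> susp :=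
  @torus_map R _ _ add_cocycle (Z2t_shift 1) snd (fun _ => erefl).

Lemma Tfrak_to_suspensionE s z x :
  Tfrak_to_suspension (Tfrak_class (s, z, x)) = suspension_class (z, x).
Proof. exact: torus_mapE. Qed.

Lemma Tfrak_to_suspension_quotient : quotient_map Tfrak_to_suspension.
Proof.
split => [y|A].
  by have [z [x <-]] := torus_class_surj y; exists (Tfrak_class (false, z, x));
    exact: Tfrak_to_suspensionE.
have cr : continuous Tfrak_to_suspension by apply: torus_map_continuous;
  exact: snd_continuous.
split => [oA|]; first by move/continuousP: cr; exact.
rewrite !class_open => oA.
(* The section z |-> (0, z) is not compatible with the cocycle, but it is used only before gluing,
   to pull back the open preimage of [A]. *)
pose j (p : Z2t * unit_interval R) : bool * Z2t * unit_interval R := (false, p.1,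
  p.2).
have -> : class _ @^-1` A = j @^-1` (class _ @^-1` (Tfrak_to_suspension @^-1` A)).
  apply/seteqP; split => -[z x] /=.
    by rewrite -[class _ (j (z, x))]/(Tfrak_class (false, z, x))
      Tfrak_to_suspensionE.
  by rewrite -[class _ (j (z, x))]/(Tfrak_class (false, z, x)) Tfrak_to_suspensionE.
apply: open_comp oA => p _.
apply: pair_continuous_at; last exact: snd_continuous.
by apply: pair_continuous_at; [exact: cst_continuous|exact: fst_continuous].
Qed.

Lemma Tfrak_to_suspension_fibre (y : susp) :
  (Tfrak_to_suspension @^-1` [set y] #= `I_2)%card.
Proof.
pose g z := Z2t_shift (- 1) z; have gK : cancel g (Z2t_shift 1) := Z2t_shiftNK 1.
have [g' g'K] : exists g', cancel g' add_cocycle.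
  have h p : {p' | add_cocycle p' = p} by exact/cid/add_cocycle_surj.
  by exists (fun p => sval (h p)) => p; exact: (svalP (h p)).
have rE (p : bool * Z2t) t : 0 <= t < 1 ->
    Tfrak_to_suspension (dev (f := add_cocycle) (g := g') (p, t)) = dev (f :=
      Z2t_shift 1) (g := g) (p.2, t).
  move=> /andP[t0 t1]; have e : t = \val (clamp t) by rewrite clampE// t0 ltW.
  rewrite e (dev_class g'K) (dev_class gK); case: p => s z;
    exact: Tfrak_to_suspensionE.
rewrite -(torus_coordK gK y); have := torus_coord_itv y;
  case: (torus_coord y) => z t /= t01.
have -> : Tfrak_to_suspension @^-1` [set dev (f := Z2t_shift 1) (g := g) (z, t)] =
    range (fun s => dev (f := add_cocycle) (g := g') ((s, z), t)).
  apply/seteqP; split => [y' /=|_ [s _ <-] /=]; last exact: rE.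
  rewrite -(torus_coordK g'K y'); have := torus_coord_itv y';
    case: (torus_coord y') => -[s z'] t' /= t'01.
  by rewrite rE// => /(congr1 torus_coord); rewrite !devK//= => -[-> ->]; exists s.
have := @range_card bool _ true (fun s => dev (f := add_cocycle) (g := g') ((s, z),
  t)).
rewrite card_bool; apply => s s' /(congr1 torus_coord); rewrite !devK//.
by move=> [].
Qed.

End Suspension.

Section Sfrak.
Context {R : realType}.

Lemma Sfrak_compact : compact [set: Sfrak].
Proof.
by apply: (@compact_surj _ _ Sfrak_class); [exact: class_continuous|exact:
  class_surj|exact: Lhat_compact].
Qed.

Lemma Sfrak_hausdorff : hausdorff_space Sfrak.
Proof.
have [cT _] := @Theta_homeomorphism R.
by apply: hausdorff_inj cT _ (@T_hausdorff R);
  exact: (homeomorphism_bij (@Theta_homeomorphism R)).1.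
Qed.

Lemma Sfrak_metrizable : metrizable R Sfrak.
Proof.
have [_ [m [cm muK mK]]] := mu_homeomorphism.
have [cT _] := @Theta_homeomorphism R; have [Ti _] := homeomorphism_bij
  (@Theta_homeomorphism R).
pose e := @torus_emb R L mu (@L_code R) \o @Theta R.
have ec : continuous e.
  move=> y; apply: (@continuous_comp Sfrak (mapping_torus R mu) _ (@Theta R)
    (@torus_emb R L mu (@L_code R))); first exact: cT.
  exact: (torus_emb_continuous mu_continuous (@L_code_continuous R)).
apply: (embedding_metrizable Sfrak_compact ec).
by apply: inj_comp Ti; exact: (torus_emb_inj muK (@L_code_inj R)).
Qed.

Lemma Sfrak_connected : connected [set: Sfrak].
Proof.
have [H' [[cH' _] HK H'K]] := homeomorphism_inv (@Theta_homeomorphism R).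
have := connected_continuous_connected (@torus_connected R) (continuous_subspaceT
  cH').
by congr connected; apply/seteqP; split => // y _; exists (Theta y).
Qed.

Definition Sfrak_solenoid (y : Sfrak) : solenoid R := torus_solenoid (Theta y).

Lemma Sfrak_solenoid_class w : Sfrak_solenoid (Sfrak_class w) = solenoid_class
  (forget R w).
Proof.
rewrite /Sfrak_solenoid ThetaE torus_solenoidE val_clamp_digits.
by congr (solenoid_class (_, _)).
Qed.

Lemma Sfrak_solenoid_quotient : quotient_map Sfrak_solenoid.
Proof.
have [cT _] := @Theta_homeomorphism R; have [_ Ts] := homeomorphism_bij
  (@Theta_homeomorphism R).
apply: compact_quotient_map.
- exact: Sfrak_compact.
- exact: solenoid_hausdorff.
- move=> y; apply: (@continuous_comp Sfrak (mapping_torus R mu) (solenoid R)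
    (@Theta R) torus_solenoid); first exact: cT.
  exact: torus_solenoid_continuous.
- move=> y; have [y1 <-] := torus_solenoid_surj y; have [y2 <-] := Ts y1.
  by exists y2.
Qed.

(** With the height normalised to [0, 1[, the fibre over (z, t) consists of a sign and a point of
    the cover above z: two signs, times two tags exactly when z is an integer. *)
Lemma Sfrak_solenoid_fibre (x : solenoid R) :
  (Sfrak_solenoid @^-1` [set x] #= `I_2 \/ Sfrak_solenoid @^-1` [set x] #=
    `I_4)%card.
Proof.
have [_ [m [_ muK mK]]] := mu_homeomorphism.
have [H' [_ HK H'K]] := homeomorphism_inv (@Theta_homeomorphism R).
have [z [t [t01 <-]]] := solenoid_class_surj x.
pose e (p : bool * Z2t) := H' (dev (f := mu) (g := m) (Psi_inv p, t)).
have eT p : torus_coord (Theta (e p)) = (Psi_inv p, t) by rewrite /e H'K (devK mK).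
have ei : injective e.
  by move=> p p' ee; apply: (can_inj Psi_invK); have := congr1 fst (eT p);
    rewrite ee eT.
have fibreE : Sfrak_solenoid @^-1` [set solenoid_class (z, t)] = e @` [set p |
  Z2t_proj p.2 = z].
  apply/seteqP; split => [y|_ [p pz <-]] /=; last first.
    by rewrite /Sfrak_solenoid H'K torus_solenoid_dev// -pz /Z2_part /= Z2_digitsK.
  rewrite /Sfrak_solenoid -{1}(torus_coordK mK (Theta y)).
  have := torus_coord_itv (@Theta R y); have := torus_coordK mK (@Theta R y).
  case: (torus_coord (@Theta R y)) => q s /= qs s01.
  rewrite torus_solenoid_dev// => /(solenoid_class_inj s01 t01)[qz st].
  exists (Psi q); first by rewrite /= to_Z2t_proj.
  by rewrite /e PsiK -st qs HK.
rewrite fibreE; have [[a _ az]|zn] := pselect (range Z2_of_int z).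
  right; have -> : e @` [set p | Z2t_proj p.2 = z] = range (fun sb : bool * bool =>
    e (sb.1, inr (a, sb.2))).
    apply/seteqP; split => [_ [[s z'] /= z'z <-]|_ [[s b] _ <-]].
      by exists (s, Z2t_tag z') => //=; rewrite -(Z2t_proj_inr (etrans z'z (esym
        az))).
    by exists (s, inr (a, b)).
  have := @range_card _ _ (true, true) (fun sb : bool * bool =>
    e (sb.1, inr (a, sb.2))).
  by rewrite card_prod card_bool; apply => -[s b] [s' b'] /ei [-> ->].
left; have -> : e @` [set p | Z2t_proj p.2 = z] = range (fun s : bool =>
  e (s, to_Z2t z false)).
  apply/seteqP; split => [_ [[s z'] /= z'z <-]|_ [s _ <-]].
    exists s => //; congr (e (_, _)); apply: Z2t_eq; first by rewrite to_Z2t_proj.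
    by rewrite to_Z2t_tagN//; case: z' z'z => [//|[a b]] /= az; case: zn; exists a.
  by exists (s, to_Z2t z false) => //=; rewrite to_Z2t_proj.
have := @range_card _ _ true (fun s : bool => e (s, to_Z2t z false)).
by rewrite card_bool; apply => s s' /ei [->].
Qed.

Definition Sfrak_Tfrak (y : Sfrak) : Tfrak R := torus_map Psi_mu (Theta y).

Lemma Sfrak_Tfrak_homeomorphism : homeomorphism Sfrak_Tfrak.
Proof.
apply: (@homeomorphism_comp _ _ _ (@Theta R)); first exact: Theta_homeomorphism.
exact: (torus_map_homeomorphism Psi_mu (Psi_homeomorphism)).
Qed.

Lemma Sfrak_Tfrak_class w : Sfrak_Tfrak (Sfrak_class w) =
  Tfrak_class (Psi (right_part w), clamp (real_digits R (left_digits (sval w)))).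
Proof. by rewrite /Sfrak_Tfrak ThetaE torus_mapE. Qed.

(** Transported from [mu] by [Psi], which avoids a direct proof that the cocycle [phi] is
    continuous. *)
Lemma add_cocycle_homeomorphism : homeomorphism add_cocycle.
Proof.
have [P' [hP' PK P'K]] := homeomorphism_inv (Psi_homeomorphism).
have -> : add_cocycle = Psi \o (mu \o P').
  by apply/funext => p /=; rewrite -[LHS]/(add_cocycle p) -[RHS]/(Psi (mu (P' p)))
    Psi_mu P'K.
apply: homeomorphism_comp (Psi_homeomorphism).
exact: homeomorphism_comp hP' (mu_homeomorphism).
Qed.

Definition Tfrak_shift : Tfrak R -> Tfrak R :=
  @torus_map R _ _ add_cocycle add_cocycle add_cocycle (fun _ => erefl).

Definition Tfrak_solenoid : Tfrak R -> solenoid R.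
Proof.
refine (sval (@quotient_lift _ _ _ (fun p : bool * Z2t * unit_interval R =>
  solenoid_class (Z2t_proj p.1.2, \val p.2)) _)).
move=> [[s z] x] [q' x'] /= [-> -> ->].
by rewrite /= Z2t_proj_shift -[Z2_add _ _]/(Z2_succ (Z2t_proj z)) -solenoid_glue
  add0r.
Defined.

Lemma Tfrak_solenoidE s z x :
  Tfrak_solenoid (Tfrak_class (s, z, x)) = solenoid_class (Z2t_proj z, \val x).
Proof. by rewrite /Tfrak_solenoid; case: quotient_lift => h /= ->. Qed.

Lemma Tfrak_solenoid_Sfrak y : Tfrak_solenoid (Sfrak_Tfrak y) = Sfrak_solenoid y.
Proof.
have [w <-] := class_surj y; rewrite -[class sim w]/(Sfrak_class w).
rewrite Sfrak_Tfrak_class /Sfrak_solenoid ThetaE torus_solenoidE.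
by rewrite /Psi Tfrak_solenoidE to_Z2t_proj.
Qed.

End Sfrak.

Theorem theorem2 (R : realType) :
  RelationClasses.Equivalence sim /\
  (compact [set: Sfrak] /\ metrizable R Sfrak /\ connected [set: Sfrak]) /\
  (exists p : Sfrak -> circle R,
     fibre_bundle L p /\
     homeomorphism mu /\
     exists iota : L -> p @^-1` [set circle_class 0],
       homeomorphism iota /\
       forall (z : L) (y : Sfrak),
         monodromy p (\val (iota z)) y <-> y = \val (iota (mu z))) /\
  (exists f : Sfrak -> solenoid R,
     quotient_map f /\
     (forall w : Lhat, f (Sfrak_class w) = solenoid_class (forget R w)) /\
     (forall x : solenoid R, f @^-1` [set x] #= `I_2 \/ f @^-1` [set x] #= `I_4) /\
     (exists r : Tfrak R -> suspension R,
        quotient_map r /\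
        (forall s z x, r (Tfrak_class (s, z, x)) = suspension_class (z, x)) /\
        (forall y : suspension R, r @^-1` [set y] #= `I_2)) /\
     (exists (h : Sfrak -> Tfrak R) (M : Sfrak -> Sfrak) (A : Tfrak R -> Tfrak R)
             (g : Tfrak R -> solenoid R),
        homeomorphism h /\
        homeomorphism M /\
        (forall w : Lhat, M (Sfrak_class w) = Sfrak_class (muhat w)) /\
        homeomorphism A /\
        (forall s z x, A (Tfrak_class (s, z, x)) =
           Tfrak_class (s (+) phi (Z2t_shift 1 z), Z2t_shift 1 z, x)) /\
        (forall y : Sfrak, h (M y) = A (h y)) /\
        (forall s z x, g (Tfrak_class (s, z, x)) =
           solenoid_class (Z2t_proj z, \val x)) /\
        (forall y : Sfrak, g (h y) = f y))).
Proof.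
split; first exact: (@sim_equivalence R).
split; first by split; [exact: Sfrak_compact|split;
  [exact: Sfrak_metrizable|exact: (@Sfrak_connected R)]].
split.
  have [_ [m [cm muK mK]]] := mu_homeomorphism.
  have [cH [H' [cH' HK H'K]]] := @Theta_homeomorphism R.
  exists (bundle_map (H := @Theta R)); split.
    exact: (torus_fibre_bundle muK mK mu_continuous cm cH cH' HK H'K).
  split; first exact: mu_homeomorphism.
  exists (@fibre_inclusion R L Sfrak mu m (@Theta R) H' H'K); split.
    apply: (fibre_inclusion_homeomorphism muK mK mu_continuous cm cH' HK H'K
      L_compact (@Sfrak_hausdorff R)).
  move=> z y; apply: (monodromyP muK mK mu_continuous cm cH cH' HK H'K);
    exact: L_separated.
exists Sfrak_solenoid; split; first exact: Sfrak_solenoid_quotient.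
split; first exact: Sfrak_solenoid_class.
split; first exact: Sfrak_solenoid_fibre.
split.
  exists Tfrak_to_suspension; split; first exact: Tfrak_to_suspension_quotient.
  by split; [exact: Tfrak_to_suspensionE|exact: Tfrak_to_suspension_fibre].
have hh := @Sfrak_Tfrak_homeomorphism R.
have [h' [hh' hK h'K]] := homeomorphism_inv hh.
have hA : homeomorphism (@Tfrak_shift R).
  exact: torus_map_homeomorphism add_cocycle_homeomorphism.
(* The second witness is transported from the cocycle action, hence is a homeomorphism at once; that
   it is induced by [muhat] is then an identity between classes, checked after applying the first
   witness. *)
exists Sfrak_Tfrak, (h' \o (Tfrak_shift \o Sfrak_Tfrak)), Tfrak_shift,
  Tfrak_solenoid.
split=> //; split; first by apply: homeomorphism_comp hh';
  exact: homeomorphism_comp hh hA.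
split.
  move=> w; apply: (can_inj hK); rewrite /= h'K !Sfrak_Tfrak_class.
  by rewrite /Tfrak_shift torus_mapE -Psi_mu right_part_glue left_digits_glue.
split=> //; split; first by move=> s z x; rewrite /Tfrak_shift torus_mapE.
split; first by move=> y; rewrite /= h'K.
by split; [exact: Tfrak_solenoidE|exact: Tfrak_solenoid_Sfrak].
Qed.
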